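(* Let $S_k$, $k\ge0$, be a random walk ($S_0=0$, i.i.d. increments) with $\mathbf E S_1=0$, and let $\bar S_n=\{\bar S_n(t),t\in[0,1]\}$ with $\bar S_n(t)=S_{[nt]}/n$. Suppose that $\mathbf P(S_1\ge x)$ is regularly varying at infinity with index $-\alpha$ and $\mathbf P(S_1\le-x)$ is regularly varying at infinity with index $-\beta$, where $\alpha,\beta>1$. Let $A\subseteq\mathbb D$ be a measurable set such that $$\mathop{\mathrm{arg\,min}}_{(j,k)\in\mathbb Z_+^2,\ \mathbb D_{j,k}\cap A\ne\emptyset}\ \big[(\alpha-1)j+(\beta-1)k\big]$$ is non-empty, let $(\mathcal J(A),\mathcal K(A))$ be an element of it, and suppose that $A$ is bounded away from $\mathbb D_{<\mathcal J(A),\mathcal K(A)}$. Then $$\liminf_{n\to\infty}\frac{\mathbf P(\bar S_n\in A)}{(n\mathbf P(S_1\ge n))^{\mathcal J(A)}(n\mathbf P(S_1\le-n))^{\mathcal K(A)}}\ge C_{\mathcal J(A),\mathcal K(A)}(A^\circ),$$ $$\limsup_{n\to\infty}\frac{\mathbf P(\bar S_n\in A)}{(n\mathbf P(S_1\ge n))^{\mathcal J(A)}(n\mathbf P(S_1\le-n))^{\mathcal K(A)}}\le C_{\mathcal J(A),\mathcal K(A)}(\bar A).$$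
   Context: Space: $\mathbb D=\mathbb D([0,1],\mathbb R)$ is the space of real-valued right-continuous functions with left limits on $[0,1]$ with the Skorokhod $J_1$ metric $d(x,y)=\inf_{\lambda\in\Lambda}\|\lambda-e\|\vee\|x\circ\lambda-y\|$ ($\Lambda$: non-decreasing homeomorphisms of $[0,1]$ onto itself, $e$ the identity, $\|\cdot\|$ supremum norm). $A^\circ,\bar A$ denote interior and closure. $A$ is bounded away from $B$ if $\inf_{x\in A,y\in B}d(x,y)>0$ (infimum over the empty set is $\infty$). $\mathbb Z_+$ is the set of non-negative integers; $[\cdot]$ is the integer part. $\mathbb D_{l,m}$: step functions vanishing at the origin with exactly $l$ upward jumps and $m$ downward jumps. $\mathbb I_{<j,k}=\{(l,m)\in\mathbb Z_+^2\setminus\{(j,k)\}:(\alpha-1)l+(\beta-1)m\le(\alpha-1)j+(\beta-1)k\}$ and $\mathbb D_{<j,k}=\bigcup_{(l,m)\in\mathbb I_{<j,k}}\mathbb D_{l,m}$. Limit measures: for $\gamma>1$ let $\nu_\gamma(x,\infty)=x^{-\gamma}$ on $(0,\infty)$ and $\nu_\gamma^j$ the restriction of its $j$-fold product to $\{x\in[0,\infty)^j:x_1\ge\cdots\ge x_j\}$. $C_{0,0}=\delta_{\mathbf 0}$ (Dirac measure at the zero function) and for $(j,k)\ne(0,0)$, $C_{j,k}(\cdot)=\mathbf E\big[\nu_\alpha^j\times\nu_\beta^k\{(x,y)\in(0,\infty)^j\times(0,\infty)^k:\sum_{i=1}^jx_i1_{[U_i,1]}-\sum_{i=1}^ky_i1_{[V_i,1]}\in\cdot\}\big]$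 with $U_i,V_i$ i.i.d. uniform on $[0,1]$. *)

(* Defs.v *)
From HB Require Import structures.
From mathcomp Require Import all_boot all_order all_algebra.
From mathcomp Require Import all_classical all_reals all_analysis.
From mathcomp Require Import measurable_realfun lra.

Set Implicit Arguments.
Unset Strict Implicit.
Unset Printing Implicit Defensive.

Import Order.TTheory GRing.Theory Num.Theory.
Import numFieldNormedType.Exports.

Local Open Scope classical_set_scope.
Local Open Scope ring_scope.

Definition unit_interval (R : realType) : Type :=
  set_type (`[0%R, 1%R]%classic : set R).

Section cadlag.
Variable R : realType.
Implicit Types (t : unit_interval R) (x : unit_interval R -> R).

Definition at_ge t : set_system (unit_interval R) :=
  within [set s | \val t <= \val s] (nbhs t).

(* This filter is improper at [\val t = 0]; a limit along it is then vacuous. *)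
Definition at_lt t : set_system (unit_interval R) :=
  within [set s | \val s < \val t] (nbhs t).

Definition cadlag x : Prop :=
  forall t, x @ at_ge t --> x t /\ cvg (x @ at_lt t).

Global Instance at_ge_filter t : Filter (at_ge t).
Proof. exact: within_filter. Qed.
Global Instance at_lt_filter t : Filter (at_lt t).
Proof. exact: within_filter. Qed.

Lemma unit_interval_itv t : 0 <= \val t <= 1.
Proof. by have := set_valP t; rewrite /= in_itv. Qed.

Lemma at_geP t (P : set (unit_interval R)) : at_ge t P <->
  exists2 e : R, 0 < e & forall s, \val t <= \val s < \val t + e -> P s.
Proof.
rewrite /at_ge /within /= /prop_near1; split.
  move=> /nbhs_ballP[e /= e0 eP]; exists e => // s /andP[ts se].
  apply: eP => //; rewrite /ball/= /initial_ball /ball/=.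
  by rewrite distrC ger0_norm ?subr_ge0// ltrBlDl.
case=> e e0 eP; apply/nbhs_ballP; exists e => //= s.
rewrite /ball/= /initial_ball /ball/= => + ts; rewrite distrC.
by rewrite ger0_norm ?subr_ge0// ltrBlDl => se; apply: eP; rewrite ts.
Qed.

Lemma at_ltP t (P : set (unit_interval R)) : at_lt t P <->
  exists2 e : R, 0 < e & forall s, \val t - e < \val s < \val t -> P s.
Proof.
rewrite /at_lt /within /= /prop_near1; split.
  move=> /nbhs_ballP[e /= e0 eP]; exists e => // s /andP[se st].
  apply: eP => //; rewrite /ball/= /initial_ball /ball/=.
  by rewrite ger0_norm ?subr_ge0 1?ltW// ltrBlDl -ltrBlDr.
case=> e e0 eP; apply/nbhs_ballP; exists e => //= s.
rewrite /ball/= /initial_ball /ball/= => + st.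
by rewrite ger0_norm ?subr_ge0 1?ltW// ltrBlDl -ltrBlDr => se; apply: eP; rewrite se.
Qed.

Lemma cadlag_bounded x : cadlag x -> exists M, forall t, `|x t| <= M.
Proof.
have near1 (a b : R) : `|a - b| < 1 -> `|b| <= `|a| + 1.
  by move=> ab; rewrite -lerBlDl (le_trans (lerB_dist b a))// distrC ltW.
move=> xc.
have /compact_near_coveringP := @segment_compact R 0 1.
move=> /(_ R (+oo%R) (fun M r => forall t, \val t = r -> `|x t| <= M)) [].
  move=> r r01; pose t : unit_interval R := exist _ r (mem_set r01).
  have [/cvgrPdist_lt/(_ 1 ltr01)/at_geP[e e0 xr]] := xc t.
  move=> /cvg_ex[l /cvgrPdist_lt/(_ 1 ltr01)/at_ltP[e' e'0 xl]].
  exists (ball r (Num.min e e'), [set M | `|x t| + `|l| + 1 <= M]).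
    split=> /=; last exact: nbhs_pinfty_ge.
    by apply: nbhsx_ballx; rewrite lt_min e0.
  move=> [s M] /= []; rewrite /ball/= lt_min => /andP[se se'] lM u us; have {}us : \val u = s by [].
  apply: le_trans lM; have [ru|ur] := leP r (\val u).
    have /xr/near1/le_trans : \val t <= \val u < \val t + e.
      by rewrite ru us -ltrBlDl (le_lt_trans (ler_norm _))// distrC.
    by apply; rewrite addrAC lerDl.
  have /xl/near1/le_trans : \val t - e' < \val u < \val t.
    by rewrite ur andbT us ltrBlDl -ltrBlDr (le_lt_trans (ler_norm _)).
  by apply; rewrite -addrA lerDr.
move=> M [_ HM]; exists (M + 1) => t.
apply: (HM (M + 1) _ (\val t)) => //=; first by rewrite ltrDl.
by rewrite in_itv/= unit_interval_itv.
Qed.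


Lemma cadlag_cst (c : R) : cadlag (fun=> c).
Proof. by move=> t; split; [exact: cvg_cst|exact: is_cvg_cst]. Qed.

Lemma cadlagD x y : cadlag x -> cadlag y -> cadlag (fun t => x t + y t).
Proof.
move=> xc yc t; have [xr xl] := xc t; have [yr yl] := yc t.
by split; [exact: cvgD|exact: is_cvgD].
Qed.

Lemma cadlagN x : cadlag x -> cadlag (fun t => - x t).
Proof.
by move=> xc t; have [xr xl] := xc t; split; [exact: cvgN|exact: is_cvgN].
Qed.

Lemma cadlag_sum n (x : 'I_n -> unit_interval R -> R) :
  (forall i, cadlag (x i)) -> cadlag (fun t => \sum_(i < n) x i t).
Proof.
elim: n x => [|n IH] x xc.
  by under eq_fun do rewrite big_ord0; exact: cadlag_cst.
by under eq_fun do rewrite big_ord_recl; apply: cadlagD => //; exact: IH.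
Qed.

Lemma cadlag_locally_cst x :
  (forall t, exists2 e, 0 < e &
    forall s, \val t <= \val s < \val t + e -> x s = x t) ->
  (forall t, exists2 e, 0 < e &
    exists l, forall s, \val t - e < \val s < \val t -> x s = l) ->
  cadlag x.
Proof.
move=> xr xl t; split.
  have [e e0 xe] := xr t; apply: cvg_near_cst.
  by apply/at_geP; exists e => // s /xe ->.
have [e e0 [l xe]] := xl t; apply/cvg_ex; exists l; apply: cvg_near_cst.
by apply/at_ltP; exists e => // s /xe ->.
Qed.

Lemma cadlag_step (u z : R) : cadlag (fun t => z * (u <= \val t)%R%:R).
Proof.
apply: cadlag_locally_cst => t.
  have [ut|tu] := leP u (\val t).
    by exists 1 => // s /andP[ts _]; rewrite (le_trans ut ts).
  exists (u - \val t); first by rewrite subr_gt0.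
  by move=> s /andP[_]; rewrite addrC subrK ltNge => /negbTE ->.
have [tu|ut] := leP (\val t) u.
  exists 1 => //; exists 0 => s /andP[_ st].
  by rewrite leNgt (lt_le_trans st tu) mulr0.
exists (\val t - u); first by rewrite subr_gt0.
by exists (z * 1) => s /andP[]; rewrite opprB addrC subrK => /ltW ->.
Qed.

Lemma cadlag_truncn (a : nat -> R) (n : nat) :
  cadlag (fun t => a (Num.truncn (n%:R * \val t))).
Proof.
case: n => [|n]; first by under eq_fun do rewrite mul0r; exact: cadlag_cst.
have n0 : 0 < n.+1%:R :> R by [].
apply: cadlag_locally_cst => t; have /andP[t0 t1] := unit_interval_itv t.
  pose k := Num.truncn (n.+1%:R * \val t).
  have kt : k%:R <= n.+1%:R * \val t < k.+1%:R.
    by apply: truncn_itv; rewrite mulr_ge0.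
  exists (k.+1%:R / n.+1%:R - \val t).
    by rewrite subr_gt0 ltr_pdivlMr// mulrC; case/andP: kt.
  move=> s /andP[ts]; rewrite addrC subrK ltr_pdivlMr// mulrC => sk.
  congr (a _); apply/truncn_def; rewrite -/k.
  by case/andP: kt => kt _; rewrite sk andbT (le_trans kt)// ler_pM2l.
have [->|tn0] := eqVneq (\val t) 0.
  exists 1 => //; exists 0 => s /andP[_].
  by rewrite ltNge; have /andP[-> _] := unit_interval_itv s.
have tp : 0 < \val t by rewrite lt_def tn0.
have [k /andP[kt tk]] : exists k : nat, k%:R < n.+1%:R * \val t <= k.+1%:R.
  pose m := Num.truncn (n.+1%:R * \val t).
  have /andP[mt tm] : m%:R <= n.+1%:R * \val t < m.+1%:R.
    by apply: truncn_itv; rewrite mulr_ge0.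
  move: mt; rewrite le_eqVlt => /predU1P[mt|mt]; last first.
    by exists m; rewrite mt ltW.
  case: m mt {tm} => [|m] mt; last by exists m; rewrite -mt lexx ltr_nat andbT.
  by move: (mulr_gt0 n0 tp); rewrite -mt ltxx.
exists (\val t - k%:R / n.+1%:R).
  by rewrite subr_gt0 ltr_pdivrMr// mulrC.
exists (a k) => s /andP[]; rewrite opprB addrC subrK ltr_pdivrMr// mulrC => ks st.
congr (a _); apply/truncn_def; rewrite (ltW ks)/= (lt_le_trans _ tk)//.
by rewrite ltr_pM2l.
Qed.

End cadlag.

Record skorokhod (R : realType) := Skorokhod {
  skorokhod_fun :> unit_interval R -> R ;
  skorokhod_cadlag : cadlag skorokhod_fun }.

HB.instance Definition _ (R : realType) := gen_eqMixin (skorokhod R).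
HB.instance Definition _ (R : realType) := gen_choiceMixin (skorokhod R).

Definition zero_path (R : realType) : skorokhod R := Skorokhod (cadlag_cst 0).

HB.instance Definition _ (R : realType) :=
  isPointed.Build (skorokhod R) (zero_path R).

Section skorokhod_metric.
Variable R : realType.
Implicit Types (x y z : skorokhod R) (f : unit_interval R -> R)
  (lam : unit_interval R -> unit_interval R) (t : unit_interval R).

Definition time_change lam : Prop := exists mu : unit_interval R -> unit_interval R,
  [/\ continuous lam, continuous mu, cancel lam mu, cancel mu lam &
      {homo lam : s t / \val s <= \val t}].

Definition supnorm f : R := sup (range (fun t => `|f t|)).

(* The suprema are finite, by [cadlag_bounded]; see [skorokhod_costP]. *)
Definition skorokhod_cost lam x y : R :=
  Num.max (supnorm (fun t => \val (lam t) - \val t))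
          (supnorm (fun t => x (lam t) - y t)).

Definition skorokhod_dist x y : R :=
  inf [set skorokhod_cost lam x y | lam in time_change].

Lemma skorokhodP x y : x =1 y -> x = y.
Proof.
case: x y => [x xc] [y yc] /= /funext xy; subst y.
by congr Skorokhod; exact: Prop_irrelevance.
Qed.

Lemma unit_interval_inj t (s : unit_interval R) : \val t = \val s -> t = s.
Proof. exact: val_inj. Qed.

Lemma time_change_id : time_change id.
Proof. by exists id; split=> // t; exact: cvg_id. Qed.

Lemma time_change_inv lam mu : continuous lam -> continuous mu ->
  cancel lam mu -> cancel mu lam -> {homo lam : s t / \val s <= \val t} ->
  time_change mu.
Proof.
move=> lc mc lK mK lh; exists lam; split=> // s t st.
rewrite leNgt; apply/negP => ts.
have := lh _ _ (ltW ts); rewrite !mK => ts'.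
have e : s = t by apply: unit_interval_inj; apply/eqP; rewrite eq_le st.
by rewrite e ltxx in ts.
Qed.

Lemma time_change_comp lam mu :
  time_change lam -> time_change mu -> time_change (lam \o mu).
Proof.
move=> [lam' [lc lc' lK lK' lh]] [mu' [mc mc' mK mK' mh]].
exists (mu' \o lam'); split.
- by move=> t; apply: continuous_comp; [exact: mc|exact: lc].
- by move=> t; apply: continuous_comp; [exact: lc'|exact: mc'].
- exact: can_comp.
- exact: can_comp.
- by move=> s t /mh /lh.
Qed.

Lemma unit_interval_exists (r : R) : 0 <= r <= 1 -> {t : unit_interval R | \val t = r}.
Proof. by move=> r01; exists (exist _ r (mem_set r01)). Qed.

Lemma supnormP f M : (exists B, forall t, `|f t| <= B) ->
  supnorm f <= M <-> forall t, `|f t| <= M.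
Proof.
move=> [B fB]; split=> [fM t|fM].
  apply: le_trans fM; apply: ub_le_sup; last by exists t.
  by exists B => _ [s _ <-].
have [t0 _] := @unit_interval_exists 0 ltac:(by rewrite lexx ler01).
by apply: ge_sup => [|_ [s _ <-]//]; exists `|f t0|; exists t0.
Qed.

Lemma skorokhod_costP lam x y M : skorokhod_cost lam x y <= M <->
  forall t, `|\val (lam t) - \val t| <= M /\ `|x (lam t) - y t| <= M.
Proof.
have bl : exists B, forall t, `|\val (lam t) - \val t| <= B.
  exists 1 => t; have /andP[t0 t1] := unit_interval_itv t.
  have /andP[l0 l1] := unit_interval_itv (lam t).
  by rewrite ler_norml; apply/andP; split; lra.
have bx : exists B, forall t, `|x (lam t) - y t| <= B.
  have [Bx xB] := cadlag_bounded (skorokhod_cadlag x).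
  have [By yB] := cadlag_bounded (skorokhod_cadlag y).
  by exists (Bx + By) => t; rewrite (le_trans (ler_normB _ _))// lerD.
rewrite /skorokhod_cost ge_max; split.
  by move=> /andP[/(supnormP _ bl) lM /(supnormP _ bx) xM] t; split.
move=> H; apply/andP; split.
  by apply/(supnormP _ bl) => t; have [] := H t.
by apply/(supnormP _ bx) => t; have [] := H t.
Qed.

Lemma skorokhod_cost_ge0 lam x y : 0 <= skorokhod_cost lam x y.
Proof.
have [t _] := @unit_interval_exists 0 ltac:(by rewrite lexx ler01).
have /skorokhod_costP/(_ t)[] := lexx (skorokhod_cost lam x y).
by move=> + _; exact: le_trans.
Qed.

Lemma skorokhod_dist_le lam x y :
  time_change lam -> skorokhod_dist x y <= skorokhod_cost lam x y.
Proof.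
move=> tl; apply: ge_inf; last by exists lam.
by exists 0 => _ [mu _ <-]; exact: skorokhod_cost_ge0.
Qed.

Lemma skorokhod_dist_nonempty x y :
  [set skorokhod_cost lam x y | lam in time_change] !=set0.
Proof. by exists (skorokhod_cost id x y), id => //; exact: time_change_id. Qed.

Lemma skorokhod_dist_lt x y M : skorokhod_dist x y < M ->
  exists2 lam, time_change lam & skorokhod_cost lam x y < M.
Proof.
move=> /inf_lt -/(_ (skorokhod_dist_nonempty x y))[_ [lam tl <-] lM].
by exists lam.
Qed.

Lemma skorokhod_distxx x : skorokhod_dist x x = 0.
Proof.
apply/eqP; rewrite eq_le; apply/andP; split.
  apply: (le_trans (skorokhod_dist_le x x time_change_id)).
  by apply/skorokhod_costP => t; rewrite !subrr normr0.
apply: lb_le_inf; first exact: skorokhod_dist_nonempty.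
by move=> _ [mu _ <-]; exact: skorokhod_cost_ge0.
Qed.

Lemma skorokhod_dist_sym x y : skorokhod_dist x y = skorokhod_dist y x.
Proof.
suff dle u v : skorokhod_dist u v <= skorokhod_dist v u.
  by apply/eqP; rewrite eq_le !dle.
apply: lb_le_inf; first exact: skorokhod_dist_nonempty.
move=> _ [lam [mu [lc mc lK mK lh]] <-].
apply: (le_trans (skorokhod_dist_le u v (time_change_inv lc mc lK mK lh))).
apply/skorokhod_costP => t.
have /skorokhod_costP/(_ (mu t))[] := lexx (skorokhod_cost lam v u).
by rewrite mK => l1 l2; split; rewrite distrC.
Qed.

Lemma skorokhod_dist_triangle y x z :
  skorokhod_dist x z <= skorokhod_dist x y + skorokhod_dist y z.
Proof.
apply/ler_addgt0Pr => e e0; have e20 : 0 < e / 2 by rewrite divr_gt0.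
have [lam tl lM] : exists2 lam, time_change lam &
  skorokhod_cost lam x y < skorokhod_dist x y + e / 2.
  by apply: skorokhod_dist_lt; rewrite ltrDl.
have [mu tm mM] : exists2 mu, time_change mu &
  skorokhod_cost mu y z < skorokhod_dist y z + e / 2.
  by apply: skorokhod_dist_lt; rewrite ltrDl.
apply: (le_trans (skorokhod_dist_le x z (time_change_comp tl tm))).
rewrite (splitr e) addrACA.
apply/skorokhod_costP => t /=.
have /skorokhod_costP/(_ (mu t))[l1 l2] := ltW lM.
have /skorokhod_costP/(_ t)[m1 m2] := ltW mM.
split.
  exact: le_trans (ler_distD (\val (mu t)) _ _) (lerD l1 m1).
exact: le_trans (ler_distD (y (mu t)) _ _) (lerD l2 m2).
Qed.

Lemma skorokhod_dist_positivity x y : skorokhod_dist x y = 0 -> x = y.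
Proof.
move=> xy0; apply: skorokhodP => t; apply/eqP; rewrite -subr_eq0 -normr_le0.
apply/ler_addgt0Pr => e e0; rewrite add0r.
have close d : 0 < d -> exists2 lam, time_change lam & forall s,
    `|\val (lam s) - \val s| < d /\ `|x (lam s) - y s| < d.
  move=> d0; have /skorokhod_dist_lt[lam tl ld] : skorokhod_dist x y < d.
    by rewrite xy0.
  exists lam => // s.
  have /skorokhod_costP/(_ s)[l1 l2] := lexx (skorokhod_cost lam x y).
  by split; exact: le_lt_trans ld.
have e30 : 0 < e / 3 by rewrite divr_gt0.
have /andP[t0 t1] := unit_interval_itv t.
move: t1; rewrite le_eqVlt => /predU1P[t1|t1].
  have [lam [mu [_ _ lK mK lh]] ld] := close _ e0.
  have lt : lam t = t.
    apply: unit_interval_inj; apply/eqP; rewrite eq_le.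
    have -> /= : \val (lam t) <= \val t.
      by rewrite t1; case/andP: (unit_interval_itv (lam t)).
    rewrite -{1}(mK t); apply: lh; rewrite t1.
    by case/andP: (unit_interval_itv (mu t)).
  by have [_] := ld t; rewrite lt => /ltW.
have [/cvgrPdist_lt/(_ _ e30)/at_geP[d1 d10 xd] _] := skorokhod_cadlag x t.
have [/cvgrPdist_lt/(_ _ e30)/at_geP[d2 d20 yd] _] := skorokhod_cadlag y t.
pose d := Num.min (Num.min d1 d2) (1 - \val t).
have d0 : 0 < d by rewrite !lt_min d10 d20 subr_gt0.
have dd1 : d <= d1 by rewrite !ge_min lexx.
have dd2 : d <= d2 by rewrite !ge_min lexx orbT.
have d1t : d <= 1 - \val t by rewrite ge_min lexx orbT.
have [s st] : {s : unit_interval R | \val s = \val t + d / 2}.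
  by apply: unit_interval_exists; apply/andP; split; move: d0 t0 d1t; clear; lra.
have [|lam _ /(_ s)[]] := close (Num.min (e / 3) (d / 2)).
  by rewrite lt_min e30 divr_gt0.
rewrite !lt_min => /andP[_ ls] /andP[xys _].
move: ls; rewrite ltr_norml => /andP[ls1 ls2].
have xl : `|x t - x (lam s)| < e / 3.
  by apply: xd; apply/andP; split; move: d0 dd1 st ls1 ls2; clear; lra.
have yl : `|y t - y s| < e / 3.
  by apply: yd; apply/andP; split; move: d0 dd2 st; clear; lra.
rewrite distrC in yl.
have -> : x t - y t = (x t - x (lam s)) + ((x (lam s) - y s) + (y s - y t)).
  by rewrite addrA subrKA addrA subrK.
rewrite (le_trans (ler_normD _ _))//.
by have := ler_normD (x (lam s) - y s) (y s - y t); move: xl xys yl; clear; lra.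
Qed.

End skorokhod_metric.

HB.instance Definition _ (R : realType) := isMetric.Build R (skorokhod R)
  (@skorokhod_distxx R) (@skorokhod_dist_positivity R)
  (@skorokhod_dist_sym R) (@skorokhod_dist_triangle R).

HB.instance Definition _ (R : realType) :=
  @isMeasurable.Build (sigma_display (@open (skorokhod R))) (skorokhod R)
    <<s @open (skorokhod R) >> (@sigma_algebra0 _ setT _) (@sigma_algebraC _ _)
    (@sigma_algebra_bigcup _ setT _).


Section step_paths.
Variable R : realType.
Implicit Types (x : skorokhod R) (t u : unit_interval R).

Definition left_limit x t : R := lim (x @ at_lt t).

Definition up_jumps x : set (unit_interval R) :=
  [set t | 0 < \val t /\ left_limit x t < x t].

Definition down_jumps x : set (unit_interval R) :=
  [set t | 0 < \val t /\ x t < left_limit x t].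

(* Piecewise constant with finitely many pieces, [s] listing the breakpoints. *)
Definition step_path x : Prop := exists s : seq R, forall t u,
  \val t <= \val u -> (forall c, c \in s -> ~ (\val t < c <= \val u)) ->
  x t = x u.

Definition step_paths (l m : nat) : set (skorokhod R) :=
  [set x | [/\ step_path x, forall t, \val t = 0 -> x t = 0,
    (up_jumps x #= `I_l)%card & (down_jumps x #= `I_m)%card]].

Definition jump_cost (alpha beta : R) (lm : nat * nat) : R :=
  (alpha - 1) * lm.1%:R + (beta - 1) * lm.2%:R.

Definition I_lt (alpha beta : R) (j k : nat) : set (nat * nat) :=
  [set lm | lm <> (j, k) /\
    jump_cost alpha beta lm <= jump_cost alpha beta (j, k)].

Definition step_paths_lt (alpha beta : R) (j k : nat) : set (skorokhod R) :=
  \bigcup_(lm in I_lt alpha beta j k) step_paths lm.1 lm.2.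

Definition argmin_jump_cost (alpha beta : R) (A : set (skorokhod R)) :
    set (nat * nat) :=
  let feasible := [set jk | step_paths jk.1 jk.2 `&` A !=set0] in
  [set jk | feasible jk /\ forall lm, feasible lm ->
    jump_cost alpha beta jk <= jump_cost alpha beta lm].

Definition bounded_away (A B : set (skorokhod R)) : Prop :=
  (0 < ereal_inf [set (mdist xy.1 xy.2)%:E | xy in A `*` B])%E.

End step_paths.

Section limit_measures.
Variable R : realType.
Implicit Types (gamma alpha beta : R) (mu : set R -> \bar R).

Local Open Scope ereal_scope.

(* [nu_tail] below shows that this density gives the tail [x `^ (- gamma)]. *)
Definition nu gamma (A : set R) : \bar R :=
  \int[lebesgue_measure]_(x in A `&` `]0%R, +oo[)
    (gamma * x `^ (- gamma - 1))%:E.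

Lemma nu_tail gamma (x : R) : (0 < gamma)%R -> (0 < x)%R ->
  nu gamma `]x, +oo[ = (x `^ (- gamma))%:E.
Proof.
move=> g0 x0.
rewrite /nu setIidl; last first.
  by move=> z /=; rewrite !in_itv/= !andbT; exact: lt_trans.
pose f (z : R) : R := (gamma * z `^ (- gamma - 1))%R.
pose F (z : R) : R := (- z `^ (- gamma))%R.
have Fder (z : R) : (0 < z)%R -> is_derive z 1%R F (f z).
  move=> z0; have := is_deriveN (is_derive1_powR (- gamma) z0).
  by rewrite /f mulNr opprK.
have fder (z : R) : (0 < z)%R -> {for z, continuous f}.
  move=> z0; have [/derivable1_diffP/differentiable_continuous d _] :=
    is_derive1_powR (- gamma - 1) z0.
  by apply: cvgM; [exact: cvg_cst|exact: d].
have mf : measurable_fun `]x, +oo[ f.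
  apply: open_continuous_measurable_fun => //.
  by move=> z; rewrite inE/= in_itv/= andbT => /(lt_trans x0); exact: fder.
rewrite integral_itv_obnd_cbnd ?(@ge0_continuous_FTC2y R f F x 0); last 1 first.
- exact/measurable_EFinP.
- by rewrite /F sub0e -EFinN opprK.
- by move=> z _; rewrite mulr_ge0 ?powR_ge0 ?ltW.
- apply: continuous_in_subspaceT => z; rewrite inE/= in_itv/= andbT => xz.
  exact/fder/(lt_le_trans x0).
- rewrite -oppr0; apply: cvgN; apply/cvgrPdist_lt => e e0.
  near=> z; rewrite sub0r normrN ger0_norm ?powR_ge0// powRN.
  have z0 : (0 < z)%R by near: z; exact: nbhs_pinfty_gt.
  rewrite invf_plt ?posrE ?powR_gt0//.
  rewrite -[ltLHS](@powRr1) ?invr_ge0 ?ltW//.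
  rewrite -[X in (_ `^ X)%R](@mulVf _ gamma) ?gt_eqF// powRrM.
  apply: gt0_ltr_powR; rewrite ?nnegrE ?powR_ge0 ?ltW//.
- by move=> z /(lt_trans x0) z0; have [] := Fder z z0.
- apply: cvg_at_right_filter.
  by have [/derivable1_diffP/differentiable_continuous] := Fder x x0.
- move=> z; rewrite in_itv/= andbT => /(lt_trans x0) z0.
  by rewrite derive1E; have [] := Fder z z0.
Unshelve. all: by end_near.
Qed.

(* The [n]-fold product measure, for sigma-finite [mu]. *)
Fixpoint power_measure mu (n : nat) : set (n.-tuple R) -> \bar R :=
  match n with
  | 0 => \d_[tuple]
  | n'.+1 => pushforward (mu \x @power_measure mu n')
      (fun p : R * n'.-tuple R => [tuple of p.1 :: p.2])
  end.

Definition nu_power gamma (j : nat) (B : set (j.-tuple R)) : \bar R :=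
  power_measure (nu gamma)
    (B `&` [set x : j.-tuple R | sorted >=%R x /\ forall i, (0 <= tnth x i)%R]).

Lemma cadlag_jumps n (z u : n.-tuple R) :
  cadlag (fun t => \sum_(i < n) tnth z i * (tnth u i <= \val t)%R%:R)%R.
Proof. by apply: cadlag_sum => i; exact: cadlag_step. Qed.

Definition jump_path j k (u : j.-tuple R) (v : k.-tuple R)
    (x : j.-tuple R) (y : k.-tuple R) : skorokhod R :=
  Skorokhod (cadlagD (cadlag_jumps x u) (cadlagN (cadlag_jumps y v))).

Definition uniform01 : set R -> \bar R := uniform_prob (@ltr01 R).

(* The integral over [uv] is the expectation over the i.i.d. uniform jump times,
   whose joint law is the product of uniform laws. *)
Definition limit_measure alpha beta (j k : nat) (B : set (skorokhod R)) : \bar R :=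
  if (j == 0)%N && (k == 0)%N then \d_(zero_path R) B else
  \int[@power_measure uniform01 j \x @power_measure uniform01 k]_uv
    (@nu_power alpha j \x @nu_power beta k)
      [set xy | [/\ forall i, (0 < tnth xy.1 i)%R, forall i, (0 < tnth xy.2 i)%R &
        B (jump_path uv.1 uv.2 xy.1 xy.2)]].

End limit_measures.

Section random_walks.
Variable R : realType.

Definition regularly_varying (f : R -> R) (rho : R) : Prop :=
  [/\ measurable_fun setT f, (\forall x \near +oo, 0 < f x) &
    forall c, 0 < c -> f (c * x) / f x @[x --> +oo] --> c `^ rho].

Variables (d : measure_display) (Omega : measurableType d).
Variable P : probability Omega R.

Definition iid (X : nat -> {RV P >-> R}) : Prop :=
  (forall (s : seq nat) (B : nat -> set R), uniq s ->
    (forall i, measurable (B i)) ->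
    P (\bigcap_(i in [set` s]) X i @^-1` B i) =
    (\prod_(i <- s) P (X i @^-1` B i))%E) /\
  (forall i (B : set R), measurable B ->
    distribution P (X i) B = distribution P (X 0) B).

Definition random_walk (S : nat -> {RV P >-> R}) : Prop :=
  (forall w, S 0 w = 0) /\ iid (fun k => (S k.+1 - S k : {mfun Omega >-> R})).

Definition scaled_walk (S : nat -> {RV P >-> R}) (n : nat) (w : Omega) :
    skorokhod R :=
  Skorokhod (cadlag_truncn (fun k => S k w / n%:R) n).

End random_walks.

(* Main.v *)
Require Import Defs.
From HB Require Import structures.
From mathcomp Require Import all_boot all_order all_algebra.
From mathcomp Require Import all_classical all_reals all_analysis.
From mathcomp Require Import measurable_realfun ring lra zify.

(** The principle is that of a single big jump, taken with multiplicity: the walk reaches [A] in the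
    cheapest possible way, by [J] upward and [K] downward jumps of order [n], while all the other
    increments together contribute nothing on the scale [n]. The denominator of the ratio is
    [norming], the order of magnitude of the probability of having those jumps.

    Fix a small [eps] and call an increment large if it exceeds [eps * n] in absolute value. The
    other increments are truncated, centred up to a negligible error, and have a moment of order
    [p > 1]; an exponential bound at the level [theta * ln n / n] shows that their partial sums all
    stay below [rho * n], up to a probability that decays faster than a power of [n] given in
    advance, if [eps] is small enough ([small_jumps]). As [norming] decays like a power of [n], this exceptional event is invisible,
    and outside of it the scaled walk is within [rho] of the step path [big_path] made of the
    large increments.

    That step path has some numbers [l] and [m] of upward and downward jumps. If the walk is in [A]
    and [rho] is smaller than the distance [delta] from [A] to the cheaper step paths, then either
    [(l, m) = (J, K)] or [(l, m)] costs strictly more ([jump_counts]). The second case has a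
    probability negligible with respect to [norming] ([many_jumps_negligible]); only finitely many
    pairs are needed, by [cost_bounded]. In the first case none of the jumps is small, for the
    removal of a small jump would bring [A] near a cheaper step path ([jump_size_ge]).

    It remains to count the ways of making the [J + K] jumps. A choice of their indices is an
    injection [tau], and [tau_rv] is the point of times and sizes that it selects. Summed over [tau]
    and divided by [norming], the law of this point gives to a box, in the limit, at least the mass
    of the box for [jump_law], with uniform times and sizes of power density: the times are
    counted, the sizes are independent and regularly varying. Dyadic approximation from the inside turns this into a lower limit for all
    sets that are open in the coordinates ([open_lower]). This one-sided statement is enough for
    both halves. The path is a continuous function of the jump times and sizes as long as the times
    are distinct and in the open unit interval ([coord_open_path]), so that open conditions on the
    path are open conditions on the coordinates. For the lower bound one uses the open set [hit] of
    strictly ordered jumps whose path lies deep inside [A]; the order makes the events of different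
    [tau] disjoint. For the upper bound one subtracts, from the set of all jumps of sizes at least
    [delta / 2], whose mass is finite and explicit ([far_upper_limit]), the open set [miss] of the
    jumps that are not in order or whose path is far from [A].

    Letting [rho] tend to [0] turns the two sets into the interior and the closure of [A], up to
    null sets of [jump_law]: coinciding or extreme times, equal sizes, sizes equal to [delta / 2].
    Finally [limit_measureE] identifies the limit measure with [jump_law] restricted to ordered
    jumps. *)

Set Implicit Arguments.
Unset Strict Implicit.
Unset Printing Implicit Defensive.

Import Order.TTheory GRing.Theory Num.Theory.
Import numFieldNormedType.Exports.

Local Open Scope classical_set_scope.
Local Open Scope ring_scope.

(** * Probabilities as real numbers *)

Lemma measurable_set_exists d' (T' : measurableType d') (F : finType) (A : F -> set T') :
  (forall i, measurable (A i)) -> measurable [set z | exists i, A i z].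
Proof.
move=> mA; rewrite (_ : [set z | _] = \bigcup_(i in [set: F]) A i).
  by apply: fin_bigcup_measurable.
by apply/seteqP; split=> z /= [i]; exists i.
Qed.

Lemma measurable_set_forall d' (T' : measurableType d') (F : finType) (A : F -> set T') :
  (forall i, measurable (A i)) -> measurable [set z | forall i, A i z].
Proof.
move=> mA; rewrite (_ : [set t | _] = \bigcap_(i in [set: F]) A i).
  by apply: fin_bigcap_measurable.
by apply/seteqP; split => [t tB i _|t tB i]; [exact: tB|exact: (tB i Logic.I)].
Qed.

Section real_probability.
Context (R : realType) (d : measure_display) (Omega : measurableType d).
Variable P : probability Omega R.
Implicit Types A B : set Omega.

Definition prob A : R := fine (P A).

Lemma probE A : measurable A -> P A = (prob A)%:E.
Proof. by move=> mA; rewrite /prob fineK// fin_num_measure. Qed.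

Lemma prob_ge0 A : 0 <= prob A.
Proof. exact: fine_ge0. Qed.

Lemma prob_le A B : measurable A -> measurable B -> A `<=` B -> prob A <= prob B.
Proof.
by move=> mA mB AB; rewrite -lee_fin -!probE//; apply: le_measure; rewrite ?inE.
Qed.

Lemma prob_le1 A : measurable A -> prob A <= 1.
Proof. by move=> mA; rewrite -lee_fin -probE//; exact: probability_le1. Qed.

Lemma prob_setT : prob setT = 1.
Proof. by rewrite /prob probability_setT. Qed.

Lemma prob_setC A : measurable A -> prob (~` A) = 1 - prob A.
Proof.
move=> mA; apply: EFin_inj; rewrite EFinB -!probE//; last exact: measurableC.
exact: probability_setC.
Qed.

Lemma probU_le A B : measurable A -> measurable B -> prob (A `|` B) <= prob A + prob B.
Proof.
move=> mA mB; rewrite -lee_fin EFinD -!probE//; last exact: measurableU.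
exact: measureU2.
Qed.

Lemma probU A B : measurable A -> measurable B -> A `&` B = set0 ->
  prob (A `|` B) = prob A + prob B.
Proof.
move=> mA mB AB; apply: EFin_inj; rewrite EFinD -!probE//; last exact: measurableU.
exact: measureU.
Qed.

Section finite_unions.
Variables (F : finType) (A : F -> set Omega).
Hypothesis mA : forall i, measurable (A i).

Let U (s : seq F) := [set w | exists2 i, i \in s & A i w].

Let US i s : U (i :: s) = A i `|` U s.
Proof.
apply/seteqP; split=> z /=; last first.
  by move=> [Az|[g gs Az]]; [exists i => //; exact: mem_head|exists g => //; rewrite inE gs orbT].
by move=> [g]; rewrite inE => /predU1P[->|gs]; [left|right; exists g].
Qed.

Let U0 : U [::] = set0. Proof. by rewrite -subset0 => w []. Qed.

Let mU s : measurable (U s).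
Proof. by elim: s => [|i s IH]; rewrite ?U0// US; exact: measurableU. Qed.

Let UT : U (enum F) = [set w | exists i, A i w].
Proof. by apply/seteqP; split=> w [i]; exists i; rewrite ?mem_enum. Qed.

Lemma prob_exists_le : prob [set w | exists i, A i w] <= \sum_i prob (A i).
Proof.
rewrite -UT -big_enum; elim: (enum F) => [|i s IH].
  by rewrite U0 big_nil /prob measure0.
by rewrite US big_cons (le_trans (probU_le _ _))// lerD2l.
Qed.

Lemma prob_exists : (forall i j w, A i w -> A j w -> i = j) ->
  prob [set w | exists i, A i w] = \sum_i prob (A i).
Proof.
move=> dis; rewrite -UT -big_enum; have := enum_uniq F.
elim: (enum F) => [|i s IH] /=; first by rewrite U0 big_nil /prob measure0.
move=> /andP[ins us]; rewrite US big_cons probU ?IH//.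
rewrite -subset0 => w [Ai [j js /(dis _ _ _ Ai) ij]].
by move: ins; rewrite ij js.
Qed.

End finite_unions.

End real_probability.

(** * Tails of regular variation *)

Section regular_variation.
Variable R : realType.
Implicit Types (u v : nat -> R) (p q : R).

(** The bookkeeping of orders of magnitude: all the error terms below are compared with powers of
    [n], and every loss in an exponent is absorbed by strict inequalities between costs. *)
Definition le_pow u p := exists2 C : R, 0 < C & \forall n \near \oo, `|u n| <= C * n%:R `^ p.

Lemma le_powM u v p q : le_pow u p -> le_pow v q -> le_pow (fun n => u n * v n) (p + q).
Proof.
move=> [C C0 uC] [D D0 vD]; exists (C * D); first exact: mulr_gt0.
near=> n.
have n0 : n%:R != 0 :> R by rewrite pnatr_eq0 -lt0n; near: n; exact: nbhs_infty_gt.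
rewrite normrM powRD; last by rewrite n0 implybT.
rewrite mulrACA ler_pM//; first by near: n.
by near: n.
Unshelve. all: by end_near. Qed.

Lemma le_pow_cst (c : R) : le_pow (fun=> c) 0.
Proof.
exists (`|c| + 1); first by rewrite ltr_wpDl.
by near=> n; rewrite powRr0 mulr1 lerDl.
Unshelve. all: by end_near. Qed.

Lemma le_powX u p k : le_pow u p -> le_pow (fun n => u n ^+ k) (p * k%:R).
Proof.
move=> up; elim: k => [|k IH].
  by rewrite mulr0; under eq_fun do rewrite expr0; exact: le_pow_cst.
rewrite -natr1 mulrDr mulr1 addrC; under eq_fun do rewrite exprS.
exact: le_powM.
Qed.

Lemma cvg_powRN (p : R) : p < 0 -> n%:R `^ p @[n --> \oo] --> (0 : R).
Proof.
move=> p0; apply/cvgrPdist_lt => e e0; near=> n.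
have n0 : 0 < n%:R :> R by rewrite ltr0n; near: n; exact: nbhs_infty_gt.
rewrite sub0r normrN ger0_norm ?powR_ge0//.
have np : 0 < - p by rewrite oppr_gt0.
rewrite -(opprK p) powRN invf_plt ?posrE ?powR_gt0//.
rewrite -[ltLHS]powRr1 ?invr_ge0 ?ltW//.
rewrite -[X in _ `^ X < _](mulVf (lt0r_neq0 np)) powRrM.
apply: gt0_ltr_powR; rewrite ?nnegrE ?powR_ge0//.
by near: n; exact: nbhs_infty_gtr.
Unshelve. all: by end_near. Qed.

Lemma le_pow_cvg0 u p : p < 0 -> le_pow u p -> u @ \oo --> (0 : R).
Proof.
move=> p0 [C C0 uC]; apply: norm_cvg0.
apply: (@squeeze_cvgr _ _ _ _ (fun=> 0) (fun n => C * n%:R `^ p)).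
- by near=> n; rewrite normr_ge0; near: n.
- exact: cvg_cst.
- by rewrite -(mulr0 C); apply: cvgM; [exact: cvg_cst|exact: cvg_powRN].
Unshelve. all: by end_near. Qed.

Lemma le_pow_sub u v p : (\forall n \near \oo, `|u n| <= `|v n|) -> le_pow v p -> le_pow u p.
Proof.
move=> uv [C C0 vC]; exists C => //; near=> n.
by apply: (@le_trans _ _ `|v n|); near: n.
Unshelve. all: by end_near. Qed.

Lemma gt1_ltr_powRr (x p q : R) : 1 < x -> p < q -> x `^ p < x `^ q.
Proof.
move=> x1 pq; have x0 : x != 0 by rewrite gt_eqF// (lt_trans ltr01).
by rewrite /powR (negbTE x0) ltr_expR ltr_pM2r// ln_gt0.
Qed.

(** A bound on [f (2 * x) / f x] at all large [x], iterated over the dyadic scales, bounds the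
    growth of [f]. This weak form of the bounds of Potter needs no uniform convergence of the
    ratios. *)
Lemma doubling_bound (f : R -> R) (b x0 M : R) : 0 < x0 -> 0 <= M ->
  (forall x, x0 <= x -> f (2 * x) <= 2 `^ b * f x) ->
  (forall x, x0 <= x <= 2 * x0 -> f x <= M) ->
  exists2 C, 0 < C & forall x, x0 <= x -> f x <= C * x `^ b.
Proof.
move=> x00 M0 f2 fM.
pose c := Num.min (x0 `^ b) ((2 * x0) `^ b).
have c0 : 0 < c by rewrite lt_min !powR_gt0// mulr_gt0.
have cb x : x0 <= x <= 2 * x0 -> c <= x `^ b.
  move=> /andP[x0x xx0]; rewrite ge_min.
  have x_gt0 : 0 < x by exact: lt_le_trans x0x.
  have [b0|b0] := leP 0 b.
    by apply/orP; left; apply: ge0_ler_powR => //; rewrite nnegrE ltW.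
  apply/orP; right; rewrite -(opprK b) powRN (powRN x) lef_pV2 ?posrE ?powR_gt0 ?mulr_gt0//.
  apply: ge0_ler_powR => //; rewrite ?nnegrE ?oppr_ge0 ?ltW//.
  by rewrite mulr_gt0.
exists ((M + 1) / c); first by rewrite divr_gt0// ltr_wpDl.
have H k : forall x, x0 <= x <= 2 ^+ k.+1 * x0 -> f x <= (M + 1) / c * x `^ b.
  elim: k => [|k IH] x.
    rewrite expr1 => xx; rewrite (le_trans (fM _ xx))// -mulrA.
    rewrite (@le_trans _ _ (M + 1)) ?lerDl// ler_peMr ?addr_ge0//.
    by rewrite mulrC ler_pdivlMr// mul1r cb.
  move=> /andP[x0x xk]; have [xx|xx] := leP x (2 * x0).
    apply: IH; rewrite x0x/= (le_trans xx)// ler_wpM2r ?(ltW x00)//.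
    by rewrite -[leLHS]expr1 ler_eXn2l// ltr1n.
  have -> : x = 2 * (x / 2) by rewrite mulrC divfK.
  have hx : x0 <= x / 2 by rewrite ler_pdivlMr// mulrC ltW.
  have hx0 : 0 <= x / 2 by rewrite (le_trans _ hx)// ltW.
  rewrite (le_trans (f2 _ hx))// powRM// mulrCA ler_pM2l ?powR_gt0//.
  by apply: IH; rewrite hx/= ler_pdivrMr// mulrAC -exprSr.
move=> x x0x; apply: (H (Num.truncn (x / x0))).
rewrite x0x/= -ler_pdivrMr//.
have xx0 : 0 <= x / x0 by rewrite divr_ge0 ?ltW// (lt_le_trans x00).
have /andP[_ /ltW h] := truncn_itv xx0.
by rewrite (le_trans h)// -natrX ler_nat ltnW// ltn_expl.
Qed.

Variables (F : R -> R) (a : R).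
Hypothesis F_noninc : forall x y, x <= y -> F y <= F x.
Hypothesis F_gt0 : \forall x \near +oo, 0 < F x.
Hypothesis F_ratio : forall c, 0 < c -> F (c * x) / F x @[x --> +oo] --> c `^ (- a).

(** Regular variation only gives positivity near infinity; monotonicity spreads it everywhere. *)
Lemma tail_gt0 x : 0 < F x.
Proof.
have [y [xy Fy]] : exists y, x <= y /\ 0 < F y.
  have : \forall y \near +oo, x <= y /\ 0 < F y.
    by near=> y; split; near: y; [apply: nbhs_pinfty_ge; exact: num_real|exact: F_gt0].
  exact: filter_ex.
exact: lt_le_trans (F_noninc xy).
Unshelve. all: by end_near. Qed.

Lemma tail_le (eta : R) : 0 < eta ->
  exists x0, 0 < x0 /\ exists2 C, 0 < C & forall x, x0 <= x -> F x <= C * x `^ (- a + eta).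
Proof.
move=> eta0.
have lt2 : 2 `^ (- a) < (2 : R) `^ (- a + eta).
  by apply: gt1_ltr_powRr; rewrite ?ltr1n// ltrDl.
have [M [_ HM]] := cvgr_le _ (F_ratio (ltr0n _ 2)) _ lt2.
pose x0 := `|M| + 1.
have x00 : 0 < x0 by rewrite ltr_wpDl.
have Mx0 : M < x0 by rewrite ltr_pwDr// ler_norm.
exists x0; split => //; apply: (@doubling_bound F _ _ (F x0)) => //.
- exact/ltW/tail_gt0.
- move=> x x0x; rewrite -ler_pdivrMr ?tail_gt0//.
  by apply: HM; exact: lt_le_trans x0x.
- by move=> x /andP[x0x _]; exact: F_noninc.
Qed.

Lemma tailV_le (eta : R) : 0 < eta ->
  exists x0, 0 < x0 /\ exists2 C, 0 < C & forall x, x0 <= x -> (F x)^-1 <= C * x `^ (a + eta).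
Proof.
move=> eta0.
have lt2 : (2 : R) `^ (- (a + eta)) < 2 `^ (- a).
  by apply: gt1_ltr_powRr; rewrite ?ltr1n// opprD gtrDl oppr_lt0.
have [M [_ HM]] := cvgr_ge _ (F_ratio (ltr0n _ 2)) _ lt2.
pose x0 := `|M| + 1.
have x00 : 0 < x0 by rewrite ltr_wpDl.
have Mx0 : M < x0 by rewrite ltr_pwDr// ler_norm.
exists x0; split => //; apply: (@doubling_bound (fun x => (F x)^-1) _ _ (F (2 * x0))^-1) => //.
- by rewrite invr_ge0; exact/ltW/tail_gt0.
- move=> x x0x; rewrite -[2 `^ _]invrK -powRN -invfM lef_pV2 ?posrE ?mulr_gt0 ?powR_gt0 ?tail_gt0//.
  rewrite -ler_pdivlMr ?tail_gt0//.
  by apply: HM; exact: lt_le_trans x0x.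
- by move=> x /andP[_ x0x]; rewrite lef_pV2 ?posrE ?tail_gt0//; exact: F_noninc.
Qed.

Lemma tail_ratio_nat c : 0 < c -> F (c * n%:R) / F n%:R @[n --> \oo] --> c `^ (- a).
Proof.
move=> c0; apply: (cvg_comp (fun n : nat => n%:R : R) (fun x => F (c * x) / F x)).
  exact: cvgr_idn.
exact: F_ratio.
Qed.

Lemma tail_le_pow c eta : 0 < c -> 0 < eta ->
  le_pow (fun n => n%:R * F (c * n%:R)) (1 - a + eta).
Proof.
move=> c0 eta0; have [x0 [x00 [C C0 FC]]] := tail_le eta0.
exists (C * c `^ (- a + eta)); first by rewrite mulr_gt0 ?powR_gt0.
near=> n.
have n0 : 0 < n%:R :> R by rewrite ltr0n; near: n; exact: nbhs_infty_gt.
rewrite ger0_norm ?mulr_ge0 ?(ltW (tail_gt0 _))//.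
rewrite -addrA (@powRD _ n%:R 1); last by rewrite (gt_eqF n0) implybT.
rewrite powRr1// mulrCA ler_pM2l//.
rewrite -mulrA -powRM ?(ltW c0)//; apply: FC.
rewrite mulrC -ler_pdivrMr//; near: n; exact: nbhs_infty_ger.
Unshelve. all: by end_near. Qed.

Lemma tailV_le_pow eta : 0 < eta ->
  le_pow (fun n => (n%:R * F n%:R)^-1) (a - 1 + eta).
Proof.
move=> eta0; have [x0 [x00 [C C0 FC]]] := tailV_le eta0.
exists C => //; near=> n.
have n0 : 0 < n%:R :> R by rewrite ltr0n; near: n; exact: nbhs_infty_gt.
rewrite ger0_norm ?invr_ge0 ?mulr_ge0 ?(ltW (tail_gt0 _))//.
rewrite addrAC (@powRD _ n%:R (a + eta)); last by rewrite (gt_eqF n0) implybT.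
rewrite powRN powRr1// invfM mulrA mulrC.
rewrite ler_pM2r ?invr_gt0//; apply: FC.
near: n; exact: nbhs_infty_ger.
Unshelve. all: by end_near. Qed.

End regular_variation.

(** * Time changes and pure jump paths *)

Section time_changes.
Variable R : realType.
Implicit Types (lam mu : unit_interval R -> unit_interval R).

Lemma lipschitz_continuous lam (C : R) : 0 < C ->
  (forall s t, `|\val (lam s) - \val (lam t)| <= C * `|\val s - \val t|) ->
  continuous lam.
Proof.
move=> C0 lamC t U /nbhs_ballP[e /= e0 eU].
change (nbhs t (lam @^-1` U)); apply/nbhs_ballP; exists (e / C) => /=; first by rewrite divr_gt0.
move=> s; rewrite /ball/= /initial_ball /ball/= => ts; apply: eU.
rewrite /ball/= /initial_ball /ball/=.
by rewrite (le_lt_trans (lamC _ _))// mulrC -ltr_pdivlMr.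
Qed.

(** A perturbation of the identity with Lipschitz constant less than one is strictly increasing,
    and it is onto by the intermediate value theorem. *)
Lemma contraction_time_change (psi : R -> R) (L : R) : 0 <= L < 1 ->
  (forall s t, `|psi s - psi t| <= L * `|s - t|) -> psi 0 = 0 -> psi 1 = 0 ->
  exists2 lam, time_change lam & forall t, \val (lam t) = \val t + psi (\val t).
Proof.
move=> /andP[L0 L1] psiL psi0 psi1.
pose f t := t + psi t.
have expand s t : s <= t -> (1 - L) * (t - s) <= f t - f s <= (1 + L) * (t - s).
  move=> st; have ts : 0 <= t - s by rewrite subr_ge0.
  have := psiL t s; rewrite (ger0_norm ts) ler_norml /f.
  by move=> /andP[]; lra.
have fhom s t : s <= t -> f s <= f t.
  move=> st; have /andP[h _] := expand _ _ st; rewrite -subr_ge0; apply: le_trans h.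
  by rewrite mulr_ge0// subr_ge0// ltW.
have f0 : f 0 = 0 by rewrite /f psi0 addr0.
have f1 : f 1 = 1 by rewrite /f psi1 addr0.
have lamP (t : unit_interval R) : {s : unit_interval R | \val s = f (\val t)}.
  apply: unit_interval_exists; have /andP[t0 t1] := unit_interval_itv t.
  by apply/andP; split; [rewrite -[leLHS]f0 fhom|rewrite -[leRHS]f1 fhom].
pose lam t := sval (lamP t).
have lamE t : \val (lam t) = f (\val t) by exact: svalP (lamP t).
have fcont : {within `[(0:R), 1], continuous f}.
  apply: continuous_subspaceT => t; apply: cvgD; first exact: cvg_id.
  apply/cvgrPdist_lt => e e0; near=> s.
  rewrite (le_lt_trans (psiL _ _))// (@le_lt_trans _ _ (1 * `|t - s|))//.
    by rewrite ler_wpM2r// ltW.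
  rewrite mul1r; near: s; exact: cvgr_dist_lt.
have muP (t : unit_interval R) : {s : unit_interval R | f (\val s) = \val t}.
  apply: cid; have [|c] := @IVT R f 0 1 (\val t) ler01 fcont.
    by rewrite f0 f1 /Num.min /Num.max ltr01; exact: unit_interval_itv.
  rewrite in_itv/= => c01 fc.
  by have [s sc] := unit_interval_exists c01; exists s; rewrite sc.
pose mu t := sval (muP t).
have muE t : f (\val (mu t)) = \val t by exact: svalP (muP t).
have expandN s t : (1 - L) * `|s - t| <= `|f s - f t| <= (1 + L) * `|s - t|.
  have := fun s t st => fhom s t st; have := expand.
  wlog st : s t / s <= t.
    move=> W ex fh; have [st|/ltW st] := leP s t; first exact: W.
    by rewrite distrC (distrC (f s)); exact: W.
  move=> /(_ _ _ st) ex /(_ _ _ st) fst.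
  by rewrite distrC ger0_norm ?subr_ge0// distrC ger0_norm ?subr_ge0.
have L10 : 0 < 1 - L by rewrite subr_gt0.
have finj (s t : unit_interval R) : f (\val s) = f (\val t) -> s = t.
  move=> fst; apply: unit_interval_inj; apply/eqP; rewrite -subr_eq0 -normr_le0.
  have /andP[+ _] := expandN (\val s) (\val t).
  by rewrite fst subrr normr0 pmulr_rle0.
exists lam => //; exists mu; split.
- apply: (@lipschitz_continuous _ (1 + L)); first by rewrite ltr_wpDr.
  by move=> s t; rewrite !lamE; have /andP[] := expandN (\val s) (\val t).
- apply: (@lipschitz_continuous _ (1 - L)^-1); first by rewrite invr_gt0.
  move=> s t; rewrite mulrC ler_pdivlMr// mulrC.
  by rewrite -(muE s) -(muE t); have /andP[] := expandN (\val (mu s)) (\val (mu t)).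
- by move=> t; apply: finj; rewrite muE lamE.
- by move=> t; apply: unit_interval_inj; rewrite lamE muE.
- by move=> s t st; rewrite !lamE fhom.
Unshelve. all: by end_near. Qed.

End time_changes.

Section jump_functions.
Variable R : realType.
Implicit Types (H : finType).

Lemma cadlag_jump_fun H (u z : H -> R) :
  cadlag (fun t => \sum_h z h * (u h <= \val t)%R%:R).
Proof.
have := @cadlag_sum R #|H| (fun i t => z (enum_val i) * (u (enum_val i) <= \val t)%R%:R).
move=> /(_ (fun i => cadlag_step _ _)); congr cadlag; apply/funext => t.
rewrite [RHS](reindex (fun i : 'I_#|H| => enum_val i))//.
exact/onW_bij/enum_val_bij.
Qed.

(** Signed sizes and an arbitrary finite index set: in this form the limiting paths, the paths of
    the large increments and the paths with a jump removed are treated alike. *)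
Definition jump_fun H (u z : H -> R) : skorokhod R := Skorokhod (cadlag_jump_fun u z).

Lemma jump_funE H (u z : H -> R) t :
  jump_fun u z t = \sum_h z h * (u h <= \val t)%R%:R.
Proof. by []. Qed.

Lemma mdist_le_sup (x y : skorokhod R) (M : R) :
  (forall t, `|x t - y t| <= M) -> mdist x y <= M.
Proof.
move=> xyM; apply: (le_trans (skorokhod_dist_le x y (@time_change_id R))).
apply/skorokhod_costP => t; split => //.
by rewrite subrr normr0 (le_trans (normr_ge0 _) (xyM t)).
Qed.

Lemma mdist_jump_fun_sizes H (u z z' : H -> R) :
  mdist (jump_fun u z) (jump_fun u z') <= \sum_h `|z h - z' h|.
Proof.
apply: mdist_le_sup => t; rewrite !jump_funE -sumrB.
rewrite (le_trans (ler_norm_sum _ _ _))// ler_sum// => h _.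
by case: (u h <= _); rewrite ?mulr1// !mulr0 subrr normr0.
Qed.

Definition tent (rho c t : R) : R := Num.max 0 (1 - `|t - c| / rho).

Lemma tent_lip rho c s t : 0 < rho -> `|tent rho c s - tent rho c t| <= `|s - t| / rho.
Proof.
move=> rho0; rewrite /tent.
have h : `| `|s - c| / rho - `|t - c| / rho| <= `|s - t| / rho.
  rewrite -mulrBl normrM [X in _ * X]gtr0_norm ?invr_gt0// ler_pM2r ?invr_gt0//.
  rewrite (le_trans (ler_dist_dist _ _))//.
  by have -> : s - c - (t - c) = s - t by ring.
move: h; set p := _ / rho; set q := `|t - c| / rho; set r := `|s - t| / rho.
rewrite !ler_norml /Num.max.
by case: ifPn; case: ifPn; rewrite -?leNgt => ? ? /andP[? ?]; apply/andP; split; lra.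
Qed.

Lemma tent_center rho c : tent rho c c = 1.
Proof. by rewrite /tent subrr normr0 mul0r subr0; apply: max_r. Qed.

Lemma tent_far rho c t : 0 < rho -> rho <= `|t - c| -> tent rho c t = 0.
Proof. by move=> rho0 h; apply: max_l; rewrite subr_le0 ler_pdivlMr// mul1r. Qed.

(** The time change adds to the identity one tent of width [rho] around each jump time, of height
    the displacement of that time. The times being separated, a tent vanishes at the jump times
    other than its own, and the bound on the displacements makes the sum of the tents a
    contraction. *)
Lemma mdist_jump_fun H (u u' z z' : H -> R) (rho : R) : 0 < rho ->
  (forall h, rho <= u h <= 1 - rho) ->
  (forall g h, g != h -> rho <= `|u g - u h|) ->
  \sum_h `|u' h - u h| < rho ->
  mdist (jump_fun u' z') (jump_fun u z) <=
    Num.max (\sum_h `|u' h - u h|) (\sum_h `|z' h - z h|).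
Proof.
move=> rho0 u01 usep ulo.
pose D := \sum_h `|u' h - u h|.
pose psi t := \sum_h (u' h - u h) * tent rho (u h) t.
have psiL s t : `|psi s - psi t| <= D / rho * `|s - t|.
  rewrite /psi -sumrB (le_trans (ler_norm_sum _ _ _))//.
  rewrite mulrAC -mulrA mulr_suml ler_sum// => h _.
  by rewrite -mulrBr normrM ler_wpM2l//; exact: tent_lip.
have psi0 : psi 0 = 0.
  rewrite /psi big1// => h _; rewrite tent_far ?mulr0// sub0r normrN.
  by have /andP[h0 _] := u01 h; rewrite (le_trans h0)// ler_norm.
have psi1 : psi 1 = 0.
  rewrite /psi big1// => h _; rewrite tent_far ?mulr0//.
  by have /andP[_ h0] := u01 h; rewrite (le_trans _ (ler_norm _))// lerBrDl addrC -lerBrDl.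
have psiu h : psi (u h) = u' h - u h.
  rewrite /psi (bigD1 h)//= tent_center mulr1 big1 ?addr0// => g gh.
  by rewrite tent_far ?mulr0// distrC usep.
have D0 : 0 <= D by rewrite sumr_ge0.
have DL : 0 <= D / rho < 1 by rewrite divr_ge0 ?(ltW rho0)//= ltr_pdivrMr// mul1r.
have [lam lamT lamE] := contraction_time_change DL psiL psi0 psi1.
apply: (le_trans (skorokhod_dist_le _ _ lamT)); apply/skorokhod_costP => t; split.
  rewrite lamE addrAC subrr add0r le_max; apply/orP; left.
  rewrite /psi (le_trans (ler_norm_sum _ _ _))// ler_sum// => h _.
  rewrite normrM ler_piMr// ger0_norm ?le_max ?lexx//.
  by rewrite ge_max ler01/= gerBl mulr_ge0// invr_ge0 ltW.
rewrite le_max; apply/orP; right.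
rewrite !jump_funE -sumrB (le_trans (ler_norm_sum _ _ _))// ler_sum// => h _.
have -> : (u' h <= \val (lam t)) = (u h <= \val t).
  have [r rE] : {r : unit_interval R | \val r = u h}.
    apply: unit_interval_exists; have := u01 h; move: rho0; clear; lra.
  have [mu [_ _ lmu _ lh]] := lamT.
  have -> : u' h = \val (lam r) by rewrite lamE rE psiu addrC subrK.
  rewrite -rE; apply/idP/idP; last exact: lh.
  move=> lrt; rewrite leNgt; apply/negP => tr.
  have e : lam t = lam r.
    by apply: unit_interval_inj; apply/eqP; rewrite eq_le lrt lh// ltW.
  by have := congr1 mu e; rewrite !lmu => e'; rewrite e' ltxx in tr.
by case: (u h <= _); rewrite ?mulr1// !mulr0 subrr normr0.
Qed.

End jump_functions.

(** * Jump counts of pure jump paths *)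

Section step_path_lemmas.
Variable R : realType.

Lemma card_eq_fin (H : finType) (A : {pred H}) : ([set h | h \in A] #= `I_#|A|)%card.
Proof.
have -> : [set h | h \in A] = (fun i : 'I_#|A| => enum_val i) @` setT.
  apply/seteqP; split=> [h /= hA|_ [i _ <-]]; last exact: enum_valP.
  by exists (enum_rank_in hA h) => //; rewrite enum_rankK_in.
rewrite (card_eql (inj_card_eq _)); last by move=> i j _ _; exact: enum_val_inj.
by rewrite card_eq_sym card_II.
Qed.

Lemma at_lt_proper (t : unit_interval R) : 0 < \val t -> ProperFilter (at_lt t).
Proof.
move=> t0; split; last exact: at_lt_filter.
move=> /at_ltP[e e0 eP].
have [s sE] : {s : unit_interval R | \val s = Num.max 0 (\val t - e / 2)}.
  have /andP[_ t1] := unit_interval_itv t.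
  apply: unit_interval_exists; rewrite le_max lexx/= ge_max ler01/=.
  by rewrite (le_trans _ t1)// gerBl divr_ge0// ltW.
apply: (eP s); rewrite sE; move: t0 e0; clear.
by rewrite /Num.max; case: ifPn; rewrite -?leNgt => *; apply/andP; split; lra.
Qed.

Lemma left_limit_jump_fun (H : finType) (u z : H -> R) t : 0 < \val t ->
  left_limit (jump_fun u z) t = \sum_h z h * (u h < \val t)%R%:R.
Proof.
move=> t0; apply: (@cvg_lim _ _ _ _ (at_lt_proper t0)); first exact: norm_hausdorff.
apply: cvg_near_cst; apply/at_ltP.
have [e e0 eP] : exists2 e, 0 < e & forall h, u h < \val t -> u h <= \val t - e.
  have : forall s : seq H, exists2 e, 0 < e & forall h, h \in s ->
    u h < \val t -> u h <= \val t - e.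
    elim=> [|g s [e e0 IH]]; first by exists 1.
    have [gt|gt] := ltP (u g) (\val t).
      exists (Num.min e (\val t - u g)); first by rewrite lt_min e0 subr_gt0.
      move=> h; rewrite inE => /predU1P[->|/IH hs ut].
        by rewrite lerBrDl -lerBrDr ge_min lexx orbT.
      by rewrite (le_trans (hs ut))// lerD2l lerN2 ge_min lexx.
    exists e => // h; rewrite inE => /predU1P[->|/IH//].
    by rewrite ltNge gt.
  move=> /(_ (enum H))[e e0 eP]; exists e => // h; apply: eP; exact: mem_enum.
exists e => // s /andP[es st]; rewrite jump_funE; apply: eq_bigr => h _.
congr (_ * (nat_of_bool _)%:R); apply/idP/idP => [us|/eP us].
  exact: le_lt_trans st.
exact/ltW/(le_lt_trans us).
Qed.

(** Distinct times prevent jumps from merging or cancelling, so that the jumps of the path are the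
    entries of [z], with their signs; the entries equal to zero do not count. *)
Lemma jump_fun_step_paths (H : finType) (u z : H -> R) l m :
  (forall h, 0 < u h <= 1) -> injective u ->
  #|[pred h | 0 < z h]| = l -> #|[pred h | z h < 0]| = m ->
  step_paths l m (jump_fun u z).
Proof.
move=> u01 uinj zl zm.
have pt (h : H) : {t : unit_interval R | \val t = u h}.
  by apply: unit_interval_exists; have /andP[/ltW -> ->] := u01 h.
pose p h := sval (pt h); have pE h : \val (p h) = u h := svalP (pt h).
have jump t : 0 < \val t ->
  jump_fun u z t - left_limit (jump_fun u z) t = \sum_(h | u h == \val t) z h.
  move=> t0; rewrite left_limit_jump_fun// jump_funE -sumrB [RHS]big_mkcond/=.
  apply: eq_bigr => h _; rewrite -mulrBr; case: ltgtP => _.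
  - by rewrite subrr mulr0.
  - by rewrite subrr mulr0.
  - by rewrite subr0 mulr1.
have jumpp h : jump_fun u z (p h) - left_limit (jump_fun u z) (p h) = z h.
  rewrite jump ?pE; last by have /andP[] := u01 h.
  by rewrite (big_pred1 h)// => g; rewrite /= (inj_eq uinj).
have jump0 t : 0 < \val t -> ~ (exists h, p h = t) ->
  jump_fun u z t - left_limit (jump_fun u z) t = 0.
  move=> t0 ht; rewrite jump// big_pred0// => h; apply/negbTE/eqP => e.
  by apply: ht; exists h; apply: unit_interval_inj; rewrite pE.
have jumps (Q : pred R) : ~~ Q 0 ->
  ([set t | (0 < \val t)%R /\ Q (jump_fun u z t - left_limit (jump_fun u z) t)%R]
   #= `I_#|[pred h | Q (z h)]|)%card.
  move=> Q0; have -> : [set t | (0 < \val t)%R /\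
      Q (jump_fun u z t - left_limit (jump_fun u z) t)%R] =
      p @` [set h | h \in [pred h | Q (z h)]].
    apply/seteqP; split=> [t /= [t0 Qt]|_ [h /= Qh <-]]; last first.
      by rewrite jumpp pE; have /andP[] := u01 h.
    have [[h ht]|nh] := pselect (exists h, p h = t).
      by exists h => //=; rewrite inE -jumpp ht.
    by rewrite jump0// (negbTE Q0) in Qt.
  rewrite (card_eql (inj_card_eq _)) ?card_eq_fin// => g h _ _ /(congr1 \val).
  by rewrite !pE; exact: uinj.
split.
- exists [seq u h | h : H] => t s ts H0; rewrite !jump_funE; apply: eq_bigr => h _.
  congr (_ * (nat_of_bool _)%:R); apply/idP/idP => [ut|us]; first exact: le_trans ts.
  rewrite leNgt; apply/negP => tu; apply: (H0 (u h)); last by rewrite tu.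
  by apply/mapP; exists h => //; rewrite mem_enum.
- move=> t t0; rewrite jump_funE big1// => h _.
  by rewrite t0 leNgt; have /andP[-> _] := u01 h; rewrite mulr0.
- rewrite -zl; have := jumps (fun r => 0 < r); rewrite ltxx => /(_ isT).
  by congr (_ #= _)%card; apply/seteqP; split=> t /= [t0]; rewrite subr_gt0.
- rewrite -zm; have := jumps (fun r => r < 0); rewrite ltxx => /(_ isT).
  by congr (_ #= _)%card; apply/seteqP; split=> t /= [t0]; rewrite subr_lt0.
Qed.

(** The index type ['I_j + 'I_k] puts upward and downward jumps on the same footing: products over
    it are products over all the jumps, whatever their signs. *)
Definition split_fun T j k (u : j.-tuple T) (v : k.-tuple T) (h : 'I_j + 'I_k) : T :=
  match h with inl i => tnth u i | inr i => tnth v i end.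

Definition jump_sign j k (h : 'I_j + 'I_k) : R := if h is inl _ then 1 else - 1.

Lemma jump_pathE j k (u : j.-tuple R) (v : k.-tuple R) x y :
  jump_path u v x y =
  jump_fun (split_fun u v) (fun h => jump_sign h * split_fun x y h).
Proof.
apply: skorokhodP => t; rewrite jump_funE big_sumType/=.
congr (_ + _); first by apply: eq_bigr => i _; rewrite mul1r.
by rewrite -sumrN; apply: eq_bigr => i _; rewrite mulN1r mulNr.
Qed.

End step_path_lemmas.

(** * Sets open in finitely many coordinates, and dyadic cells *)

Section dyadic_cells.
Context (R : realType) (d : measure_display) (T : measurableType d) (I : finType).
Variable co : I -> T -> R.
Hypothesis mco : forall i, measurable_fun setT (co i).
Implicit Types (G : set T) (m : nat).

(** The level [m] cuts the interval from [- 2 ^+ m] to [2 ^+ m] into cells of width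
    [(2 ^+ m)^-1]; there are [2 * 4 ^ m] of them. *)
Definition dyadic_lo m k : R := k%:R / 2 ^+ m - 2 ^+ m.

Definition dyadic_cell m (c : {ffun I -> 'I_(2 * 4 ^ m)}) : set T :=
  [set z | forall i, dyadic_lo m (c i) <= co i z < dyadic_lo m (c i).+1].

(** Openness in the coordinates [co]; it asks for no topology on [T], and applies both to the space
    of jump times and sizes and to the probability space itself, with partial sums as
    coordinates. *)
Definition coord_open G := forall z, G z -> exists2 rho : R, 0 < rho &
  forall z', (forall i, `|co i z' - co i z| < rho) -> G z'.

Definition inner_cells m G : set T :=
  \bigcup_(c in [set c : {ffun I -> 'I_(2 * 4 ^ m)} | dyadic_cell c `<=` G]) dyadic_cell c.

Let scale m (x : R) : R := 2 ^+ m * (x + 2 ^+ m).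

Let dyadic_loP m k x : (dyadic_lo m k <= x) = (k%:R <= scale m x).
Proof. by rewrite /dyadic_lo /scale lerBlDr ler_pdivrMr ?exprn_gt0// mulrC. Qed.

Let dyadic_hiP m k x : (x < dyadic_lo m k) = (scale m x < k%:R).
Proof. by rewrite !ltNge dyadic_loP. Qed.

Let four m : (4 ^ m)%:R = 2 ^+ m * 2 ^+ m :> R.
Proof. by rewrite natrX -exprMn -natrM. Qed.

Lemma dyadic_coverP m (x : R) : - 2 ^+ m <= x < 2 ^+ m ->
  exists k : 'I_(2 * 4 ^ m), dyadic_lo m k <= x < dyadic_lo m k.+1.
Proof.
move=> /andP[mx xm].
have s0 : 0 <= scale m x by rewrite mulr_ge0 ?exprn_ge0// -lerBlDr sub0r.
have /andP[h1 h2] := truncn_itv s0.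
have kl : (Num.truncn (scale m x) < 2 * 4 ^ m)%N.
  rewrite -(ltr_nat R) (le_lt_trans h1)// /scale.
  have -> : (2 * 4 ^ m)%:R = 2 ^+ m * (2 ^+ m + 2 ^+ m) :> R.
    by rewrite natrM four; ring.
  by rewrite ltr_pM2l ?exprn_gt0// ltrD2r.
by exists (Ordinal kl); rewrite dyadic_loP dyadic_hiP h1.
Qed.

Lemma dyadic_cell_measurable m (c : {ffun I -> 'I_(2 * 4 ^ m)}) : measurable (dyadic_cell c).
Proof.
have -> : dyadic_cell c = \bigcap_(i in [set: I])
    (co i @^-1` `[dyadic_lo m (c i), dyadic_lo m (c i).+1[).
  apply/seteqP; split=> [z zc i _ /=|z zc i]; first by rewrite in_itv /= zc.
  by have := zc i Logic.I; rewrite /= in_itv.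
apply: fin_bigcap_measurable => [|i _]; first exact: finite_finset.
by rewrite -[X in measurable X]setTI; exact: mco.
Qed.

Lemma dyadic_cell_disjoint m (c c' : {ffun I -> 'I_(2 * 4 ^ m)}) z :
  dyadic_cell c z -> dyadic_cell c' z -> c = c'.
Proof.
move=> cz cz'; apply/ffunP => i; apply: val_inj => /=.
have := cz i; have := cz' i; rewrite !dyadic_loP !dyadic_hiP.
move=> /andP[a1 a2] /andP[b1 b2].
have := le_lt_trans a1 b2; have := le_lt_trans b1 a2; rewrite !ltr_nat !ltnS => h1 h2.
by apply/eqP; rewrite eqn_leq h1 h2.
Qed.

Lemma inner_cells_sub m G : inner_cells m G `<=` G.
Proof. by move=> z [c /= cG /cG]. Qed.

Lemma inner_cells_measurable m G : measurable (inner_cells m G).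
Proof.
apply: fin_bigcup_measurable => [|c _]; last exact: dyadic_cell_measurable.
exact: finite_finset.
Qed.

Lemma inner_cellsS m G : inner_cells m G `<=` inner_cells m.+1 G.
Proof.
move=> z [c cG zc].
have zm i : - 2 ^+ m.+1 <= co i z < 2 ^+ m.+1.
  have := zc i; rewrite dyadic_loP dyadic_hiP /scale => /andP[h1 h2].
  have p0 : 0 < 2 ^+ m :> R by rewrite exprn_gt0.
  have h3 : 0 <= co i z + 2 ^+ m.
    by rewrite -(pmulr_rge0 _ p0) (le_trans _ h1).
  have h4 : co i z + 2 ^+ m < 2 * 2 ^+ m.
    rewrite -(ltr_pM2l p0) (lt_le_trans h2)//.
    have -> : 2 ^+ m * (2 * 2 ^+ m) = (2 * 4 ^ m)%:R :> R.
      by rewrite natrM four; ring.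
    by rewrite ler_nat.
  by rewrite exprS; apply/andP; split; lra.
have /(_ _)/cid-/all_sig[c' c'P] := fun i => dyadic_coverP (zm i).
exists (finfun c'); last by move=> i; rewrite ffunE.
move=> z' z'c'; apply: cG => i; have := z'c' i; rewrite ffunE.
have := c'P i; have := zc i; rewrite !dyadic_loP !dyadic_hiP.
have sE x : scale m.+1 x = 2 * scale m x + 2 * (4 ^ m)%:R.
  by rewrite /scale four exprS; ring.
rewrite !sE; move: (scale m _) (scale m _) => x y /andP[a1 a2] /andP[b1 b2] /andP[e1 e2].
have k1 : (2 * c i + 2 * 4 ^ m <= c' i)%N.
  rewrite -ltnS -(ltr_nat R) (le_lt_trans _ b2)// natrD !natrM lerD2r.
  by rewrite ler_pM2l.
have k2 : (c' i <= 2 * c i + 1 + 2 * 4 ^ m)%N.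
  rewrite -ltnS -(ltr_nat R) (le_lt_trans b1)// -addSn natrD !natrM ltrD2r.
  have -> : (2 * c i + 1).+1%:R = 2 * (c i).+1%:R :> R.
    by rewrite -natrM; congr (_%:R); lia.
  by rewrite ltr_pM2l.
have {}k1 : 2 * (c i)%:R + 2 * (4 ^ m)%:R <= (c' i)%:R :> R.
  by rewrite -!natrM -natrD ler_nat.
have {}k2 : (c' i)%:R <= 2 * (c i)%:R + 1 + 2 * (4 ^ m)%:R :> R.
  by rewrite -!natrM natr1 -natrD ler_nat addn1 in k2 *.
by move: e1 e2; rewrite -!natr1 => e1 e2; apply/andP; split; lra.
Qed.

(** Every point of an open set is in a cell contained in the set, once the cells are finer than the
    room left around the point and reach far enough. *)
Lemma bigcup_inner_cells G : coord_open G -> \bigcup_m inner_cells m G = G.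
Proof.
move=> Go; apply/seteqP; split=> [z [m _] /inner_cells_sub//|z Gz].
have [rho rho0 Grho] := Go _ Gz.
have [m [zm rm]] : exists m, (forall i, `|co i z| < 2 ^+ m) /\ (2 ^+ m)^-1 < rho :> R.
  pose B := \sum_i `|co i z| + rho^-1.
  have B0 : 0 <= B by rewrite addr_ge0 ?sumr_ge0 ?invr_ge0 ?ltW.
  have Bm : B < 2 ^+ (Num.truncn B).+1.
    have /andP[_ h] := truncn_itv B0; rewrite (lt_le_trans h)//.
    by rewrite -natrX ler_nat ltnW// ltn_expl.
  exists (Num.truncn B).+1; split=> [i|].
    rewrite (le_lt_trans _ Bm)// /B (bigD1 i)//= -addrA lerDl.
    by rewrite addr_ge0 ?sumr_ge0 ?invr_ge0 ?ltW.
  rewrite invf_plt ?posrE ?exprn_gt0// (le_lt_trans _ Bm)// lerDr.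
  by rewrite sumr_ge0.
have zm' i : - 2 ^+ m <= co i z < 2 ^+ m.
  by have := zm i; rewrite ltr_norml => /andP[/ltW -> ->].
have /(_ _)/cid-/all_sig[c cP] := fun i => dyadic_coverP (zm' i).
exists m => //; exists (finfun c); last by move=> i; rewrite ffunE.
move=> z' z'c; apply: Grho => i; apply: lt_trans rm.
have := z'c i; have := cP i; rewrite ffunE /dyadic_lo -[(c i).+1%:R]natr1 mulrDl mul1r.
by move=> /andP[? ?] /andP[? ?]; rewrite ltr_norml; apply/andP; split; lra.
Qed.

Lemma coord_open_measurable G : coord_open G -> measurable G.
Proof.
move=> /bigcup_inner_cells <-; apply: bigcup_measurable => m _.
exact: inner_cells_measurable.
Qed.

(** A finite union of disjoint cells exhausts the mass of an open set; so lower limits over cells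
    give lower limits over open sets. *)
Lemma inner_cells_cvg (mu : {measure set T -> \bar R}) G : coord_open G ->
  mu (inner_cells m G) @[m --> \oo] --> mu G.
Proof.
move=> Go; rewrite -{2}(bigcup_inner_cells Go).
apply: nondecreasing_cvg_mu => [m||].
- exact: inner_cells_measurable.
- by apply: bigcup_measurable => m _; exact: inner_cells_measurable.
- by apply/nondecreasing_seqP => m; apply/subsetPset; exact: inner_cellsS.
Qed.

Lemma measure_inner_cells (mu : {measure set T -> \bar R}) m G :
  mu (inner_cells m G) =
  (\sum_(c : {ffun I -> 'I_(2 * 4 ^ m)} | `[< dyadic_cell c `<=` G >]) mu (dyadic_cell c))%E.
Proof.
rewrite /inner_cells measure_fin_bigcup//=.
- pose r := [seq c <- enum {ffun I -> 'I_(2 * 4 ^ m)} | `[< dyadic_cell c `<=` G >]].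
  transitivity (\sum_(c <- r) mu (dyadic_cell c))%E.
    rewrite [RHS]fsbig_seq; last by apply: filter_uniq; exact: enum_uniq.
    have -> : [set c : {ffun I -> 'I_(2 * 4 ^ m)} | dyadic_cell c `<=` G] = [set` r].
      apply/seteqP; split=> c /=; rewrite mem_filter mem_enum andbT.
        by move=> cG; apply/asboolP.
      by move=> /asboolP.
    by [].
  by rewrite /r big_filter big_enum_cond; exact: eq_bigl.
- apply/trivIsetP => c c' _ _ /eqP cc'; rewrite -subset0 => z [cz c'z].
  by apply: cc'; exact: dyadic_cell_disjoint c'z.
- by move=> c _; exact: dyadic_cell_measurable.
Qed.

End dyadic_cells.

Section coord_open_theory.
Context (R : realType) (d : measure_display) (T : measurableType d) (I : finType).
Variable co : I -> T -> R.
Implicit Types (G : set T).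

Lemma finite_pos_lb (F : finType) (f : F -> R) : (forall i, 0 < f i) ->
  exists2 rho : R, 0 < rho & forall i, rho <= f i.
Proof.
move=> f0; suff [rho rho0 fr] : exists2 rho : R, 0 < rho & forall i, i \in enum F -> rho <= f i.
  by exists rho => // i; apply: fr; rewrite mem_enum.
elim: (enum F) => [|i s [rho rho0 IH]]; first by exists 1.
exists (Num.min rho (f i)); first by rewrite lt_min rho0 f0.
by move=> g; rewrite inE ge_min => /predU1P[->|/IH ->//]; rewrite lexx orbT.
Qed.

Lemma coord_open_forall (F : finType) (G : F -> set T) :
  (forall i, coord_open co (G i)) -> coord_open co [set z | forall i, G i z].
Proof.
move=> Go z Gz; have /(_ _)/cid2-/all_sig[rho rhoP] := fun i => Go i z (Gz i).
have [e e0 er] := finite_pos_lb (fun i => (rhoP i).1); exists e => // z' zz' i.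
have [r0 h] := rhoP i; apply: h => c; exact: lt_le_trans (zz' c) (er i).
Qed.

Lemma coord_openI G G' : coord_open co G -> coord_open co G' -> coord_open co (G `&` G').
Proof.
move=> Go Go' z [/Go[r r0 h] /Go'[r' r0' h']].
exists (Num.min r r'); first by rewrite lt_min r0.
move=> z' zz'; split; [apply: h|apply: h'] => i; have := zz' i; rewrite lt_min => /andP[] //.
Qed.

Lemma coord_open_exists (F : Type) (G : F -> set T) :
  (forall i, coord_open co (G i)) -> coord_open co [set z | exists i, G i z].
Proof.
move=> Go z [i Gz]; have [r r0 h] := Go _ _ Gz.
by exists r => // z' /h Gz'; exists i.
Qed.

Lemma coord_openU G G' : coord_open co G -> coord_open co G' -> coord_open co (G `|` G').
Proof.
move=> Go Go' z [/Go|/Go'] [r r0 h]; exists r => // z' /h; [by left|by right].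
Qed.

Lemma coord_open_imply (P : Prop) G : coord_open co G -> coord_open co [set z | P -> G z].
Proof.
move=> Go z PG; have [p|np] := pselect P.
  by have [r r0 h] := Go z (PG p); exists r => // z' /h Gz' _.
by exists 1 => // z' _ /np.
Qed.

Lemma coord_open_gt i (c : R) : coord_open co [set z | c < co i z].
Proof.
move=> z /= cz; exists (co i z - c); first by rewrite subr_gt0.
by move=> z' /(_ i) /=; rewrite ltr_norml => /andP[+ _]; move: cz; clear; lra.
Qed.

Lemma coord_open_lt i (c : R) : coord_open co [set z | co i z < c].
Proof.
move=> z /= cz; exists (c - co i z); first by rewrite subr_gt0.
by move=> z' /(_ i) /=; rewrite ltr_norml => /andP[_ +]; move: cz; clear; lra.
Qed.

Lemma coord_open_lt2 i i' : coord_open co [set z | co i z < co i' z].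
Proof.
move=> z /= cz; exists ((co i' z - co i z) / 2); first by rewrite divr_gt0// subr_gt0.
by move=> z' h /=; have := h i; have := h i'; rewrite !ltr_norml => /andP[? ?] /andP[? ?]; lra.
Qed.

Lemma coord_open_neq i i' : coord_open co [set z | co i z <> co i' z].
Proof.
have -> : [set z | co i z <> co i' z] = [set z | co i z < co i' z] `|` [set z | co i' z < co i z].
  apply/seteqP; split=> z /=; last by move=> [h|h] e; rewrite e ltxx in h.
  by move=> /eqP; rewrite neq_lt => /orP.
by apply: coord_openU; exact: coord_open_lt2.
Qed.

End coord_open_theory.

(** Turns sortedness into finitely many conditions on pairs of coordinates. *)
Lemma sorted_tnthP (T : Type) (leT : rel T) n (t : n.-tuple T) : transitive leT ->
  sorted leT t <-> forall i i' : 'I_n, (i < i')%N -> leT (tnth t i) (tnth t i').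
Proof.
move=> tr; split=> [st i i' ii'|h].
  have x0 : T := tnth t i.
  by rewrite !(tnth_nth x0); apply: sorted_ltn_nth => //; rewrite ?inE ?size_tuple.
case: n t h => [|n] t h; first by rewrite (tuple0 t).
have x0 : T := tnth t ord0.
apply/(sortedP x0) => i; rewrite size_tuple => in1.
have i1 : (i < n.+1)%N by exact: ltnW.
by have := h (Ordinal i1) (Ordinal in1) (ltnSn _); rewrite !(tnth_nth x0).
Qed.

(** * Products of i.i.d. variables *)

Section iid_products.
Context (R : realType) (d : measure_display) (Omega : measurableType d).
Variable P : probability Omega R.
Variable X : nat -> {RV P >-> R}.
Hypothesis iidX : iid X.

Lemma iid_preimage i (B : set R) : measurable B -> P (X i @^-1` B) = P (X 0 @^-1` B).
Proof. by move=> mB; exact: iidX.2. Qed.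

Lemma measurable_RV_preimage i (B : set R) : measurable B -> measurable (X i @^-1` B).
Proof. by move=> mB; rewrite -[X in measurable X]setTI; exact: measurable_funP. Qed.

Lemma iid_ord n (B : 'I_n -> set R) : (forall i, measurable (B i)) ->
  P [set w | forall i, B i (X i w)] = (\prod_(i < n) P (X 0 @^-1` B i))%E.
Proof.
move=> mB; pose Bn i := if insub i is Some o then B o else setT.
have mBn i : measurable (Bn i) by rewrite /Bn; case: insubP.
have BnE (i : 'I_n) : Bn i = B i by rewrite /Bn valK.
have := iidX.1 (index_iota 0 n) Bn (iota_uniq _ _) mBn.
rewrite big_mkord => e.
rewrite (_ : [set w | _] = \bigcap_(i in [set` index_iota 0 n]) X i @^-1` Bn i).
  by rewrite e; apply: eq_bigr => i _; rewrite BnE iid_preimage.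
apply/seteqP; split=> w /=.
  by move=> Bw i /=; rewrite mem_index_iota => /andP[_ ilt]; rewrite -[i]/(val (Ordinal ilt)) BnE; exact: Bw.
move=> Bw i; rewrite -BnE; apply: Bw => /=; rewrite mem_index_iota; exact: ltn_ord.
Qed.

Lemma iid_ord_fine n (B : 'I_n -> set R) : (forall i, measurable (B i)) ->
  fine (P [set w | forall i, B i (X i w)]) = \prod_(i < n) fine (P (X 0 @^-1` B i)).
Proof.
move=> mB; rewrite iid_ord//.
rewrite (eq_bigr (fun i => (fine (P (X 0 @^-1` B i)))%:E)); last first.
  by move=> i _; apply: (probE P); exact: measurable_RV_preimage.
by rewrite prodEFin.
Qed.

Lemma measurable_iid_box n (B : 'I_n -> set R) : (forall i, measurable (B i)) ->
  measurable [set w | forall i, B i (X i w)].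
Proof.
move=> mB; rewrite (_ : [set w | _] = \bigcap_(i in [set: 'I_n]) (X i @^-1` B i)).
  by apply: fin_bigcap_measurable => // i _; exact: measurable_RV_preimage.
by apply/seteqP; split => [t tB i _|t tB i]; [exact: tB|exact: (tB i Logic.I)].
Qed.

Import HBNNSimple.
Local Open Scope ereal_scope.

Let prod_indic n L (B : 'I_L -> set R) (phi : {ffun 'I_n -> 'I_L}) (v : 'I_L -> R) w :
  (\prod_(i < n) (v (phi i) * \1_(B (phi i)) (X i w)) =
   (\prod_(i < n) v (phi i)) * \1_[set w | forall i : 'I_n, B (phi i) (X i w)] w)%R.
Proof.
rewrite big_split/=; congr (_ * _)%R.
have [Bw|nBw] := pselect (forall i : 'I_n, B (phi i) (X i w)).
  by rewrite [RHS]indicE mem_set// big1// => i _; rewrite indicE mem_set//; exact: Bw.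
rewrite [RHS]indicE memNset//.
have [i nBi] : exists i : 'I_n, ~ B (phi i) (X i w) by exact/existsNP.
by rewrite (bigD1 i)//= indicE memNset// mul0r.
Qed.

(** Expanding the product of sums leaves indicators of boxes, where independence applies. *)
Let simple_prod n L (B : 'I_L -> set R) (v : 'I_L -> R) :
  (forall l, measurable (B l)) -> (forall l, 0 <= v l)%R ->
  \int[P]_w (\prod_(i < n) \sum_(l < L) v l * \1_(B l) (X i w))%R%:E =
  ((\sum_(l < L) v l * fine (P (X 0%N @^-1` B l))) ^+ n)%R%:E.
Proof.
move=> mB v0.
have mS (phi : {ffun 'I_n -> 'I_L}) : measurable [set w | forall i : 'I_n, B (phi i) (X i w)].
  exact: (@measurable_iid_box n (fun i => B (phi i))).
under eq_integral => w _.
  rewrite bigA_distr_bigA/= (eq_bigr _ (fun phi _ => prod_indic B phi v w)) -sumEFin.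
  over.
rewrite ge0_integral_sum//; last 2 first.
- by move=> phi; apply: measurableT_comp => //; apply: measurable_funM => //; exact: measurable_indic.
- move=> phi w _; rewrite lee_fin mulr_ge0//; first by apply: prodr_ge0 => i _; exact: v0.
transitivity (\sum_(phi : {ffun 'I_n -> 'I_L})
    (\prod_(i < n) (v (phi i) * fine (P (X 0%N @^-1` B (phi i)))))%R%:E).
  apply: eq_bigr => phi _.
  under eq_integral do rewrite EFinM.
  rewrite ge0_integralZl//; last 2 first.
  - by apply: measurableT_comp => //; exact: measurable_indic.
  - by rewrite lee_fin; apply: prodr_ge0 => i _; exact: v0.
  rewrite integral_indic// setIT big_split/= EFinM; congr (_ * _).
  by rewrite (probE P)// /prob (@iid_ord_fine n (fun i => B (phi i))).
rewrite sumEFin; congr (_%:E).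
rewrite -(bigA_distr_bigA (fun (i : 'I_n) l => v l * fine (P (X 0%N @^-1` B l)))%R).
by rewrite prodr_const card_ord.
Qed.

Let nnsfun_sum (h : {nnsfun R >-> R}) : exists L, exists B : 'I_L -> set R, exists v : 'I_L -> R,
  [/\ forall l, measurable (B l), forall l, (0 <= v l)%R &
      forall x, h x = (\sum_(l < L) v l * \1_(B l) x)%R].
Proof.
have /finite_seqP[r0 r0E] := fimfunP h.
pose r := undup r0.
have rE x : x \in r <-> range h x by rewrite r0E /= mem_undup.
exists (size r), (fun l => h @^-1` [set nth 0%R r l]), (fun l => nth 0%R r l); split => [l|l|x].
- exact: measurable_sfunP.
- have : nth 0%R r l \in r by exact: mem_nth.
  by move=> /rE[x _ <-].
have hx : h x \in r by apply/rE; exists x.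
have ir : (index (h x) r < size r)%N by rewrite index_mem.
rewrite (bigD1 (Ordinal ir))//= nth_index// indicE mem_set//= mulr1 big1 ?addr0// => l.
move=> lx; rewrite indicE memNset ?mulr0//= => e; move: lx; apply/negP; rewrite negbK.
by apply/eqP/val_inj => /=; rewrite e index_uniq//; exact: undup_uniq.
Qed.

(** For simple functions this is the expansion [simple_prod]; both sides pass to the limit along an
    increasing approximation by simple functions. *)
Lemma iid_expectation_prod n (f : R -> R) : measurable_fun setT f ->
  (forall x, 0 <= f x)%R -> \int[P]_w (f (X 0%N w))%:E \is a fin_num ->
  \int[P]_w (\prod_(i < n) f (X i w))%R%:E = (\int[P]_w (f (X 0%N w))%:E) ^+ n.
Proof.
move=> mf f0 If.
have mF : measurable_fun setT (EFin \o f) by exact/measurable_EFinP.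
pose h := nnsfun_approx measurableT mF.
have h_nd x : {homo (fun k => h k x) : k m / (k <= m)%N >-> (k <= m)%R}.
  by move=> k m km; exact/lefP/nd_nnsfun_approx.
have h_cvg x : (h k x)%:E @[k --> \oo] --> (f x)%:E.
  by apply: (@cvg_nnsfun_approx _ _ _ _ measurableT _ mF) => // y _; rewrite lee_fin.
have hr_cvg x : h k x @[k --> \oo] --> f x by exact: fine_cvg (h_cvg x).
have prod_cvg m w : (\prod_(i < m) h k (X i w))%R @[k --> \oo] --> (\prod_(i < m) f (X i w))%R.
  elim: m => [|m IH]; first by under eq_cvg do rewrite big_ord0; rewrite big_ord0; exact: cvg_cst.
  by under eq_cvg do rewrite big_ord_recr; rewrite big_ord_recr; apply: cvgM.
have step k : \int[P]_w (\prod_(i < n) h k (X i w))%R%:E = (\int[P]_w (h k (X 0%N w))%:E) ^+ n.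
  have [L [B [v [mB v0 hE]]]] := nnsfun_sum (h k).
  have iE m : \int[P]_w (\prod_(i < m) h k (X i w))%R%:E =
      \int[P]_w (\prod_(i < m) \sum_(l < L) v l * \1_(B l) (X i w))%R%:E.
    by apply: eq_integral => w _; congr EFin; apply: eq_bigr => i _; exact: hE.
  rewrite iE simple_prod//; have := @simple_prod 1 L B v mB v0; rewrite expr1 -iE.
  under eq_integral => w _ do rewrite big_ord1.
  by move=> ->; elim: n => [|m IH]; rewrite ?expr0// exprS expeS EFinM IH.
have mh k i : measurable_fun setT (fun w => h k (X i w)).
  by apply: measurableT_comp.
have lhs : \int[P]_w (\prod_(i < n) h k (X i w))%R%:E @[k --> \oo] -->
    \int[P]_w (\prod_(i < n) f (X i w))%R%:E.
  rewrite (eq_integral (fun w => limn (fun k => (\prod_(i < n) h k (X i w))%R%:E))); last first.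
    move=> w _; apply/esym/cvg_lim => //; apply: cvg_EFin; first by near=> k.
    exact: prod_cvg.
  apply: cvg_monotone_convergence => //.
  - move=> k; apply: measurableT_comp => //; apply: measurable_prod => i _; exact: mh.
  - by move=> k w _; rewrite lee_fin; apply: prodr_ge0 => i _.
  - move=> w _ k m km; rewrite lee_fin; apply: ler_prod => i _.
    by rewrite h_nd// andbT.
have rhs : \int[P]_w (h k (X 0%N w))%:E @[k --> \oo] --> \int[P]_w (f (X 0%N w))%:E.
  rewrite (eq_integral (fun w => limn (fun k => (h k (X 0%N w))%:E))); last first.
    by move=> w _; apply/esym/cvg_lim.
  apply: cvg_monotone_convergence => //.
  - by move=> k; apply: measurableT_comp.
  - by move=> k w _; rewrite lee_fin.
  - by move=> w _ k m km; rewrite lee_fin; exact: h_nd.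
have rhsn m : (\int[P]_w (h k (X 0%N w))%:E) ^+ m @[k --> \oo] --> (\int[P]_w (f (X 0%N w))%:E) ^+ m.
  elim: m => [|m IH]; first exact: cvg_cst.
  rewrite expeS; under eq_cvg do rewrite expeS.
  apply: cvgeM => //.
  rewrite mule_def_fin//; elim: (m) => [|q IHq]//.
  by rewrite expeS fin_numM.
rewrite -(cvg_lim _ lhs)// -(cvg_lim _ (rhsn n))//.
by apply: congr_lim; apply/funext => k; exact: step.
Unshelve. all: by end_near. Qed.

End iid_products.

(** * Exponential bounds and moments *)

Section exponential_bounds.
Variable R : realType.
Implicit Types (x y s c p : R).

(** The constant [4] leaves room for a proof by the tangent inequality alone: for [y <= 1 / 2] from
    [expR (- y) >= 1 - y], and for [y > 1 / 2] because [1 <= (2 * y) ^+ 2]. *)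
Lemma expR_le_quadratic y : expR y <= 1 + y + 4 * expR `|y| * y ^+ 2.
Proof.
have e1 : 1 <= expR `|y| by rewrite -expR0 ler_expR.
have [y2|y2] := leP y (1 / 2).
  have ye : expR y * (1 - y) <= 1.
    have := expR_ge1Dx (- y); rewrite expRN => h.
    by rewrite mulrC -ler_pdivlMr ?expR_gt0// mul1r; move: h; rewrite (addrC 1).
  have h1 : expR y <= 1 + y + 2 * y ^+ 2.
    have yp : 0 < 1 - y by move: y2; clear; lra.
    rewrite -(ler_pM2r yp) (le_trans ye)//.
    have -> : (1 + y + 2 * y ^+ 2) * (1 - y) = 1 + y ^+ 2 * (1 - 2 * y) by ring.
    by rewrite lerDl mulr_ge0 ?sqr_ge0//; move: y2; clear; lra.
  rewrite (le_trans h1)// lerD2l ler_wpM2r ?sqr_ge0//.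
  by move: e1; clear; lra.
have y0 : 0 <= y by move: y2; clear; lra.
rewrite (ger0_norm y0) -addrA ler_wpDl// ?ler_wpDl//.
rewrite mulrAC ler_peMl ?expR_ge0//.
rewrite (_ : 4 * y ^+ 2 = (2 * y) ^+ 2); last by rewrite exprMn -natrX.
by rewrite exprn_ege1//; move: y2; clear; lra.
Qed.

Definition trunc c x : R := if `|x| <= c then x else 0.

Lemma measurable_trunc c : measurable_fun setT (trunc c).
Proof.
apply: measurable_fun_if => //.
  by apply: measurable_fun_ler => //; exact: measurable_normr.
Qed.

(** The coefficient of the moment of order [p] in the bound [expR_trunc_le]: the first term pays for
    the mean lost by the truncation at level [c], the second one for the quadratic part of the
    exponential. *)
Definition mgf_excess s c p : R := s * c `^ (1 - p) + 4 * s ^+ 2 * expR (s * c) * c `^ (2 - p).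

(** The linear term is that of [x] and not of its truncation, so that it disappears in expectation
    for centred variables. *)
Lemma expR_trunc_le (sg s c p x : R) : `|sg| = 1 -> 0 <= s -> 0 < c -> 1 < p <= 2 ->
  expR (s * (sg * trunc c x)) <= 1 + s * (sg * x) + mgf_excess s c p * `|x| `^ p.
Proof.
move=> sg1 s0 c0 /andP[p1 p2]; rewrite /trunc /mgf_excess mulrDl.
have t1 : 0 <= s * c `^ (1 - p) * `|x| `^ p by rewrite !mulr_ge0 ?powR_ge0.
have t2 : 0 <= 4 * s ^+ 2 * expR (s * c) * c `^ (2 - p) * `|x| `^ p.
  by rewrite !mulr_ge0 ?powR_ge0 ?sqr_ge0 ?expR_ge0.
have sgx : `|sg * x| = `|x| by rewrite normrM sg1 mul1r.
case: ifPn => [xc|]; last first.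
  rewrite -ltNge => xc; rewrite !mulr0 expR0 -addrA lerDl addrA addr_ge0//.
  rewrite -mulrA -mulrDr mulr_ge0// -lerBlDl sub0r (@le_trans _ _ `|x|)//.
    by rewrite -sgx -normrN ler_norm.
  have x0 : 0 < `|x| by exact: lt_trans xc.
  rewrite -[leLHS]powRr1// -{1}(subrK p 1) powRD; last by rewrite (gt_eqF x0) implybT.
  rewrite ler_pM2r ?powR_gt0// -(opprB p 1) !powRN lef_pV2 ?posrE ?powR_gt0//.
  by apply: ge0_ler_powR; rewrite ?nnegrE ?subr_ge0// ltW.
apply: (le_trans (expR_le_quadratic _)); rewrite lerD2l.
apply: (@le_trans _ _ (4 * s ^+ 2 * expR (s * c) * c `^ (2 - p) * `|x| `^ p)); last by rewrite lerDr.
have -> : (s * (sg * x)) ^+ 2 = s ^+ 2 * x ^+ 2.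
  by rewrite !exprMn -(real_normK (num_real sg)) sg1 expr1n mul1r.
rewrite normrM sgx (ger0_norm s0).
have e1 : expR (s * `|x|) <= expR (s * c) by rewrite ler_expR ler_wpM2l.
have x2 : x ^+ 2 <= c `^ (2 - p) * `|x| `^ p.
  have [->|x0] := eqVneq x 0; first by rewrite expr0n/= mulr_ge0 ?powR_ge0.
  have x0' : 0 < `|x| by rewrite normr_gt0.
  rewrite -(real_normK (num_real x)) -powR_mulrn// -{1}(subrK p 2%:R) powRD; last first.
    by rewrite (gt_eqF x0') implybT.
  rewrite ler_pM2r ?powR_gt0//; apply: ge0_ler_powR; rewrite ?nnegrE ?subr_ge0//.
  exact: ltW.
rewrite mulrACA -[leRHS]mulrA -mulrA.
rewrite (_ : 4 * (s ^+ 2 * _) = 4 * s ^+ 2 * (expR (s * `|x|) * x ^+ 2)); last by ring.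
rewrite -[X in _ <= X]mulrA ler_wpM2l ?mulr_ge0 ?sqr_ge0//.
by rewrite ler_pM ?expR_ge0 ?sqr_ge0.
Qed.

End exponential_bounds.

Section moments.
Context (R : realType) (d : measure_display) (Omega : measurableType d).
Variable P : probability Omega R.
Local Open Scope ereal_scope.

(** The [p]-th power is dominated by a series over the dyadic shells of [`|Z w|], whose terms have
    geometrically decreasing expectations. *)
Lemma moment_lty (Z : {RV P >-> R}) (p q C : R) : (0 < p < q)%R -> (0 <= C)%R ->
  (forall x, 1 <= x -> fine (P [set w | x <= `|Z w|]) <= C * x `^ (- q))%R ->
  \int[P]_w (`|Z w| `^ p)%:E < +oo.
Proof.
move=> /andP[p0 pq] C0 tail.
have mtail x : measurable [set w | (x <= `|Z w|)%R].
  rewrite -[X in measurable X]setTI (_ : [set w | _] = (fun w => `|Z w|%R) @^-1` `[x, +oo[).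
    by apply: measurableT_comp => //; exact: measurableT_comp.
  by apply/seteqP; split=> w /=; rewrite in_itv/= andbT.
pose f (k : nat) w : \bar R := (2 `^ (k.+1%:R * p) * \1_[set w | (2 ^+ k <= `|Z w|)%R] w)%:E.
have f0 k w : 0 <= f k w by rewrite lee_fin mulr_ge0 ?powR_ge0.
have mf k : measurable_fun setT (f k).
  by apply/measurable_EFinP; apply: measurable_funM => //; exact: measurable_indic.
have ptw w : (`|Z w| `^ p)%:E <= 1 + \sum_(k <oo) f k w.
  have [z1|z1] := ltP `|Z w|%R 1%R.
    rewrite -[leLHS]adde0 leeD ?nneseries_ge0// lee_fin.
    have [->|z0] := eqVneq `|Z w|%R 0%R; first by rewrite powR0 ?gt_eqF.
    rewrite -(powRr0 `|Z w|%R) ger_powR ?(ltW p0)//.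
    by rewrite lt_def z0 normr_ge0 ltW.
  have [k /andP[kz zk]] : exists k : nat, (2 ^+ k <= `|Z w| < 2 ^+ k.+1)%R.
    have ex : exists n : nat, (`|Z w| < 2 ^+ n)%R.
      exists (Num.truncn `|Z w|%R).+1; have /andP[_ h] := truncn_itv (normr_ge0 (Z w)).
      by rewrite (lt_le_trans h)// -natrX ler_nat ltnW// ltn_expl.
    case: (ex_minnP ex) => -[|n] zn nmin; first by rewrite expr0 ltNge z1 in zn.
    exists n; rewrite zn andbT leNgt; apply/negP => /nmin.
    by rewrite ltnn.
  rewrite (@le_trans _ _ (\sum_(0 <= i < k.+1) f i w))//; last first.
    rewrite -[leLHS]add0e leeD//.
    by apply: (nneseries_lim_ge k.+1) => i _ _; exact: f0.
  rewrite big_nat_recr//= -[leLHS]add0e leeD ?sume_ge0//.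
  rewrite /f indicE mem_set// mulr1 lee_fin.
  have -> : (2 `^ (k.+1%:R * p) = (2 ^+ k.+1) `^ p :> R)%R by rewrite powRrM powR_mulrn.
  by apply: ge0_ler_powR; rewrite ?nnegrE ?exprn_ge0// ltW.
apply: (@le_lt_trans _ _ (\int[P]_w (1 + \sum_(k <oo) f k w))).
  apply: ge0_le_integral => //.
  - apply/measurable_EFinP; apply: (measurableT_comp (measurable_powR _)).
    by apply: measurableT_comp => //; exact: measurable_normr.
  - by apply: emeasurable_funD => //; exact: ge0_emeasurable_sum.
rewrite ge0_integralD//; last 2 first.
- by move=> w _; exact: nneseries_ge0.
- exact: ge0_emeasurable_sum.
rewrite integral_cst//= mul1e [P setT]probability_setT lte_add_pinfty ?ltry//.
rewrite integral_nneseries//.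
pose r : R := (2 `^ (p - q))%R.
have r0 : (0 < r)%R by exact: powR_gt0.
have r1 : (r < 1)%R by have : (r < 2 `^ 0)%R; [rewrite gt1_ltr_powRr ?ltr1n ?subr_lt0|rewrite powRr0].
pose K : R := (2 `^ p * C)%R.
have K0 : (0 <= K)%R by rewrite mulr_ge0 ?powR_ge0.
have fk k : \int[P]_w f k w <= (K * r ^+ k)%:E.
  rewrite /f; under eq_integral do rewrite EFinM.
  rewrite ge0_integralZl ?lee_fin ?powR_ge0//; last first.
    by apply/measurable_EFinP; exact: measurable_indic.
  rewrite integral_indic// setIT.
  rewrite [X in _ * X](_ : _ = (fine (P [set w | (2 ^+ k <= `|Z w|)%R]))%:E); last first.
    by rewrite fineK// fin_num_measure.
  rewrite -EFinM lee_fin.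
  rewrite (@le_trans _ _ (2 `^ (k.+1%:R * p) * (C * (2 ^+ k) `^ (- q))))%R//.
    by rewrite ler_wpM2l ?powR_ge0// tail// exprn_ege1// ler1n.
  have two0 : (2 : R)%R != 0%R by rewrite pnatr_eq0.
  have pD (x y : R) : (2 `^ (x + y) = 2 `^ x * 2 `^ y :> R)%R by rewrite powRD// two0 implybT.
  have e1 : ((2 ^+ k) `^ (- q) = 2 `^ (k%:R * - q) :> R)%R by rewrite -powR_mulrn// powRrM.
  have e2 : (2 `^ (k.+1%:R * p) = 2 `^ p * 2 `^ (k%:R * p) :> R)%R.
    by rewrite -pD -natr1; congr (_ `^ _)%R; ring.
  have e3 : (r ^+ k = 2 `^ (k%:R * p) * 2 `^ (k%:R * - q))%R.
    by rewrite /r -powR_mulrn ?powR_ge0// -powRrM -pD; congr (_ `^ _)%R; ring.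
  by rewrite e1 e2 e3 /K le_eqVlt; apply/orP; left; apply/eqP; ring.
apply: (@le_lt_trans _ _ (K / (1 - r))%:E); last exact: ltry.
apply: lime_le; first by apply: is_cvg_nneseries => k _ _; exact: integral_ge0.
near=> n; apply: (@le_trans _ _ (\sum_(0 <= k < n) (K * r ^+ k)%:E)).
  by apply: lee_sum => k _; exact: fk.
rewrite sumEFin lee_fin -mulr_sumr ler_wpM2l//.
have r1' : (0 < 1 - r)%R by rewrite subr_gt0.
rewrite -[leRHS]mul1r ler_pdivlMr//.
have -> : ((\sum_(0 <= k < n) r ^+ k) * (1 - r) = 1 - r ^+ n)%R.
  by rewrite mulrC big_mkord -opprB mulNr -subrX1 opprB.
by rewrite gerBl exprn_ge0// ltW.
Unshelve. all: by end_near. Qed.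

End moments.

(** * Concentration of truncated sums *)

Section growth.
Variable R : realType.

Lemma le_pow_powR (c r : R) : 0 < c -> le_pow (fun n => (c * n%:R) `^ r) r.
Proof.
move=> c0; exists (c `^ r); first exact: powR_gt0.
by near=> n; rewrite ger0_norm ?powR_ge0// powRM// ltW.
Unshelve. all: by end_near. Qed.

Lemma le_pow_ln (eta : R) : 0 < eta -> le_pow (fun n => ln (n%:R : R)) eta.
Proof.
move=> eta0; exists eta^-1; first by rewrite invr_gt0.
near=> n.
have n1 : (0 < n)%N by near: n; exact: nbhs_infty_gt.
have n0 : 0 < n%:R :> R by rewrite ltr0n.
rewrite ger0_norm; last by rewrite ln_ge0// ler1n.
rewrite mulrC ler_pdivlMr// mulrC -ln_powR.
have h := expR_ge1Dx (ln (n%:R `^ eta)).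
rewrite lnK ?posrE ?powR_gt0// in h.
by rewrite (le_trans _ h)// lerDr.
Unshelve. all: by end_near. Qed.

End growth.

Section truncated_sums.
Context (R : realType) (d : measure_display) (Omega : measurableType d).
Variable P : probability Omega R.
Variable X : nat -> {RV P >-> R}.
Hypothesis iidX : iid X.
Hypothesis X_mean : (\int[P]_w (X 0%N w)%:E = 0)%E.
Variable p : R.
Hypothesis p12 : 1 < p <= 2.
Hypothesis X_moment : (\int[P]_w (`|X 0%N w| `^ p)%:E < +oo)%E.

Let m : R := fine (\int[P]_w (`|X 0%N w| `^ p)%:E)%E.

Let mE : (\int[P]_w (`|X 0%N w| `^ p)%:E = m%:E)%E.
Proof.
by rewrite /m fineK// ge0_fin_numE//; apply: integral_ge0 => w _; rewrite lee_fin powR_ge0.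
Qed.

Let m_ge0 : 0 <= m.
Proof. by rewrite -lee_fin -mE; apply: integral_ge0 => w _; rewrite lee_fin powR_ge0. Qed.

Let measurable_moment : measurable_fun setT (fun w => `|X 0%N w| `^ p).
Proof.
by apply: (measurableT_comp (measurable_powR _)); exact: measurableT_comp.
Qed.

Let integrable_moment : P.-integrable setT (fun w => (`|X 0%N w| `^ p)%:E).
Proof.
apply/integrableP; split; first exact/measurable_EFinP.
under eq_integral => w _ do rewrite gee0_abs ?lee_fin ?powR_ge0//.
exact: X_moment.
Qed.

Let integrable_X : P.-integrable setT (fun w => (X 0%N w)%:E).
Proof.
have i1 : P.-integrable setT (fun=> 1%:E) by apply: finite_measure_integrable_cst.
apply: (@le_integrable _ _ _ P _ measurableT _ (fun w => 1%:E + (`|X 0%N w| `^ p)%:E)%E) => //.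
- exact/measurable_EFinP.
- move=> w _; rewrite -EFinD !abse_EFin lee_fin [leRHS]ger0_norm ?addr_ge0 ?powR_ge0//.
  have [x1|x1] := leP `|X 0%N w| 1; first by rewrite (le_trans x1)// lerDl powR_ge0.
  rewrite (@le_trans _ _ (`|X 0%N w| `^ p))// ?lerDr// le1r_powR ?ltW//.
  by have /andP[] := p12.
- exact: (integrableD measurableT i1 integrable_moment).
Qed.

Definition trunc_sum (c : R) k w : R := \sum_(i < k) trunc c (X i w).

Lemma measurable_trunc_sum c k : measurable_fun setT (trunc_sum c k).
Proof.
apply: measurable_sum => i; apply: measurableT_comp => //; exact: measurable_trunc.
Qed.

(** Taking expectations in [expR_trunc_le]: the linear term vanishes since the mean is zero. *)
Lemma mgf_trunc_le (sg s c : R) : `|sg| = 1 -> 0 <= s -> 0 < c ->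
  (\int[P]_w (expR (s * (sg * trunc c (X 0%N w))))%:E <= (1 + mgf_excess s c p * m)%:E)%E.
Proof.
move=> sg1 s0 c0; set k := mgf_excess s c p.
have k0 : 0 <= k by rewrite /k /mgf_excess addr_ge0// !mulr_ge0 ?powR_ge0 ?expR_ge0 ?sqr_ge0.
have i1 : P.-integrable setT (fun=> 1%:E) by apply: finite_measure_integrable_cst.
have i2 : P.-integrable setT (fun w => ((s * sg)%:E * (X 0%N w)%:E)%E) by exact: integrableZl.
have i3 : P.-integrable setT (fun w => (k%:E * (`|X 0%N w| `^ p)%:E)%E) by exact: integrableZl.
have i12 := integrableD measurableT i1 i2.
have i123 := integrableD measurableT i12 i3.
have -> : ((1 + k * m)%:E = \int[P]_w (1%:E + (s * sg)%:E * (X 0%N w)%:E + k%:E * (`|X 0%N w| `^ p)%:E))%E.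
  rewrite integralD// integralD// integralZl// integralZl// X_mean mE mule0 adde0.
  by rewrite integral_cst//= mul1e [P setT]probability_setT.
have mY : measurable_fun setT (fun w => (expR (s * (sg * trunc c (X 0%N w))))%:E).
  apply/measurable_EFinP; apply: measurableT_comp => //.
  apply: measurable_funM => //; apply: measurable_funM => //.
  by apply: measurableT_comp => //; exact: measurable_trunc.
apply: le_integral => //.
  apply: (le_integrable measurableT mY _ i123) => w _.
  rewrite -!EFinM -!EFinD !abse_EFin lee_fin ger0_norm ?expR_ge0//.
  apply: le_trans (ler_norm _); rewrite -mulrA; exact: expR_trunc_le.
by move=> w _; rewrite -!EFinM -!EFinD lee_fin -mulrA; exact: expR_trunc_le.
Qed.

(** The exponential Markov inequality, followed by the factorization over the independent
    increments. The sign [sg] gives both tails at once. *)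
Lemma chernoff_trunc_sum (sg s c a : R) k : `|sg| = 1 -> 0 <= s -> 0 < c ->
  fine (P [set w | a <= sg * trunc_sum c k w]) <= expR (- (s * a) + k%:R * (mgf_excess s c p * m)).
Proof.
move=> sg1 s0 c0; set A := [set w | _].
have mA : measurable A.
  rewrite /A (_ : [set w | _] = (fun w => sg * trunc_sum c k w) @^-1` `[a, +oo[).
    rewrite -[X in measurable X]setTI; apply: measurable_funM => //.
    exact: measurable_trunc_sum.
  by apply/seteqP; split=> w /=; rewrite in_itv/= andbT.
pose f x := expR (s * (sg * trunc c x)).
have mf : measurable_fun setT f.
  apply: measurableT_comp => //; apply: measurable_funM => //; apply: measurable_funM => //.
  exact: measurable_trunc.
have f0 x : 0 <= f x by exact: expR_ge0.
have fle := mgf_trunc_le sg1 s0 c0.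
have ffin : (\int[P]_w (f (X 0%N w))%:E)%E \is a fin_num.
  rewrite ge0_fin_numE; first by rewrite (le_lt_trans fle)// ltry.
  by apply: integral_ge0 => w _; rewrite lee_fin.
have mfX i : measurable_fun setT (fun w => f (X i w)) by exact: measurableT_comp.
have PA : (P A <= (expR (- (s * a)))%:E * \int[P]_w (\prod_(i < k) f (X i w))%:E)%E.
  have -> : (P A = \int[P]_w (\1_A w)%:E)%E by rewrite integral_indic// setIT.
  rewrite -[X in (_ <= X)%E]ge0_integralZl//; last 2 first.
  - by apply/measurable_EFinP; apply: measurable_prod => i _; exact: mfX.
  - by move=> w _; rewrite lee_fin; apply: prodr_ge0.
  apply: ge0_le_integral => //.
  - by apply/measurable_EFinP; exact: measurable_indic.
  - apply/measurable_EFinP; apply: measurable_funM => //.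
    by apply: measurable_prod => i _; exact: mfX.
  - move=> w _; rewrite -EFinM lee_fin indicE.
    have [|_] := boolP (w \in A); last by rewrite mulr_ge0 ?expR_ge0// prodr_ge0.
    rewrite inE /A/= => aw.
    have -> : \prod_(i < k) f (X i w) = expR (s * (sg * trunc_sum c k w)).
      by rewrite /trunc_sum !mulr_sumr expR_sum.
    by rewrite -expRD -expR0 ler_expR addrC subr_ge0 ler_wpM2l.
rewrite -lee_fin fineK ?fin_num_measure// (le_trans PA)//.
rewrite expRD EFinM lee_pmul2l ?lte_fin ?expR_gt0//.
rewrite iid_expectation_prod// (@le_trans _ _ ((1 + mgf_excess s c p * m) ^+ k)%:E)//.
  move: fle; rewrite -(fineK ffin) -EFin_expe !lee_fin => fle.
  by apply: lerXn2r => //; rewrite nnegrE; [apply: fine_ge0; apply: integral_ge0 => w _; rewrite lee_fin|rewrite (le_trans _ fle)//; apply: fine_ge0; apply: integral_ge0 => w _; rewrite lee_fin].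
rewrite lee_fin expRM_natl lerXn2r ?nnegrE ?expR_ge0 ?expR_ge1Dx//.
by rewrite addr_ge0// mulr_ge0// /mgf_excess addr_ge0// !mulr_ge0 ?powR_ge0 ?expR_ge0 ?sqr_ge0.
Qed.

(** Partial sums at all times up to [n]: a uniform approximation of the path is needed. *)
Definition big_trunc_sum (c a : R) n : set Omega :=
  [set w | exists k : 'I_n.+1, a <= `|trunc_sum c k w|].

Lemma measurable_trunc_sum_ge (c a sg : R) k : measurable [set w | a <= sg * trunc_sum c k w].
Proof.
rewrite (_ : [set w | _] = (fun w => sg * trunc_sum c k w) @^-1` `[a, +oo[).
  rewrite -[X in measurable X]setTI; apply: measurable_funM => //.
  exact: measurable_trunc_sum.
by apply/seteqP; split=> w /=; rewrite in_itv/= andbT.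
Qed.

Let big_trunc_sumE c a n : big_trunc_sum c a n =
  [set w | exists k : 'I_n.+1, a <= 1 * trunc_sum c k w] `|`
  [set w | exists k : 'I_n.+1, a <= -1 * trunc_sum c k w].
Proof.
apply/seteqP; split => w /=.
  move=> [k]; have [h|h] := leP 0 (trunc_sum c k w); last first.
    by rewrite ltr0_norm// => ?; right; exists k; rewrite mulN1r.
  by rewrite ger0_norm// => ?; left; exists k; rewrite mul1r.
move=> [|] [k h]; exists k; apply: (le_trans h).
  by rewrite mul1r ler_norm.
by rewrite mulN1r -normrN ler_norm.
Qed.

Let measurable_half (c a sg : R) n : measurable [set w | exists k : 'I_n.+1, a <= sg * trunc_sum c k w].
Proof. by apply: measurable_set_exists => k; exact: measurable_trunc_sum_ge. Qed.

Lemma measurable_big_trunc_sum c a n : measurable (big_trunc_sum c a n).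
Proof. by rewrite big_trunc_sumE; apply: measurableU; exact: measurable_half. Qed.

Lemma big_trunc_sum_le (s c a : R) n : 0 <= s -> 0 < c ->
  fine (P (big_trunc_sum c a n)) <=
  (2 * n.+1)%:R * expR (- (s * a) + n%:R * (mgf_excess s c p * m)).
Proof.
move=> s0 c0; set e := expR _.
have ke : 0 <= mgf_excess s c p * m.
  by rewrite mulr_ge0// /mgf_excess addr_ge0// !mulr_ge0 ?powR_ge0 ?expR_ge0 ?sqr_ge0.
have ch sg : `|sg| = 1 -> prob P [set w | exists k : 'I_n.+1, a <= sg * trunc_sum c k w] <= n.+1%:R * e.
  move=> sg1; apply: le_trans; first by apply: prob_exists_le => k; exact: measurable_trunc_sum_ge.
  apply: (@le_trans _ _ (\sum_(k < n.+1) e)); last by rewrite sumr_const card_ord mulr_natl.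
  apply: ler_sum => k _; rewrite /prob (le_trans (chernoff_trunc_sum _ _ sg1 s0 c0))//.
  by rewrite ler_expR lerD2l ler_wpM2r// ler_nat -ltnS.
rewrite big_trunc_sumE -/(prob P _); apply: le_trans; first by apply: probU_le; exact: measurable_half.
rewrite natrM -mulrA mulr_natl mulr2n lerD// ch ?normr1// normrN normr1//.
Qed.

(** The exponential bound is used with [s = theta * ln n / n], where [theta = (M + 1) / delta], so
    that [expR (- s * delta * n)] is [n `^ (- (M + 1))]; one power of [n] is lost in the union over
    the times. The truncation at [eps * n] costs a factor [n `^ (theta * eps)] in the quadratic
    term, which the moment of order [p > 1] absorbs when [theta * eps <= (p - 1) / 2]. *)
Lemma small_jumps (delta M : R) : 0 < delta -> 0 < M ->
  exists2 eps0 : R, 0 < eps0 & forall eps, 0 < eps <= eps0 ->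
  le_pow (fun n => fine (P (big_trunc_sum (eps * n%:R) (delta * n%:R) n))) (- M).
Proof.
move=> delta0 M0; have /andP[p1 p2] := p12.
pose theta := (M + 1) / delta.
have pm1 : 0 < p - 1 by rewrite subr_gt0.
have theta0 : 0 < theta by rewrite divr_gt0// addr_gt0.
(* The exponent granted to the logarithms, small enough to keep the two exponents below negative. *)
pose h := (p - 1) / 8.
have h0 : 0 < h by rewrite divr_gt0.
exists ((p - 1) / 2 / theta); first by apply: divr_gt0 => //; exact: divr_gt0.
move=> eps /andP[eps0 epsle].
have te : theta * eps <= (p - 1) / 2 by rewrite [theta * eps]mulrC -ler_pdivlMr.
pose s n : R := theta * ln n%:R / n%:R.
pose excess n := n%:R * (mgf_excess (s n) (eps * n%:R) p * m).
have excess0 : excess @ \oo --> (0 : R).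
  have g1 : le_pow (fun n => theta * m * (ln n%:R * (eps * n%:R) `^ (1 - p))) (0 + (h + (1 - p))).
    by apply: le_powM; [exact: le_pow_cst|apply: le_powM; [exact: le_pow_ln|exact: le_pow_powR]].
  have g2 : le_pow (fun n => 4 * theta ^+ 2 * m * ((ln n%:R) ^+ 2 *
      ((1 * n%:R) `^ (-1) * ((1 * n%:R) `^ (theta * eps) * (eps * n%:R) `^ (2 - p)))))
      (0 + (h * 2%:R + (-1 + (theta * eps + (2 - p))))).
    apply: le_powM; [exact: le_pow_cst|apply: le_powM; [apply: le_powX; exact: le_pow_ln|]].
    by apply: le_powM; [exact: le_pow_powR|apply: le_powM; exact: le_pow_powR].
  have neg1 : 0 + (h + (1 - p)) < 0.
    have aux (q : R) : 1 < q -> 0 + ((q - 1) / 8 + (1 - q)) < 0 by lra.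
    exact: aux.
  have neg2 : 0 + (h * 2%:R + (-1 + (theta * eps + (2 - p)))) < 0.
    have aux (t q : R) : 1 < q -> t <= (q - 1) / 2 ->
        0 + ((q - 1) / 8 * 2%:R + (-1 + (t + (2 - q)))) < 0 by lra.
    exact: aux.
  have sum0 := cvgD (le_pow_cvg0 neg1 g1) (le_pow_cvg0 neg2 g2).
  rewrite -[X in _ --> X](addr0 0); apply: cvg_trans; last exact: sum0.
  apply: near_eq_cvg; near=> n.
  have n0 : 0 < n%:R :> R by rewrite ltr0n; near: n; exact: nbhs_infty_gt.
  rewrite /excess /mgf_excess /s fctE /= !mul1r.
  have -> : expR (theta * ln n%:R / n%:R * (eps * n%:R)) = n%:R `^ (theta * eps).
    by rewrite /powR gt_eqF//; congr expR; field; rewrite gt_eqF.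
  rewrite powRN powRr1 ?ltW//.
  by field; rewrite gt_eqF.
exists (4 * expR 1); first by rewrite mulr_gt0// expR_gt0.
near=> n.
have n1 : (0 < n)%N by near: n; exact: nbhs_infty_gt.
have n0 : 0 < n%:R :> R by rewrite ltr0n.
have s0 : 0 <= s n by rewrite /s divr_ge0// mulr_ge0 ?(ltW theta0)// ln_ge0// ler1n.
rewrite ger0_norm ?fine_ge0//.
apply: (le_trans (@big_trunc_sum_le (s n) (eps * n%:R) (delta * n%:R) n s0 (mulr_gt0 eps0 n0))).
have -> : s n * (delta * n%:R) = (M + 1) * ln n%:R.
  by rewrite /s /theta; field; rewrite !gt_eqF.
have e1 : excess n <= 1 by near: n; apply: cvgr_le excess0 _ _.
rewrite (@le_trans _ _ (4 * n%:R * expR (- ((M + 1) * ln n%:R) + 1)))//.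
  rewrite ler_pM ?expR_ge0//; last by rewrite ler_expR lerD2l.
  rewrite -natrM ler_nat (_ : 4%N = (2 * 2)%N)// -mulnA leq_pmul2l//.
  by rewrite mul2n -addnn -addn1 leq_add2l.
rewrite expRD -mulNr.
have -> : expR (- (M + 1) * ln n%:R) = n%:R `^ (- M) / n%:R.
  rewrite -[X in _ / X]powRr1 ?ltW// -powRN -powRD; last by rewrite (gt_eqF n0) implybT.
  by rewrite /powR gt_eqF// opprD.
rewrite le_eqVlt; apply/orP; left; apply/eqP; field; rewrite gt_eqF//.
Unshelve. all: by end_near. Qed.

End truncated_sums.

(** * Powers of a sigma-finite measure *)

Local Open Scope ereal_scope.

Section power_measures.
Variable R : realType.
Variable mu : {sigma_finite_measure set R -> \bar R}.

Definition cons_tuple n (p : R * n.-tuple R) : n.+1.-tuple R := [tuple of p.1 :: p.2].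

Lemma measurable_cons_tuple n : measurable_fun setT (@cons_tuple n).
Proof. exact: measurable_cons. Qed.

Section cons_measure.
Variables (n : nat) (nu : {sigma_finite_measure set n.-tuple R -> \bar R}).

(** One step of [power_measure], as a measure of its own so that sigma-finiteness can be carried
    along the recursion. *)
Definition cons_measure := pushforward (mu \x nu) (@cons_tuple n).

Let cons0 : cons_measure set0 = 0.
Proof. by rewrite /cons_measure /pushforward preimage_set0 measure0. Qed.

Let cons_ge0 A : 0 <= cons_measure A.
Proof. by apply: integral_ge0 => x _; exact: measure_ge0. Qed.

Let cons_sigma_additive : semi_sigma_additive cons_measure.
Proof.
move=> F mF tF mUF; rewrite /cons_measure /pushforward preimage_bigcup.
have mpre A : measurable A -> measurable (@cons_tuple n @^-1` A).
  by move=> mA; rewrite -[X in measurable X]setTI; exact: measurable_cons_tuple.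
have := @measure_semi_sigma_additive _ _ _ [the measure _ _ of (mu \x nu)] (fun k => @cons_tuple n @^-1` F k).
apply.
- by move=> k; apply: mpre; exact: mF.
- apply/trivIsetP => /= i j _ _ ij; rewrite -preimage_setI.
  by move/trivIsetP : tF => /(_ _ _ _ _ ij) ->//; rewrite preimage_set0.
- by rewrite -preimage_bigcup; exact: mpre.
Qed.

HB.instance Definition _ := isMeasure.Build _ _ _ cons_measure
  cons0 cons_ge0 cons_sigma_additive.

Lemma cons_measure_rect (A : set R) (B : set (n.-tuple R)) :
  measurable A -> measurable B ->
  cons_measure [set t | A (thead t) /\ B [tuple of behead t]] = mu A * nu B.
Proof.
move=> mA mB; rewrite /cons_measure /pushforward.
rewrite -(product_measure1E mu nu mA mB); congr (_ _).
apply/seteqP; split=> -[x t] /=; rewrite theadE => -[Ax]; set s := [tuple of _].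
  by have -> : s = t by exact: val_inj.
by move=> Bt; have -> : s = t by exact: val_inj.
Qed.

Let cons_sigma_finite : sigma_finite setT cons_measure.
Proof.
have /sigma_finiteP[F [TF ndF Foo]] := sigma_finiteT mu.
have /sigma_finiteP[G [TG ndG Goo]] := sigma_finiteT nu.
exists (fun k => [set t | F k (thead t) /\ G k [tuple of behead t]]).
  apply/esym; rewrite -subTset => t _.
  have [k _ Fk] : (\bigcup_k F k) (thead t) by rewrite -TF.
  have [l _ Gl] : (\bigcup_k G k) [tuple of behead t] by rewrite -TG.
  exists (maxn k l) => //; split.
    by move: Fk; exact/subsetPset/ndF/leq_maxl.
  by move: Gl; exact/subsetPset/ndG/leq_maxr.
move=> k; have [mF Fk] := Foo k; have [mG Gk] := Goo k; split.
  apply: measurableI.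
    rewrite -[X in measurable X]setTI; exact: (measurable_tnth ord0).
  by rewrite -[X in measurable X]setTI; exact: (@measurable_behead _ _ n).
by rewrite cons_measure_rect// lte_mul_pinfty// ge0_fin_numE.
Qed.

HB.instance Definition _ := Measure_isSigmaFinite.Build _ _ _ cons_measure
  cons_sigma_finite.

End cons_measure.

(** The sigma-finite measure behind the set function [power_measure] ([sfpowerE]). *)
Fixpoint sfpower n : {sigma_finite_measure set n.-tuple R -> \bar R} :=
  match n with
  | 0 => [the {sigma_finite_measure set 0.-tuple R -> \bar R} of \d_[tuple]]
  | n'.+1 => [the {sigma_finite_measure set n'.+1.-tuple R -> \bar R} of cons_measure (sfpower n')]
  end.

Lemma sfpowerE n : @power_measure R mu n = sfpower n :> (set _ -> \bar R).
Proof. by elim: n => [|n IH]//=; rewrite IH. Qed.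

Lemma sfpowerS n (A : set R) (B : set (n.-tuple R)) : measurable A -> measurable B ->
  sfpower n.+1 [set t | A (thead t) /\ B [tuple of behead t]] = mu A * sfpower n B.
Proof. exact: cons_measure_rect. Qed.

Lemma sfpowerS_section n (X : set (n.+1.-tuple R)) :
  sfpower n.+1 X = \int[mu]_x sfpower n [set t | X (cons_tuple (x, t))].
Proof.
rewrite /= /cons_measure /pushforward /product_measure1.
apply: eq_integral => x _ /=; congr (_ _).
by apply/seteqP; split=> t; rewrite /xsection /= inE.
Qed.

Lemma sfpower_box n (B : 'I_n -> set R) : (forall i, measurable (B i)) ->
  sfpower n [set t | forall i, B i (tnth t i)] = \prod_(i < n) mu (B i).
Proof.
elim: n B => [|n IH] B mB.
  rewrite big_ord0 /= (_ : [set t | _] = setT) ?diracT//.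
  by apply/seteqP; split => // t _ [].
rewrite big_ord_recl -IH// -sfpowerS//.
  congr (_ _); apply/seteqP; split => [t tB /=|t /= [t0 tB] i].
    split; first exact: tB.
    by move=> i; have := tB (lift ord0 i); rewrite {1}(tuple_eta t) tnthS.
  have [j ->|->] := unliftP ord0 i; last exact: t0.
  by rewrite (tuple_eta t) tnthS; exact: tB.
rewrite (_ : [set t | _] = \bigcap_(i in [set: 'I_n])
    ((@tnth _ R)^~ i @^-1` B (lift ord0 i))); last first.
  by apply/seteqP; split => [t tB i _|t tB i]; [exact: tB|exact: (tB i Logic.I)].
apply: fin_bigcap_measurable => // i _.
by rewrite -[X in measurable X]setTI; exact: measurable_tnth.
Qed.

Lemma sfpower_boxr n (B : 'I_n -> set R) (r : 'I_n -> R) :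
  (forall i, measurable (B i)) -> (forall i, mu (B i) = (r i)%:E) ->
  sfpower n [set t | forall i, B i (tnth t i)] = (\prod_(i < n) r i)%:E.
Proof.
move=> mB Br; rewrite sfpower_box// (eq_bigr (fun i => (r i)%:E))//.
by rewrite -prodEFin.
Qed.

Lemma sfpower_tnth_null n (i : 'I_n) (A : set R) : measurable A -> mu A = 0 ->
  sfpower n [set t | A (tnth t i)] = 0.
Proof.
move=> mA muA; pose B j := if j == i then A else setT.
have -> : [set t : n.-tuple R | A (tnth t i)] = [set t | forall j, B j (tnth t j)].
  apply/seteqP; split => t /=.
    by move=> At j; rewrite /B; case: eqP => [->|].
  by move=> /(_ i); rewrite /B eqxx.
rewrite sfpower_box; last by move=> j; rewrite /B; case: ifP.
by rewrite (bigD1 i)//= {1}/B eqxx muA mul0e.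
Qed.

(** Conditionally on the first coordinate, a tie with it is a null set by atomlessness; the other
    ties are handled by recursion. *)
Lemma sfpower_tie n (i j : 'I_n) : (forall x, mu [set x] = 0) -> i != j ->
  sfpower n [set t | tnth t i = tnth t j] = 0.
Proof.
move=> atomless; elim: n i j => [[]//|n IH] i j ij.
wlog : i j ij / (i < j)%N.
  move=> W; move: (ij); rewrite -val_eqE neq_ltn => /orP[|] h; first exact: W.
  by rewrite -(W j i) 1?eq_sym//; congr (_ _); apply/seteqP; split => t /=.
move=> {}ij; have [j' jE|jE] := unliftP ord0 j; last by rewrite jE in ij.
rewrite sfpowerS_section; have [i' iE|iE] := unliftP ord0 i; last first.
  rewrite integral0_eq// => x _; rewrite iE jE.
  rewrite -[RHS](sfpower_tnth_null j' (measurable_set1 x) (atomless x)).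
  by congr (_ _); apply/seteqP; split => t /=; rewrite tnthS /cons_tuple tnth0 /= => <-.
rewrite integral0_eq// => x _; rewrite iE jE.
rewrite -[RHS](IH i' j'); last first.
  by apply: contraTneq ij => ij; rewrite iE jE ij ltnn.
by congr (_ _); apply/seteqP; split => t /=; rewrite !tnthS.
Qed.

End power_measures.
Local Close Scope ereal_scope.

(** * The measures of the jump sizes and of the jump times *)

Local Open Scope ereal_scope.

Section nu_measure.
Variables (R : realType) (gamma : R).
Hypothesis g0 : (0 < gamma)%R.

(** The positivity of [gamma] is an argument of the definition, since the measure structure
    attached to this function depends on it. *)
Definition nu_measure of (0 < gamma)%R : set R -> \bar R := nu gamma.

Let density (x : R) : \bar R := (gamma * x `^ (- gamma - 1))%:E.

Let density_ge0 x : 0 <= density x.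
Proof. by rewrite lee_fin mulr_ge0 ?powR_ge0// ltW. Qed.

Let measurable_density D : measurable_fun D density.
Proof.
apply: measurable_funTS; apply: measurableT_comp => //.
by apply: measurable_funM; [exact: measurable_cst|exact: measurable_powR].
Qed.

Local Notation nug := (nu_measure g0).

Let nu0 : nug set0 = 0.
Proof. by rewrite /nu_measure /nu set0I integral_set0. Qed.

Let nu_ge0 A : 0 <= nug A.
Proof. by apply: integral_ge0 => x _; exact: density_ge0. Qed.

Let nu_sigma_additive : semi_sigma_additive nug.
Proof.
move=> F mF tF mUF; rewrite /nu_measure /nu setI_bigcupl; apply: cvg_toP.
  apply: ereal_nondecreasing_is_cvgn => m n mn.
  by apply: lee_sum_nneg_natr => // k _ _; exact: nu_ge0.
rewrite ge0_integral_bigcup//=.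
- move=> k; apply: measurableI; [exact: mF|exact: measurable_itv].
- exact: measurable_density.
- by move=> x _; exact: density_ge0.
- apply/trivIsetP => i j _ _ ij; rewrite setIACA.
  by move/trivIsetP : tF => /(_ _ _ _ _ ij) ->//; rewrite set0I.
Qed.

HB.instance Definition _ := isMeasure.Build _ _ _ nug nu0 nu_ge0 nu_sigma_additive.

Lemma nu_set1 x : nug [set x] = 0.
Proof.
apply: null_set_integral; [by apply: measurableI|exact: measurable_density|].
apply/eqP; rewrite -measure_le0 -(lebesgue_measure_set1 x).
by apply: le_measure; rewrite ?inE//; apply: measurableI.
Qed.

Lemma nu_ray x : (0 < x)%R -> nug `[x, +oo[ = (x `^ (- gamma))%:E.
Proof.
move=> x0; rewrite -(@setU1itv _ _ +oo%O x false)// measureU//; last first.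
  by rewrite -subset0 => y [/= ->]; rewrite /= in_itv/= ltxx.
by rewrite [X in X + _]nu_set1 add0e; exact: nu_tail.
Qed.

Lemma nu_itv a b : (0 < a <= b)%R ->
  nug `[a, b[ = (a `^ (- gamma) - b `^ (- gamma))%:E.
Proof.
move=> /andP[a0 ab]; have b0 := lt_le_trans a0 ab.
have : nug `[a, +oo[ = nug `[a, b[ + nug `[b, +oo[.
  rewrite -measureU//; last first.
    by rewrite -subset0 => y []; rewrite /= !in_itv/= andbT => /andP[_ /lt_le_trans /[apply]]; rewrite ltxx.
  by congr (_ _); rewrite -(@itv_bndbnd_setU _ _ _ (BLeft b))//= bnd_simp.
rewrite !nu_ray//; case: (nug `[a, b[) => [r| |] // /eqP.
by rewrite -EFinD eqe => /eqP ->; rewrite addrK.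
Qed.

Let nu_sigma_finite : sigma_finite setT nug.
Proof.
exists (fun k => `]-oo, 0%R] `|` `](k.+1%:R^-1)%R, +oo[).
  apply/esym; rewrite -subTset => x _; have [x0|x0] := leP x 0%R.
    by exists 0%N => //; left; rewrite /= in_itv.
  exists (Num.truncn x^-1) => //; right; rewrite /= in_itv/= andbT.
  by rewrite invf_plt ?posrE// truncnS_gt.
move=> k; split; first exact: measurableU.
apply: le_lt_trans; first exact: measureU2.
rewrite [X in X + _](_ : _ = 0) ?add0e; last first.
  change (nu gamma `]-oo, 0%R] = 0).
  rewrite /nu (_ : _ `&` _ = set0) ?integral_set0//.
  rewrite -subset0 => x []; rewrite /= !in_itv/= andbT => x0 /(le_lt_trans x0).
  by rewrite ltxx.
by rewrite [X in X < _]nu_tail// ?invr_gt0// ltry.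
Qed.

HB.instance Definition _ := Measure_isSigmaFinite.Build _ _ _ nug nu_sigma_finite.

End nu_measure.

Section uniform_measure.
Variable R : realType.
Local Notation U := (uniform_prob (@ltr01 R)).
Let uniform01_0 : @uniform01 R set0 = 0. Proof. exact: (measure0 U). Qed.
Let uniform01_ge0 A : 0 <= @uniform01 R A. Proof. exact: (measure_ge0 U). Qed.
Let uniform01_sigma_additive : semi_sigma_additive (@uniform01 R).
Proof. exact: (@measure_semi_sigma_additive _ _ _ U). Qed.
HB.instance Definition _ := isMeasure.Build _ _ _ (@uniform01 R) uniform01_0 uniform01_ge0 uniform01_sigma_additive.
Let uniform01_setT : @uniform01 R setT = 1. Proof. exact: (@probability_setT _ _ _ U). Qed.
HB.instance Definition _ := @Measure_isProbability.Build _ _ R (@uniform01 R) uniform01_setT.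

Lemma uniform01_itv (a b : R) : (0 <= a)%R -> (a <= b)%R -> (b <= 1)%R ->
  @uniform01 R `[a, b[ = (b - a)%:E.
Proof.
move=> a0 ab b1; rewrite /uniform01 /uniform_prob.
rewrite (eq_integral (fun=> 1)); last first.
  move=> x; rewrite inE/= in_itv/= => /andP[ax xb].
  by rewrite /uniform_pdf (le_trans a0 ax) (le_trans (ltW xb) b1)/= subr0 invr1.
rewrite integral_cst//= mul1e lebesgue_measure_itv/= lte_fin.
by case: ltgtP ab => // ->; rewrite subrr.
Qed.

Lemma uniform01_null (A : set R) : measurable A -> lebesgue_measure A = 0 ->
  @uniform01 R A = 0.
Proof.
move=> mA A0; rewrite /uniform01 /uniform_prob; apply: null_set_integral => //.
apply: measurable_funTS; apply: measurableT_comp => //.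
exact: measurable_uniform_pdf.
Qed.

Lemma uniform01_set1 (x : R) : @uniform01 R [set x] = 0.
Proof. by apply: uniform01_null => //; exact: lebesgue_measure_set1. Qed.

Lemma uniform01_out : @uniform01 R (~` `]0%R, 1%R[) = 0.
Proof.
apply/eqP; rewrite -measure_le0.
have h : @uniform01 R (~` `[0%R, 1%R]) = 0.
  rewrite /uniform01 /uniform_prob integral0_eq// => x /= /negP.
  by rewrite in_itv/= /uniform_pdf => /negbTE ->.
have -> : ~` `]0%R, 1%R[ = ~` `[0%R, 1%R] `|` ([set 0%R] `|` [set 1%R]) :> set R.
  apply/seteqP; split=> x /=; rewrite !in_itv/=.
    move=> /negP; rewrite negb_and -!leNgt => /orP[x0|x1].
      have [->|x0'] := eqVneq x 0%R; first by right; left.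
      by left; apply/negP; rewrite negb_and -!ltNge lt_neqAle x0' x0.
    have [->|x0'] := eqVneq x 1%R; first by right; right.
    by left; apply/negP; rewrite negb_and -!ltNge [(1 < x)%R]lt_neqAle eq_sym x0' x1 orbT.
  move=> [/negP|[->|->]]; last 2 first.
  - by rewrite ltxx.
  - by rewrite ltxx andbF.
  by rewrite negb_and -!ltNge => /orP[x0|x0]; apply/negP; rewrite negb_and -!leNgt (ltW x0) ?orbT.
have m1 : measurable (~` `[0%R, 1%R] : set R) by apply: measurableC.
apply: le_trans; first by apply: measureU2 => //; exact: measurableU.
rewrite [X in X + _]h add0e; apply: le_trans; first exact: measureU2.
by rewrite [X in X + _]uniform01_set1 add0e [leLHS]uniform01_set1.
Qed.

End uniform_measure.
Local Close Scope ereal_scope.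

(** * The joint law of the limiting jumps *)

Local Open Scope ereal_scope.

Section arbitrary_integrands.
Context d (T : measurableType d) (R : realType) (mu : {measure set T -> \bar R}).
Import HBNNSimple.

(** The integral of a nonnegative function is a supremum over the simple functions below it, which
    is monotone without any measurability. *)
Lemma le_integral_arbitrary (f g : T -> \bar R) : (forall x, 0 <= f x) ->
  (forall x, f x <= g x) -> \int[mu]_x f x <= \int[mu]_x g x.
Proof.
move=> f0 fg; have g0 x : 0 <= g x := le_trans (f0 x) (fg x).
rewrite !ge0_integralE// !patch_setT; apply: le_ereal_sup => _ [h hf <-].
by exists h => // x; exact: le_trans (fg x).
Qed.

(** Measurability of [f] is not available on [N]; [f] is squeezed between the functions equal to [g]
    outside [N] and to [0] or [+oo] on it. *)
Lemma integral_eq_off_null (f g : T -> \bar R) (N : set T) :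
  measurable N -> mu N = 0 -> measurable_fun setT g ->
  (forall x, 0 <= f x) -> (forall x, 0 <= g x) -> (forall x, ~ N x -> f x = g x) ->
  \int[mu]_x f x = \int[mu]_x g x.
Proof.
move=> mN N0 mg f0 g0 fg.
pose k (c : \bar R) x := if x \in N then c else g x.
have mk c : measurable_fun setT (k c).
  apply: measurable_fun_if => //; first by apply: (measurable_fun_bool true); rewrite setTI preimage_mem_true.
  exact: measurable_funTS.
have kg c : 0 <= c -> \int[mu]_x k c x = \int[mu]_x g x.
  move=> c0; apply: ge0_ae_eq_integral => //.
    by move=> x _; rewrite /k; case: ifP.
  exists N; split => // x /= h; apply: contrapT => Nx; apply: h => _.
  by rewrite /k memNset.
apply/eqP; rewrite eq_le -{1}(kg +oo)// -(kg 0)//; apply/andP; split.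
  apply: le_integral_arbitrary => // x; rewrite /k; case: ifPn => [_|/negP xN]; first exact: leey.
  by rewrite fg//; apply: contra_not xN; rewrite inE.
apply: le_integral_arbitrary => x; rewrite /k; case: ifPn => // /negP xN.
by rewrite fg//; apply: contra_not xN; rewrite inE.
Qed.

End arbitrary_integrands.

Section sigma_finite_product.
Context d1 d2 (T1 : measurableType d1) (T2 : measurableType d2) (R : realType).
Variables (m1 : {sigma_finite_measure set T1 -> \bar R})
  (m2 : {sigma_finite_measure set T2 -> \bar R}).

(** The canonical sigma-finite structure on [\x] is the one for probabilities, hence this alias for
    the general case. *)
Definition prod_measure : set (T1 * T2)%type -> \bar R := m1 \x m2.

Let prod0 : prod_measure set0 = 0. Proof. exact: (measure0 (m1 \x m2)). Qed.

Let prod_ge0 A : 0 <= prod_measure A. Proof. exact: (measure_ge0 (m1 \x m2)). Qed.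

Let prod_sigma_additive : semi_sigma_additive prod_measure.
Proof. exact: (@measure_semi_sigma_additive _ _ _ (m1 \x m2)). Qed.

HB.instance Definition _ := isMeasure.Build _ _ _ prod_measure
  prod0 prod_ge0 prod_sigma_additive.

Let prod_sigma_finite : sigma_finite setT prod_measure.
Proof.
have /sigma_finiteP[F [TF ndF Foo]] := sigma_finiteT m1.
have /sigma_finiteP[G [TG ndG Goo]] := sigma_finiteT m2.
exists (fun n => F n `*` G n).
  apply/esym; rewrite -subTset => -[x y] _.
  have [k _ Fk] : (\bigcup_k F k) x by rewrite -TF.
  have [l _ Gl] : (\bigcup_k G k) y by rewrite -TG.
  exists (maxn k l) => //; split.
    by move: Fk; exact/subsetPset/ndF/leq_maxl.
  by move: Gl; exact/subsetPset/ndG/leq_maxr.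
move=> k; have [mF Fk] := Foo k; have [mG Gk] := Goo k; split.
  exact: measurableX.
by rewrite /prod_measure product_measure1E// lte_mul_pinfty// ge0_fin_numE.
Qed.

HB.instance Definition _ := Measure_isSigmaFinite.Build _ _ _ prod_measure prod_sigma_finite.

Definition sfprod : {sigma_finite_measure set (T1 * T2)%type -> \bar R} :=
  [the {sigma_finite_measure set (T1 * T2)%type -> \bar R} of prod_measure].

Lemma sfprodE A B : measurable A -> measurable B -> sfprod (A `*` B) = m1 A * m2 B.
Proof. exact: product_measure1E. Qed.

End sigma_finite_product.

Section limit_law.
Variables (R : realType) (alpha beta : R).
Hypotheses (a0 : (0 < alpha)%R) (b0 : (0 < beta)%R).
Variables j k : nat.

Local Notation H := ('I_j + 'I_k)%type.
Local Notation T2 := (j.-tuple R * k.-tuple R)%type.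
Local Notation T := (T2 * T2)%type.

Definition times_law := sfprod (sfpower (@uniform01 R) j) (sfpower (@uniform01 R) k).

Definition sizes_law := sfprod (sfpower (nu_measure a0) j) (sfpower (nu_measure b0) k).

(** The limiting jumps before they are put in order. The mass is infinite as soon as there is a
    jump, because of the small sizes. *)
Definition jump_law := sfprod times_law sizes_law.

Definition pair_coord (h : H) (p : T2) : R := split_fun p.1 p.2 h.

Definition jump_coord (i : H + H) (z : T) : R :=
  match i with inl h => pair_coord h z.1 | inr h => pair_coord h z.2 end.

Lemma measurable_pair_coord h : measurable_fun setT (pair_coord h).
Proof.
case: h => i.
- by apply: (measurableT_comp (measurable_tnth i)); exact: measurable_fst.
- by apply: (measurableT_comp (measurable_tnth i)); exact: measurable_snd.
Qed.

Lemma measurable_jump_coord i : measurable_fun setT (jump_coord i).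
Proof.
case: i => h.
- by apply: (measurableT_comp (measurable_pair_coord h)); exact: measurable_fst.
- by apply: (measurableT_comp (measurable_pair_coord h)); exact: measurable_snd.
Qed.

Lemma pair_box (m1 m2 : {sigma_finite_measure set R -> \bar R}) (B : H -> set R) (r : H -> R) :
  (forall h, measurable (B h)) ->
  (forall i, m1 (B (inl i)) = (r (inl i))%:E) ->
  (forall i, m2 (B (inr i)) = (r (inr i))%:E) ->
  sfprod (sfpower m1 j) (sfpower m2 k) [set p | forall h, B h (pair_coord h p)] =
  (\prod_h r h)%:E.
Proof.
move=> mB B1 B2; rewrite big_sumType/= EFinM.
rewrite -(sfpower_boxr (fun i => mB (inl i)) B1) -(sfpower_boxr (fun i => mB (inr i)) B2).
have mbox n (C : 'I_n -> set R) : (forall i, measurable (C i)) ->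
    measurable [set t : n.-tuple R | forall i, C i (tnth t i)].
  move=> mC; rewrite (_ : [set t | _] = \bigcap_(i in [set: 'I_n])
      ((@tnth _ R)^~ i @^-1` C i)); last first.
    by apply/seteqP; split => [t tB i _|t tB i]; [exact: tB|exact: (tB i Logic.I)].
  apply: fin_bigcap_measurable => // i _.
  by rewrite -[X in measurable X]setTI; exact: measurable_tnth.
rewrite -sfprodE; [|exact: (mbox _ (fun i => B (inl i)))|exact: (mbox _ (fun i => B (inr i)))].
congr (_ _); apply/seteqP; split=> [p pB|p [p1 p2] [i|i]].
- by split => i; [exact: (pB (inl i))|exact: (pB (inr i))].
- exact: p1.
- exact: p2.
Qed.

Lemma jump_law_box (B C : H -> set R) (r s : H -> R) :
  (forall h, measurable (B h)) -> (forall h, measurable (C h)) ->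
  (forall h, @uniform01 R (B h) = (r h)%:E) ->
  (forall i, nu_measure a0 (C (inl i)) = (s (inl i))%:E) ->
  (forall i, nu_measure b0 (C (inr i)) = (s (inr i))%:E) ->
  jump_law [set z | (forall h, B h (pair_coord h z.1)) /\
     (forall h, C h (pair_coord h z.2))] = ((\prod_h r h) * (\prod_h s h))%:E.
Proof.
move=> mB mC Br C1 C2; rewrite EFinM -(pair_box mB (fun i => Br _) (fun i => Br _)).
rewrite -(pair_box mC C1 C2).
have mbox (D : H -> set R) : (forall h, measurable (D h)) ->
    measurable [set p : T2 | forall h, D h (pair_coord h p)].
  move=> mD; rewrite (_ : [set t | _] = \bigcap_(h in [set: H])
      (pair_coord h @^-1` D h)); last first.
    by apply/seteqP; split => [t tB i _|t tB i]; [exact: tB|exact: (tB i Logic.I)].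
  apply: fin_bigcap_measurable => // h _.
  by rewrite -[X in measurable X]setTI; exact: measurable_pair_coord.
by rewrite -(product_measure1E times_law (sizes_law) (mbox _ mB) (mbox _ mC)).
Qed.

End limit_law.
Local Close Scope ereal_scope.

(** * The limit measure as a law of jumps *)

Local Open Scope ereal_scope.

Lemma measurable_le_set d (T : measurableType d) (R : realType) (f g : T -> R) :
  measurable_fun setT f -> measurable_fun setT g -> measurable [set x | (f x <= g x)%R].
Proof.
have m1 : measurable [set true] by [].
by move=> mf mg; have := measurable_fun_ler mf mg measurableT m1; rewrite setTI.
Qed.

Section sorted_tuples.
Variable R : realType.

Lemma measurable_sorted n :
  measurable [set x : n.-tuple R | sorted >=%R x /\ forall i, (0 <= tnth x i)%R].
Proof.
apply: measurableI; last first.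
  apply: (@measurable_set_forall _ _ _ (fun i => [set x : n.-tuple R | (0 <= tnth x i)%R])) => i.
  rewrite [X in measurable X](_ : _ = (@tnth _ R)^~ i @^-1` `[0%R, +oo[).
    by rewrite -[X in measurable X]setTI; exact: measurable_tnth.
  by apply/seteqP; split=> x /=; rewrite in_itv/= andbT.
have tr : transitive (>=%R : rel R) by move=> x y z h1 h2; exact: le_trans h2 h1.
rewrite [X in measurable X](_ : _ = [set x | forall p : 'I_n * 'I_n,
    (p.1 < p.2)%N -> (tnth x p.2 <= tnth x p.1)%R]); last first.
  apply/seteqP; split=> x /=.
    by move=> /(sorted_tnthP x tr) h [i i'] /h.
  by move=> h; apply/(sorted_tnthP x tr) => i i' ii'; exact: (h (i, i')).
apply: (@measurable_set_forall _ _ ('I_n * 'I_n)%type (fun p : 'I_n * 'I_n => [set x : n.-tuple R | (p.1 < p.2)%N -> (tnth x p.2 <= tnth x p.1)%R])) => -[i i'] /=.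
have [ii'|ii'] := boolP (i < i')%N; last first.
  by rewrite [X in measurable X](_ : _ = setT)//; apply/seteqP; split.
rewrite [X in measurable X](_ : _ = [set x | (tnth x i' <= tnth x i)%R]); last first.
  by apply/seteqP; split=> x /=; [exact|].
by apply: measurable_le_set; exact: measurable_tnth.
Qed.

Variables (gamma : R) (g0 : (0 < gamma)%R) (n : nat).

(** The measure behind [nu_power] ([nu_powerE]). *)
Definition ordered_law : set (n.-tuple R) -> \bar R :=
  mrestr (sfpower (nu_measure g0) n) (@measurable_sorted n).

Local Notation ol := ordered_law.

Let ol0 : ol set0 = 0.
Proof. exact: (measure0 (mrestr (sfpower (nu_measure g0) n) (@measurable_sorted n))). Qed.

Let ol_ge0 A : 0 <= ol A. Proof. exact: (measure_ge0 (sfpower (nu_measure g0) n)). Qed.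

Let ol_sigma_additive : semi_sigma_additive ol.
Proof.
exact: (@measure_semi_sigma_additive _ _ _
  (mrestr (sfpower (nu_measure g0) n) (@measurable_sorted n))).
Qed.

HB.instance Definition _ := isMeasure.Build _ _ _ ol ol0 ol_ge0 ol_sigma_additive.

Let ol_sigma_finite : sigma_finite setT ol.
Proof.
have /sigma_finiteP[F [TF ndF Foo]] := sigma_finiteT (sfpower (nu_measure g0) n).
exists F => // k; have [mF Fk] := Foo k; split => //.
rewrite (le_lt_trans _ Fk)//; apply: le_measure; rewrite ?inE//.
by apply: measurableI => //; exact: measurable_sorted.
Qed.

HB.instance Definition _ := Measure_isSigmaFinite.Build _ _ _ ol ol_sigma_finite.

Lemma nu_powerE : @nu_power R gamma n = ol.
Proof.
by apply/funext => B; rewrite /nu_power -[nu gamma]/(nu_measure g0 : set R -> \bar R) sfpowerE.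
Qed.

End sorted_tuples.

Section limit_measure_law.
Variables (R : realType) (alpha beta : R).
Hypotheses (a0 : (0 < alpha)%R) (b0 : (0 < beta)%R).
Variables j k : nat.

Local Notation H := ('I_j + 'I_k)%type.
Local Notation T2 := (j.-tuple R * k.-tuple R)%type.
Local Notation T := (T2 * T2)%type.
Local Notation times_law := (@times_law R j k).
Local Notation sizes_law := (@sizes_law R alpha beta a0 b0 j k).
Local Notation jump_law := (@jump_law R alpha beta a0 b0 j k).
Local Notation pair_coord := (@pair_coord R j k).
Local Notation jump_coord := (@jump_coord R j k).

(** The times at which the path depends continuously on its jumps. *)
Definition good_times (p : T2) : Prop := (forall h, 0 < pair_coord h p < 1)%R /\
  (forall g h, g != h -> pair_coord g p <> pair_coord h p).

Definition pos_sizes (p : T2) : Prop := forall h, (0 < pair_coord h p)%R.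

Definition sorted_sizes (p : T2) : Prop := sorted >=%R p.1 /\ sorted >=%R p.2.

Definition ssorted_sizes (p : T2) : Prop := sorted >%R p.1 /\ sorted >%R p.2.

Definition path_of (z : T) : skorokhod R := jump_path z.1.1 z.1.2 z.2.1 z.2.2.

Definition path_set (B : set (skorokhod R)) : set T :=
  [set z | [/\ good_times z.1, pos_sizes z.2 & B (path_of z)]].

Lemma nu_power_prod (C : set T2) : measurable C ->
  (@nu_power R alpha j \x @nu_power R beta k) C =
  sizes_law (C `&` [set p | sorted_sizes p /\ forall h, (0 <= pair_coord h p)%R]).
Proof.
move=> mC; rewrite (nu_powerE a0) (nu_powerE b0).
pose SJ := [set x : j.-tuple R | sorted >=%R x /\ forall i, (0 <= tnth x i)%R].
pose SK := [set x : k.-tuple R | sorted >=%R x /\ forall i, (0 <= tnth x i)%R].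
have mJ : measurable SJ by exact: measurable_sorted.
have mK : measurable SK by exact: measurable_sorted.
have mS : measurable (SJ `*` SK) by exact: measurableX.
rewrite (@product_measure_unique _ _ _ _ _ _ _ (mrestr sizes_law mS))//; last first.
  move=> A B mA mB; transitivity (sizes_law ((A `*` B) `&` (SJ `*` SK))); first by [].
  by rewrite -setXI; apply: sfprodE; exact: measurableI.
rewrite /= /mrestr; congr (_ (_ `&` _)); apply/seteqP; split=> -[x y] /=.
  by move=> [[? px] [? py]]; split => // -[i|i]; [exact: px|exact: py].
by move=> [[? ?] pz]; split; split => // i; [exact: (pz (inl i))|exact: (pz (inr i))].
Qed.

Lemma measurable_good_times : measurable good_times.
Proof.
have -> : good_times = [set p | forall h, (0 < pair_coord h p)%R /\ (pair_coord h p < 1)%R] `&`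
   [set p | forall gh : H * H, gh.1 != gh.2 -> pair_coord gh.1 p <> pair_coord gh.2 p].
  apply/seteqP; split=> p /=.
    move=> [p1 p2]; split=> [h|[g h]/= /p2//]; by have /andP[] := p1 h.
  move=> [p1 p2]; split=> [h|g h gh]; first by have [-> ->] := p1 h.
  exact: (p2 (g, h)).
apply: (@coord_open_measurable _ _ _ _ pair_coord); first exact: measurable_pair_coord.
apply: coord_openI.
  apply: coord_open_forall => h.
  by apply: coord_openI; [exact: coord_open_gt|exact: coord_open_lt].
by apply: coord_open_forall => -[g h]; apply: coord_open_imply; exact: coord_open_neq.
Qed.

Lemma null_setU d' (T' : measurableType d') (mu : {measure set T' -> \bar R}) (A B : set T') :
  measurable A -> measurable B -> mu A = 0 -> mu B = 0 -> mu (A `|` B) = 0.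
Proof.
move=> mA mB A0 B0; have h : mu (A `|` B) <= mu A + mu B by exact: measureU2.
by rewrite A0 B0 adde0 in h; apply/eqP; rewrite -measure_le0.
Qed.

Lemma null_set_exists d' (T' : measurableType d') (mu : {measure set T' -> \bar R})
    (F : finType) (A : F -> set T') :
  (forall i, measurable (A i)) -> (forall i, mu (A i) = 0) ->
  mu [set z | exists i, A i z] = 0.
Proof.
move=> mA A0; pose U (s : seq F) := [set z | exists2 i : F, i \in s & A i z].
have US i s : U (i :: s) = A i `|` U s.
  apply/seteqP; split=> z /=; last first.
    by move=> [Az|[g gs Az]]; [exists i => //; exact: mem_head|exists g => //; rewrite inE gs orbT].
  by move=> [g]; rewrite inE => /predU1P[->|gs]; [left|right; exists g].
have [mU U0] : measurable (U (enum F)) /\ mu (U (enum F)) = 0.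
  elim: (enum F) => [|i s [mU U0]].
    by rewrite (_ : U [::] = set0)// -subset0 => z [].
  by rewrite US; split; [exact: measurableU|exact: null_setU].
rewrite -U0; congr (_ _); apply/seteqP; split => z /= [i]; last by exists i.
by exists i => //; rewrite mem_enum.
Qed.

Section pair_null.
Variables m1 m2 : {sigma_finite_measure set R -> \bar R}.
Local Notation pm := (sfprod (sfpower m1 j) (sfpower m2 k)).

Lemma pair_coord_null h (A : set R) : measurable A -> m1 A = 0 -> m2 A = 0 ->
  pm [set p | A (pair_coord h p)] = 0.
Proof.
move=> mA A1 A2; case: h => i.
- have -> : [set p : T2 | A (pair_coord (inl i) p)] = [set t | A (tnth t i)] `*` setT.
    by apply/seteqP; split=> [p|p []].
  rewrite sfprodE//; last by rewrite -[X in measurable X]setTI; exact: measurable_tnth.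
  by rewrite sfpower_tnth_null// mul0e.
- have -> : [set p : T2 | A (pair_coord (inr i) p)] = setT `*` [set t | A (tnth t i)].
    by apply/seteqP; split=> [p|p []].
  rewrite sfprodE//; last by rewrite -[X in measurable X]setTI; exact: measurable_tnth.
  by rewrite sfpower_tnth_null// mule0.
Qed.

Hypothesis atomless1 : forall x, m1 [set x] = 0.
Hypothesis atomless2 : forall x, m2 [set x] = 0.

Let measurable_tie n (i i' : 'I_n) : measurable [set t : n.-tuple R | tnth t i = tnth t i'].
Proof.
have -> : [set t : n.-tuple R | tnth t i = tnth t i'] =
    [set t | (tnth t i <= tnth t i')%R] `&` [set t | (tnth t i' <= tnth t i)%R].
  apply/seteqP; split=> t /=; first by move=> ->; rewrite lexx.
  by move=> [h1 h2]; apply/eqP; rewrite eq_le h1 h2.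
by apply: measurableI; apply: measurable_le_set; exact: measurable_tnth.
Qed.

Lemma left_tie_null (i i' : 'I_j) : i != i' ->
  pm [set p | pair_coord (inl i) p = pair_coord (inl i') p] = 0.
Proof.
move=> ii'; have -> : [set p : T2 | pair_coord (inl i) p = pair_coord (inl i') p] =
    [set t | tnth t i = tnth t i'] `*` setT.
  by apply/seteqP; split=> [p|p []].
rewrite sfprodE; [|exact: measurable_tie|exact: measurableT].
by rewrite sfpower_tie// mul0e.
Qed.

Lemma right_tie_null (i i' : 'I_k) : i != i' ->
  pm [set p | pair_coord (inr i) p = pair_coord (inr i') p] = 0.
Proof.
move=> ii'; have -> : [set p : T2 | pair_coord (inr i) p = pair_coord (inr i') p] =
    setT `*` [set t | tnth t i = tnth t i'].
  by apply/seteqP; split=> [p|p []].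
rewrite sfprodE; [|exact: measurableT|exact: measurable_tie].
by rewrite sfpower_tie// mule0.
Qed.

Lemma cross_tie_null i i' :
  pm [set p | pair_coord (inl i) p = pair_coord (inr i') p] = 0.
Proof.
rewrite /= /prod_measure /product_measure1 integral0_eq// => x _.
rewrite -[RHS](sfpower_tnth_null i' (measurable_set1 (tnth x i)) (atomless2 _)).
by rewrite /comp; congr (_ _); apply/seteqP; split => y; rewrite /xsection/= inE/= => ->.
Qed.

Lemma pair_tie_null g h : g != h -> pm [set p | pair_coord g p = pair_coord h p] = 0.
Proof.
case: g h => i [i'|i'] gh.
- by apply: left_tie_null; apply: contra gh => /eqP ->.
- exact: cross_tie_null.
- rewrite -[RHS](cross_tie_null i' i); congr (_ _).
  by apply/seteqP; split => p /= ->.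
- by apply: right_tie_null; apply: contra gh => /eqP ->.
Qed.

End pair_null.

Lemma measurable_pair_tie g h : measurable [set p : T2 | pair_coord g p = pair_coord h p].
Proof.
have -> : [set p : T2 | pair_coord g p = pair_coord h p] =
    [set p | (pair_coord g p <= pair_coord h p)%R] `&` [set p | (pair_coord h p <= pair_coord g p)%R].
  apply/seteqP; split=> t /=; first by move=> ->; rewrite lexx.
  by move=> [h1 h2]; apply/eqP; rewrite eq_le h1 h2.
by apply: measurableI; apply: measurable_le_set; exact: measurable_pair_coord.
Qed.

Lemma times_law_bad : times_law (~` good_times) = 0.
Proof.
have -> : ~` good_times =
    [set p | exists h, (~` `]0%R, 1%R[) (pair_coord h p)] `|`
    [set p | exists gh : {gh : H * H | gh.1 != gh.2},
        pair_coord (sval gh).1 p = pair_coord (sval gh).2 p].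
  apply/seteqP; split=> p /=.
    move=> ng; apply: contrapT => /not_orP[n1 n2]; apply: ng; split=> [h|g h gh e].
      apply: contrapT => nh; apply: n1; exists h => /=.
      by rewrite in_itv/=.
    by apply: n2; exists (exist _ (g, h) gh).
  move=> [[h /=]|[[[g h] /= gh] e] [_ /(_ g h gh)]//].
  by rewrite in_itv/= => nh [/(_ h)].
have mO : measurable (~` `]0%R, 1%R[ : set R) by apply: measurableC.
apply: null_setU.
- apply: measurable_set_exists => h.
  by rewrite -[X in measurable X]setTI; exact: measurable_pair_coord.
- by apply: measurable_set_exists => gh; exact: measurable_pair_tie.
- apply: null_set_exists => h.
    by rewrite -[X in measurable X]setTI; exact: measurable_pair_coord.
  by apply: pair_coord_null => //; exact: uniform01_out.
- apply: null_set_exists => -[[g h] /= gh]; first exact: measurable_pair_tie.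
  by apply: pair_tie_null => // x; exact: uniform01_set1.
Qed.

Lemma mdist_path_of (z z' : T) (rho : R) : (0 < rho)%R ->
  (forall h, rho <= pair_coord h z.1 <= 1 - rho)%R ->
  (forall g h, g != h -> rho <= `|pair_coord g z.1 - pair_coord h z.1|)%R ->
  (\sum_h `|pair_coord h z'.1 - pair_coord h z.1| < rho)%R ->
  (mdist (path_of z') (path_of z) <=
    Num.max (\sum_h `|pair_coord h z'.1 - pair_coord h z.1|)
            (\sum_h `|pair_coord h z'.2 - pair_coord h z.2|))%R.
Proof.
move=> rho0 h1 h2 h3; rewrite /path_of !jump_pathE.
have -> : (\sum_h `|pair_coord h z'.2 - pair_coord h z.2| =
    \sum_h `|jump_sign R h * split_fun z'.2.1 z'.2.2 h - jump_sign R h * split_fun z.2.1 z.2.2 h|)%R.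
  apply: eq_bigr => h _; rewrite -mulrBr normrM /jump_sign.
  by case: h => i; rewrite ?normrN normr1 mul1r.
exact: (@mdist_jump_fun _ _ (split_fun z.1.1 z.1.2) (split_fun z'.1.1 z'.1.2) _ _ rho rho0 h1 h2 h3).
Qed.

(** The path depends continuously on the times and sizes of its jumps: nearby times are brought back
    by a time change, and nearby sizes give a path uniformly close. *)
Lemma coord_open_path (B : set (skorokhod R)) : open B ->
  coord_open jump_coord [set z | good_times z.1 /\ B (path_of z)].
Proof.
move=> oB z [[z01 zsep] Bz].
have /nbhs_ballP[e /= e0 eB] : nbhs (path_of z) B by exact: open_nbhs_nbhs.
have [r1 r10 r1P] := finite_pos_lb (fun h => proj1 (andP (z01 h))).
have z1' h : (0 < 1 - pair_coord h z.1)%R.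
  by rewrite subr_gt0; have /andP[] := z01 h.
have [r2 r20 r2P] := finite_pos_lb z1'.
pose f (gh : H * H) : R :=
  if gh.1 == gh.2 then 1%R else `|pair_coord gh.1 z.1 - pair_coord gh.2 z.1|%R.
have f0 gh : (0 < f gh)%R.
  rewrite /f; case: ifPn => // /zsep; rewrite normr_gt0 subr_eq0 => /eqP //.
have [r3 r30 r3P] := finite_pos_lb f0.
pose rho := Num.min r1 (Num.min r2 r3).
have rho0 : (0 < rho)%R by rewrite !lt_min r10 r20.
have rho1 h : (rho <= pair_coord h z.1 <= 1 - rho)%R.
  rewrite (le_trans _ (r1P h)) ?ge_min ?lexx//= lerBrDr addrC -lerBrDr.
  by rewrite (le_trans _ (r2P h))// !ge_min lexx orbT.
have rho2 g h : g != h -> (rho <= `|pair_coord g z.1 - pair_coord h z.1|)%R.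
  by move=> gh; have := r3P (g, h); rewrite /f/= (negbTE gh); apply: le_trans; rewrite !ge_min lexx !orbT.
pose N : R := #|{: H}|.+1%:R.
pose del := (Num.min (rho / 2) e / N)%R.
have N0 : (0 < N)%R by [].
have del0 : (0 < del)%R by rewrite divr_gt0// lt_min divr_gt0.
have sumlt (a b : H -> R) : (forall h, `|a h - b h| < del)%R ->
    (\sum_h `|a h - b h| < Num.min (rho / 2) e)%R.
  move=> ab; apply: (@le_lt_trans _ _ (\sum_(h : H) del)%R).
    by apply: ler_sum => h _; exact: ltW.
  rewrite sumr_const -[(del *+ _)%R]mulr_natr /del; set m := Num.min _ _.
  have m0 : (0 < m)%R by rewrite lt_min divr_gt0.
  rewrite mulrAC ltr_pdivrMr// ltr_pM2l// ltr_nat.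
  by rewrite ltnS; apply: subset_leq_card; apply/fintype.subsetP.
exists del => // z' zz'.
have s1 := sumlt _ _ (fun h => zz' (inl h)).
have s2 := sumlt _ _ (fun h => zz' (inr h)).
have s1r : (\sum_h `|pair_coord h z'.1 - pair_coord h z.1| < rho / 2)%R.
  by move: s1; rewrite lt_min => /andP[].
have t1 h : (`|pair_coord h z'.1 - pair_coord h z.1| < rho / 2)%R.
  by apply: le_lt_trans s1r; rewrite (bigD1 h)//= lerDl sumr_ge0.
split.
  split=> [h|g h gh e'].
    have := rho1 h; have := t1 h; rewrite ltr_norml => /andP[? ?] /andP[? ?].
    by apply/andP; split; lra.
  have := rho2 _ _ gh; have := t1 h; have := t1 g; rewrite !ltr_norml e' => /andP[? ?] /andP[? ?].
  by rewrite leNgt => /negP; apply; rewrite ltr_norml; apply/andP; split; lra.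
apply: eB; rewrite ballEmdist/= metric_sym.
apply: le_lt_trans; first apply: (mdist_path_of rho0) => //.
  by apply: lt_trans s1r _; lra.
by rewrite gt_max; move: s1 s2; rewrite !lt_min => /andP[_ ->] /andP[_ ->].
Qed.

Lemma jump_law_null1 (A : set T2) : measurable A -> times_law A = 0 ->
  jump_law [set z | A z.1] = 0.
Proof.
move=> mA A0; have -> : [set z : T | A z.1] = A `*` setT.
  by apply/seteqP; split=> [z|z []].
by rewrite sfprodE// [X in X * _]A0 mul0e.
Qed.

Lemma jump_law_null2 (A : set T2) : measurable A -> sizes_law A = 0 ->
  jump_law [set z | A z.2] = 0.
Proof.
move=> mA A0; have -> : [set z : T | A z.2] = setT `*` A.
  by apply/seteqP; split=> [z|z []].
by rewrite sfprodE// [X in _ * X]A0 mule0.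
Qed.

Definition size_ties : set T2 :=
  [set p | exists2 i : 'I_j * 'I_j, i.1 != i.2 & tnth p.1 i.1 = tnth p.1 i.2] `|`
  [set p | exists2 i : 'I_k * 'I_k, i.1 != i.2 & tnth p.2 i.1 = tnth p.2 i.2].

Lemma size_ties_null : measurable size_ties /\ sizes_law size_ties = 0.
Proof.
have -> : size_ties = [set p | exists i : {i : 'I_j * 'I_j | i.1 != i.2},
      pair_coord (inl (sval i).1) p = pair_coord (inl (sval i).2) p] `|`
    [set p | exists i : {i : 'I_k * 'I_k | i.1 != i.2},
      pair_coord (inr (sval i).1) p = pair_coord (inr (sval i).2) p].
  congr (_ `|` _); apply/seteqP; split=> p /=.
  - by move=> [i h e]; exists (exist _ i h).
  - by move=> [[i h] e]; exists i.
  - by move=> [i h e]; exists (exist _ i h).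
  - by move=> [[i h] e]; exists i.
have m1 : measurable [set p : T2 | exists i : {i : 'I_j * 'I_j | i.1 != i.2},
      pair_coord (inl (sval i).1) p = pair_coord (inl (sval i).2) p].
  by apply: measurable_set_exists => i; exact: measurable_pair_tie.
have m2 : measurable [set p : T2 | exists i : {i : 'I_k * 'I_k | i.1 != i.2},
      pair_coord (inr (sval i).1) p = pair_coord (inr (sval i).2) p].
  by apply: measurable_set_exists => i; exact: measurable_pair_tie.
split; first exact: measurableU.
apply: null_setU => //; apply: null_set_exists => -[i ii].
- exact: measurable_pair_tie.
- by apply: (@left_tie_null (nu_measure a0) (nu_measure b0)) => // x; exact: nu_set1.
- exact: measurable_pair_tie.
- by apply: (@right_tie_null (nu_measure a0) (nu_measure b0)) => // x; exact: nu_set1.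
Qed.

Lemma sorted_no_ties n (x : n.-tuple R) : sorted >=%R x ->
  (forall i : 'I_n * 'I_n, i.1 != i.2 -> tnth x i.1 <> tnth x i.2) -> sorted >%R x.
Proof.
have tr : transitive (>=%R : rel R) by move=> a b c h1 h2; exact: le_trans h2 h1.
have tr' : transitive (>%R : rel R) by move=> a b c h1 h2; exact: lt_trans h2 h1.
move=> /(sorted_tnthP x tr) h nt; apply/(sorted_tnthP x tr') => i i' ii'.
have := h _ _ ii'; rewrite /= le_eqVlt => /predU1P[e|//].
exfalso; apply: (nt (i, i')) => //=.
by apply: contraTneq ii' => ->; rewrite ltnn.
Qed.

(** The limit measure is carried by weakly ordered sizes, a closed condition, but the lower bound
    needs an open one; the difference is in the null set of ties. *)
Lemma sorted_sizes_ties p : sorted_sizes p -> ~ size_ties p -> ssorted_sizes p.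
Proof.
move=> [s1 s2] nt; split; apply: sorted_no_ties => // i ii e; apply: nt.
- by left; exists i.
- by right; exists i.
Qed.

Lemma measurable_sorted_sizes : measurable (sorted_sizes : set T2).
Proof.
have tr : transitive (>=%R : rel R) by move=> a b c h1 h2; exact: le_trans h2 h1.
have -> : sorted_sizes = [set p | forall i : 'I_j * 'I_j, (i.1 < i.2)%N ->
      (pair_coord (inl i.2) p <= pair_coord (inl i.1) p)%R] `&`
    [set p | forall i : 'I_k * 'I_k, (i.1 < i.2)%N ->
      (pair_coord (inr i.2) p <= pair_coord (inr i.1) p)%R].
  apply/seteqP; split=> p /=.
    move=> [/(sorted_tnthP _ tr) s1 /(sorted_tnthP _ tr) s2].
    by split=> i; [exact: s1|exact: s2].
  move=> [s1 s2]; split; apply/(sorted_tnthP _ tr) => i i' ii'.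
    exact: (s1 (i, i')).
  exact: (s2 (i, i')).
have mimp (P : bool) (A : set T2) : measurable A -> measurable [set x | P -> A x].
  move=> mA; case: P.
    by rewrite [X in measurable X](_ : _ = A)//; apply/seteqP; split=> x /= h; [exact: h|move=> _].
  by rewrite [X in measurable X](_ : _ = setT)//; apply/seteqP; split=> x //= _ /negP.
apply: measurableI; apply: measurable_set_forall => i; apply: mimp.
- by apply: measurable_le_set; exact: measurable_pair_coord.
- by apply: measurable_le_set; exact: measurable_pair_coord.
Qed.

Lemma measurable_section_jump (C : set T) p : measurable C -> measurable [set q : T2 | C (p, q)].
Proof.
move=> mC; have := measurable_xsection p mC.
by congr measurable; apply/seteqP; split=> q; rewrite /xsection/= inE.
Qed.

(** The inner measure of sorted sizes is a restriction of the unordered product, and the integral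
    over the times is the product measure by definition. The set [path_set] discards the null set of
    degenerate times, where the integrand defining [limit_measure] may fail to be measurable. *)
Lemma limit_measureE (B : set (skorokhod R)) : measurable (path_set B) ->
  limit_measure alpha beta j k B = jump_law (path_set B `&` [set z | sorted_sizes z.2]).
Proof.
move=> mB; set W := _ `&` _.
have mW : measurable W.
  apply: measurableI => //; have -> : [set z : T | sorted_sizes z.2] = setT `*` sorted_sizes.
    by apply/seteqP; split=> [z|z []].
  by apply: measurableX => //; exact: measurable_sorted_sizes.
have mN : measurable (~` good_times) by apply: measurableC; exact: measurable_good_times.
rewrite /limit_measure; case: ifPn => [/andP[/eqP j0 /eqP k0]|_]; last first.
  rewrite !sfpowerE.
  apply: (@integral_eq_off_null _ _ _ times_law _ (sizes_law \o xsection W) (~` good_times)) => //.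
  - exact: times_law_bad.
  - exact: measurable_fun_xsection.
  - move=> x; rewrite (nu_powerE a0) (nu_powerE b0).
    by apply: integral_ge0 => y _; exact: measure_ge0.
  - move=> uv /contrapT guv.
    rewrite (_ : [set xy | _] = [set xy | path_set B (uv, xy)]); last first.
      apply/seteqP; split=> xy /=.
        by move=> [px py Bp]; split => // -[i|i]; [exact: px|exact: py].
      by move=> [_ p Bp]; split => // i; [exact: (p (inl i))|exact: (p (inr i))].
    rewrite nu_power_prod; last exact: measurable_section_jump.
    rewrite /comp; congr (_ _); apply/seteqP; split=> xy /=; rewrite /xsection /= inE/=.
      by move=> [p [s _]].
    by move=> [[g p Bp] s]; split => //; split => // h; exact/ltW/p.
(* Without jumps all the laws are Dirac masses on a one-point space. *)
have nj (i : 'I_j) : False by have := leq_ltn_trans (leq0n i) (ltn_ord i); rewrite j0.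
have nk (i : 'I_k) : False by have := leq_ltn_trans (leq0n i) (ltn_ord i); rewrite k0.
have nh (h : H) : False by case: h => [/nj|/nk].
have path0 z : path_of z = zero_path R.
  apply: skorokhodP => t /=.
  by rewrite !big1 ?subrr.
have nil n (t : n.-tuple R) : n = 0%N -> tval t = [::].
  by move=> n0; apply: size0nil; rewrite size_tuple.
have WB z : W z <-> B (zero_path R).
  split=> [[[_ _ Bz] _]|Bz]; first by rewrite -(path0 z).
  split; last by split; rewrite nil.
  split; last by rewrite path0.
    by split=> h; exfalso; exact: (nh h).
  by move=> h; exfalso; exact: (nh h).
have [BT|nB] := pselect (B (zero_path R)).
  rewrite (_ : W = [set z | (forall h, [set: R] (pair_coord h z.1)) /\
      (forall h, [set: R] (pair_coord h z.2))]); last first.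
    by apply/seteqP; split=> z // _; exact/WB.
  rewrite (@jump_law_box _ _ _ _ _ _ _ (fun=> setT) (fun=> setT) (fun=> 1%R) (fun=> 1%R))//.
  by rewrite diracE mem_set// !big1// mulr1.
rewrite diracE memNset// (_ : W = set0) ?measure0//.
by rewrite -subset0 => z /WB.
Qed.

End limit_measure_law.
Local Close Scope ereal_scope.

(** * The path of the large increments *)

Section increments.
Variables (R : realType) (n : nat) (c : R) (x : nat -> R).

Definition big_part (y : R) : R := if `|y| <= c then 0 else y.

Lemma trunc_big_part y : trunc c y + big_part y = y.
Proof. by rewrite /trunc /big_part; case: ifP; rewrite ?addr0 ?add0r. Qed.

Definition step_time (i : 'I_n) : R := i.+1%:R / n%:R.

Definition big_path : skorokhod R :=
  jump_fun step_time (fun i : 'I_n => big_part (x i) / n%:R).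

Lemma step_time_inj : (0 < n)%N -> injective step_time.
Proof.
move=> n0 i i' /(congr1 ( *%R^~ n%:R)); rewrite /step_time !divfK ?pnatr_eq0 -?lt0n//.
by move=> /eqP; rewrite eqr_nat eqSS => /eqP /val_inj.
Qed.

Lemma step_time_itv (i : 'I_n) : 0 < step_time i <= 1.
Proof.
have n0 : (0 < n)%N by apply: leq_ltn_trans (ltn_ord i).
by rewrite divr_gt0 ?ltr0n//= ler_pdivrMr ?ltr0n// mul1r ler_nat ltn_ord.
Qed.

(** The difference of the two paths is a partial sum of truncated increments, and the uniform
    distance bounds the Skorokhod distance. *)
Lemma mdist_big_path (y : skorokhod R) (delta : R) : (0 < n)%N ->
  (forall t, y t = (\sum_(i < Num.truncn (n%:R * \val t)) x i) / n%:R) ->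
  (forall k : 'I_n.+1, `|\sum_(i < k) trunc c (x i)| < delta * n%:R) ->
  mdist y big_path <= delta.
Proof.
move=> n0 yE small; apply: mdist_le_sup => t.
have nR : 0 < n%:R :> R by rewrite ltr0n.
have /andP[t0 t1] := unit_interval_itv t.
have nt0 : 0 <= n%:R * \val t by rewrite mulr_ge0// ltW.
pose k := Num.truncn (n%:R * \val t).
have kn : (k < n.+1)%N.
  rewrite ltnS -(ler_nat R); have /andP[h _] := truncn_itv nt0; rewrite (le_trans h)//.
  by rewrite ler_piMr// ltW.
have step (i : 'I_n) : (step_time i <= \val t) = (i < k)%N.
  rewrite /step_time ler_pdivrMr// mulrC /k.
  by rewrite -truncn_ge_nat// ?ltnS.
have -> : big_path t = (\sum_(i < k) big_part (x i)) / n%:R.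
  rewrite jump_funE mulr_suml.
  rewrite (big_ord_widen_cond n xpredT (fun i => big_part (x i) / n%:R))// [RHS]big_mkcond/=.
  by apply: eq_bigr => i _; rewrite step; case: ifP; rewrite ?mulr1 ?mulr0.
rewrite yE -/k -mulrBl -sumrB normrM [X in _ * X]gtr0_norm ?invr_gt0//.
rewrite ler_pdivrMr// (eq_bigr (fun i : 'I_k => trunc c (x i))).
  exact/ltW/(small (Ordinal kn)).
by move=> i _; rewrite -{1}(trunc_big_part (x i)) addrK.
Qed.

Hypothesis c0 : 0 <= c.

Lemma big_part_gt0 y : (0 < big_part y) = (c < y).
Proof.
rewrite /big_part ler_norml; case: ifPn => [/andP[_ yc]|].
  by rewrite ltxx ltNge yc.
rewrite negb_and -!ltNge => /orP[yc|yc].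
  have y0 : y < 0 by rewrite (lt_le_trans yc)// oppr_le0.
  by rewrite !ltNge (ltW y0) (le_trans (ltW y0)).
by rewrite yc (le_lt_trans c0 yc).
Qed.

Lemma big_part_lt0 y : (big_part y < 0) = (c < - y).
Proof.
rewrite /big_part ler_norml; case: ifPn => [/andP[yc _]|].
  by rewrite ltxx ltNge lerNl yc.
rewrite negb_and -!ltNge => /orP[yc|yc].
  by rewrite ltrNr yc (lt_le_trans yc)// oppr_le0.
have y0 : 0 < y by rewrite (le_lt_trans c0).
rewrite !ltNge (ltW y0) /=; apply/esym/negbTE; rewrite negbK.
by rewrite (le_trans _ c0)// oppr_le0 ltW.
Qed.

Lemma big_path_step_paths l m : (0 < n)%N ->
  #|[pred i : 'I_n | c < x i]| = l -> #|[pred i : 'I_n | c < - x i]| = m ->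
  step_paths l m big_path.
Proof.
move=> n0 nl nm; have nR : 0 < n%:R^-1 :> R by rewrite invr_gt0 ltr0n.
apply: jump_fun_step_paths.
- exact: step_time_itv.
- exact: step_time_inj.
- by rewrite -nl; apply: eq_card => i; rewrite !inE pmulr_lgt0// big_part_gt0.
- by rewrite -nm; apply: eq_card => i; rewrite !inE pmulr_llt0// big_part_lt0.
Qed.

Variables j k : nat.
Local Notation H := ('I_j + 'I_k)%type.
Implicit Type tau : {ffun H -> 'I_n}.

Definition signed_inc (h : H) (i : nat) : R := jump_sign R h * x i.

(** A selection [tau] gives the indices of [j] upward and [k] downward increments; the coordinates
    are the corresponding jump times and, made positive by [signed_inc], jump sizes. *)
Definition tau_point tau : (j.-tuple R * k.-tuple R) * (j.-tuple R * k.-tuple R) :=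
  (([tuple step_time (tau (inl i)) | i < j], [tuple step_time (tau (inr i)) | i < k]),
   ([tuple signed_inc (inl i) (tau (inl i)) / n%:R | i < j],
    [tuple signed_inc (inr i) (tau (inr i)) / n%:R | i < k])).

Lemma tau_point_time tau h : pair_coord h (tau_point tau).1 = step_time (tau h).
Proof. by case: h => i; rewrite /pair_coord /= tnth_mktuple. Qed.

Lemma tau_point_size tau h : pair_coord h (tau_point tau).2 = signed_inc h (tau h) / n%:R.
Proof. by case: h => i; rewrite /pair_coord /= tnth_mktuple. Qed.

Lemma jump_sign_sqr (h : H) : jump_sign R h * jump_sign R h = 1.
Proof. by case: h => i; rewrite /jump_sign ?mulr1// mulN1r opprK. Qed.

Lemma path_of_tau tau : injective tau -> (forall h, c < signed_inc h (tau h)) ->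
  (forall i, i \notin codom tau -> `|x i| <= c) ->
  path_of (tau_point tau) = big_path.
Proof.
move=> tinj tbig tsmall; rewrite /path_of jump_pathE.
apply: skorokhodP => t; rewrite !jump_funE.
have big_tau h : big_part (x (tau h)) = x (tau h).
  rewrite /big_part ifN// -ltNge (lt_le_trans (tbig h))//.
  rewrite (le_trans (ler_norm _))// normrM; case: (h) => i; rewrite /jump_sign.
    by rewrite normr1 mul1r.
  by rewrite normrN normr1 mul1r.
rewrite [RHS](bigID (fun i => i \in codom tau))/= [X in _ + X]big1 ?addr0; last first.
  by move=> i /tsmall xi; rewrite /big_part xi !mul0r.
rewrite (reindex_omap tau (fun i => [pick h | tau h == i])); last first.
  move=> i /codomP[h ->]; case: pickP => [g /eqP/= ->//|/(_ h)].
  by rewrite eqxx.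
apply: eq_big => [h|h _].
  rewrite codom_f /=; case: pickP => [g /eqP /tinj -> |/(_ h)]; last by rewrite eqxx.
  by rewrite eqxx.
have := tau_point_size tau h; have := tau_point_time tau h; rewrite /pair_coord => -> ->.
by rewrite /signed_inc !mulrA jump_sign_sqr mul1r big_tau.
Qed.

End increments.

(** * Selecting the large increments *)

Section jump_selections.
Variables (R : realType) (n : nat) (c : R) (x : nat -> R) (j k : nat).
Hypothesis c0 : 0 <= c.
Local Notation H := ('I_j + 'I_k)%type.
Implicit Type tau : {ffun H -> 'I_n}.

Definition selects_big tau : Prop := forall h, c < signed_inc x h (tau h).

Definition selects_all tau : Prop :=
  selects_big tau /\ forall i, i \notin codom tau -> `|x i| <= c.

Lemma selects_codom tau (i : 'I_n) : selects_all tau -> c < `|x i| -> (i : 'I_n) \in codom tau.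
Proof. by move=> [_ small] xi; apply: contraTT xi => /small; rewrite -leNgt. Qed.

Lemma selects_inl tau (i : 'I_n) : selects_all tau -> (c < x i) = (i \in [seq tau (inl h) | h : 'I_j]).
Proof.
move=> sel; apply/idP/mapP => [xi|[h _ ->]]; last first.
  by have := sel.1 (inl h); rewrite /signed_inc mul1r.
have /codomP[[h|h] ih] := selects_codom sel (lt_le_trans xi (ler_norm _)).
  by exists h; rewrite ?mem_enum.
have := sel.1 (inr h); rewrite -ih /signed_inc mulN1r => xi'.
have := lt_trans xi' (lt_trans _ xi); move: xi xi' c0; lra.
Qed.

Lemma selects_inr tau (i : 'I_n) : selects_all tau -> (c < - x i) = (i \in [seq tau (inr h) | h : 'I_k]).
Proof.
move=> sel; apply/idP/mapP => [xi|[h _ ->]]; last first.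
  by have := sel.1 (inr h); rewrite /signed_inc mulN1r.
have xi1 : c < `|x i| by rewrite -normrN (lt_le_trans xi)// ler_norm.
have /codomP[[h|h] ih] := selects_codom sel xi1; last first.
  by exists h; rewrite ?mem_enum.
have := sel.1 (inl h); rewrite -ih /signed_inc mul1r => xi'.
by move: xi xi' c0; lra.
Qed.

Let desc : rel 'I_n := fun a b => x b < x a.
Let asc : rel 'I_n := fun a b => x a < x b.

Lemma ssorted_tau tau : ssorted_sizes (tau_point x tau).2 -> (0 < n)%N ->
  sorted desc [seq tau (inl h) | h : 'I_j] /\ sorted asc [seq tau (inr h) | h : 'I_k].
Proof.
move=> [s1 s2] n0; have nR : 0 < n%:R^-1 :> R by rewrite invr_gt0 ltr0n.
have tr : transitive (>%R : rel R) by move=> a b d h1 h2; exact: lt_trans h2 h1.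
have dtr : transitive desc by move=> a b d h1 h2; exact: lt_trans h2 h1.
have atr : transitive asc by move=> a b d h1 h2; exact: lt_trans h1 h2.
split.
  apply/(sorted_tnthP [tuple tau (inl h) | h < j] dtr) => i i' ii'; rewrite !tnth_mktuple.
  have := (sorted_tnthP _ tr).1 s1 i i' ii'.
  by rewrite !tnth_mktuple /signed_inc /= !mul1r ltr_pM2r.
apply/(sorted_tnthP [tuple tau (inr h) | h < k] atr) => i i' ii'; rewrite !tnth_mktuple.
have := (sorted_tnthP _ tr).1 s2 i i' ii'.
by rewrite !tnth_mktuple /signed_inc /= !mulN1r ltr_pM2r// ltrN2.
Qed.

(** The indices of the large increments of each sign are determined as sets; the strict order of
    the sizes determines in which order [tau] lists them. *)
Lemma selection_unique tau tau' : selects_all tau -> selects_all tau' ->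
  ssorted_sizes (tau_point x tau).2 -> ssorted_sizes (tau_point x tau').2 -> tau = tau'.
Proof.
move=> sel sel' ss ss'.
have [n0|n0] := posnP n.
  by apply/ffunP => h; have := leq_ltn_trans (leq0n _) (ltn_ord (tau h)); rewrite {1}n0.
have [s1 s2] := ssorted_tau ss n0; have [s1' s2'] := ssorted_tau ss' n0.
have e1 : [seq tau (inl h) | h : 'I_j] = [seq tau' (inl h) | h : 'I_j].
  apply: (irr_sorted_eq _ _ s1 s1').
  - by move=> a b d h1 h2; exact: lt_trans h2 h1.
  - by move=> a; exact: ltxx.
  - by move=> i; rewrite -(selects_inl _ sel) -(selects_inl _ sel').
have e2 : [seq tau (inr h) | h : 'I_k] = [seq tau' (inr h) | h : 'I_k].
  apply: (irr_sorted_eq _ _ s2 s2').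
  - by move=> a b d h1 h2; exact: lt_trans h1 h2.
  - by move=> a; exact: ltxx.
  - by move=> i; rewrite -(selects_inr _ sel) -(selects_inr _ sel').
apply/ffunP => -[h|h].
  have /eq_in_map := e1; apply; exact: mem_enum.
have /eq_in_map := e2; apply; exact: mem_enum.
Qed.

(** An upward and a downward jump never share an index, since [c] is nonnegative. *)
Lemma tau_of_tuples (t1 : j.-tuple 'I_n) (t2 : k.-tuple 'I_n) : uniq t1 -> uniq t2 ->
  (forall i, i \in t1 -> c < x i) -> (forall i, i \in t2 -> c < - x i) ->
  injective [ffun h : H => split_fun t1 t2 h] /\
  selects_big [ffun h : H => split_fun t1 t2 h].
Proof.
move=> u1 u2 p1 p2; split.
  move=> [h|h] [g|g]; rewrite !ffunE /= => e.
  - by congr inl; exact: (tuple_uniqP _ u1).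
  - exfalso; have := p1 _ (mem_tnth h t1); have := p2 _ (mem_tnth g t2); rewrite -e.
    by move: c0; lra.
  - exfalso; have := p1 _ (mem_tnth g t1); have := p2 _ (mem_tnth h t2); rewrite e.
    by move: c0; lra.
  - by congr inr; exact: (tuple_uniqP _ u2).
move=> [h|h]; rewrite /signed_inc ffunE /=.
  by rewrite mul1r; apply: p1; exact: mem_tnth.
by rewrite mulN1r; apply: p2; exact: mem_tnth.
Qed.

Lemma exists_selection_big : (j <= #|[pred i : 'I_n | (c < x i)%R]|)%N ->
  (k <= #|[pred i : 'I_n | (c < - x i)%R]|)%N ->
  exists tau, injective tau /\ selects_big tau.
Proof.
rewrite !cardE => h1 h2.
set s1 := enum _ in h1; set s2 := enum _ in h2.
have z1 : size (take j s1) == j by rewrite size_takel.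
have z2 : size (take k s2) == k by rewrite size_takel.
have [] := @tau_of_tuples (Tuple z1) (Tuple z2).
- by rewrite /= take_uniq// enum_uniq.
- by rewrite /= take_uniq// enum_uniq.
- by move=> i /mem_take; rewrite mem_enum.
- by move=> i /mem_take; rewrite mem_enum.
by move=> inj sel; exists [ffun h : H => split_fun (Tuple z1) (Tuple z2) h].
Qed.

Lemma exists_selection_all : #|[pred i : 'I_n | c < x i]| = j ->
  #|[pred i : 'I_n | c < - x i]| = k ->
  exists tau, [/\ injective tau, selects_all tau & sorted_sizes (tau_point x tau).2].
Proof.
rewrite !cardE => h1 h2.
pose ge1 (a b : 'I_n) := x b <= x a; pose ge2 (a b : 'I_n) := x a <= x b.
have tr1 : transitive ge1 by move=> a b d e1 e2; exact: le_trans e2 e1.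
have tr2 : transitive ge2 by move=> a b d e1 e2; exact: le_trans e1 e2.
set s1 := enum _ in h1; set s2 := enum _ in h2.
have z1 : size (sort ge1 s1) == j by rewrite size_sort h1.
have z2 : size (sort ge2 s2) == k by rewrite size_sort h2.
pose t1 := Tuple z1; pose t2 := Tuple z2.
have m1 i : (i \in t1) = (c < x i) by rewrite memtE /= mem_sort mem_enum.
have m2 i : (i \in t2) = (c < - x i) by rewrite memtE /= mem_sort mem_enum.
have [] := @tau_of_tuples t1 t2.
- by rewrite /= sort_uniq enum_uniq.
- by rewrite /= sort_uniq enum_uniq.
- by move=> i; rewrite m1.
- by move=> i; rewrite m2.
move=> inj sel; exists [ffun h : H => split_fun t1 t2 h]; split => //.
  split => // i; apply: contraR; rewrite -ltNge lter_normr => /orP[] xi.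
    have /tnthP[h ->] : i \in t1 by rewrite m1.
    by apply/codomP; exists (inl h); rewrite ffunE.
  have /tnthP[h ->] : i \in t2 by rewrite m2.
  by apply/codomP; exists (inr h); rewrite ffunE.
have nR : 0 <= n%:R^-1 :> R by rewrite invr_ge0.
have tr : transitive (>=%R : rel R) by move=> a b d e1 e2; exact: le_trans e2 e1.
have st1 : sorted ge1 t1 by apply: sort_sorted => a b; exact: le_total.
have st2 : sorted ge2 t2 by apply: sort_sorted => a b; exact: le_total.
split; apply/(sorted_tnthP _ tr) => i i' ii'; rewrite !tnth_mktuple /signed_inc !ffunE /=.
  by rewrite !mul1r ler_wpM2r//; exact: (sorted_tnthP _ tr1).1 st1 i i' ii'.
by rewrite !mulN1r ler_wpM2r// lerN2; exact: (sorted_tnthP _ tr2).1 st2 i i' ii'.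
Qed.

End jump_selections.

(** * Probabilities of selections *)

Section selection_probabilities.
Context (R : realType) (d : measure_display) (Omega : measurableType d).
Variable P : probability Omega R.
Variable X : nat -> {RV P >-> R}.
Hypothesis iidX : iid X.
Variables (j k n : nat).
Local Notation H := ('I_j + 'I_k)%type.
Local Notation T2 := (j.-tuple R * k.-tuple R)%type.
Implicit Type tau : {ffun H -> 'I_n}.

Definition tau_rv tau (w : Omega) : T2 * T2 := tau_point (fun i => X i w) tau.

Lemma measurable_signed_inc h i : measurable_fun setT (fun w => @signed_inc R (fun i => X i w) j k h i).
Proof. exact: measurable_funM. Qed.

Lemma measurable_tau_rv tau : measurable_fun setT (tau_rv tau).
Proof.
have mt m (f : Omega -> m.-tuple R) : (forall i, measurable_fun setT (fun w => tnth (f w) i)) ->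
    measurable_fun setT f.
  by move=> mf; apply/measurable_fun_tnthP.
apply: measurable_fun_pair; apply: measurable_fun_pair; apply: mt => i.
- by under eq_fun do rewrite tnth_mktuple; exact: measurable_cst.
- by under eq_fun do rewrite tnth_mktuple; exact: measurable_cst.
- by under eq_fun do rewrite tnth_mktuple; apply: measurable_funM => //; exact: measurable_signed_inc.
- by under eq_fun do rewrite tnth_mktuple; apply: measurable_funM => //; exact: measurable_signed_inc.
Qed.

Lemma prod_codom tau (f : H -> R) (q : R) : injective tau ->
  \prod_(i < n) (if [pick h | tau h == i] is Some h then f h else q) =
  (\prod_h f h) * q ^+ (n - #|{: H}|).
Proof.
move=> tinj; rewrite (bigID (fun i => i \in codom tau))/=; congr (_ * _).
  rewrite (reindex_omap tau (fun i => [pick h | tau h == i])); last first.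
    move=> i /codomP[h ->]; case: pickP => [g /eqP/= ->//|/(_ h)].
    by rewrite eqxx.
  apply: eq_big => [h|h _].
    rewrite codom_f /=; case: pickP => [g /eqP /tinj -> |/(_ h)]; last by rewrite eqxx.
    by rewrite eqxx.
  by case: pickP => [g /eqP /tinj ->|/(_ h)] //; rewrite eqxx.
rewrite (eq_bigr (fun=> q)); last first.
  move=> i ni; case: pickP => // h /eqP e.
  by move: ni; rewrite -e codom_f.
rewrite prodr_const; congr (_ ^+ _).
have := cardC (mem (codom tau)); rewrite card_ord card_codom// => e.
by rewrite -[X in (X - _)%N]e addKn; apply: eq_card => i; rewrite !inE.
Qed.

(** The increments that [tau] selects are independent of each other and of the others; this is
    where [tau] has to be injective. *)
Lemma selection_prob tau (C : H -> set R) (D : set R) : injective tau ->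
  (forall h, measurable (C h)) -> measurable D ->
  prob P [set w | (forall h, C h (signed_inc (fun i => X i w) h (tau h))) /\
      (forall i : 'I_n, i \notin codom tau -> D (X i w))] =
  (\prod_h prob P [set w | C h (signed_inc (fun i => X i w) h 0%N)]) *
    prob P (X 0%N @^-1` D) ^+ (n - #|{: H}|).
Proof.
move=> tinj mC mD.
pose B (i : 'I_n) : set R :=
  if [pick h | tau h == i] is Some h then [set x | C h (jump_sign R h * x)] else D.
have mB i : measurable (B i).
  rewrite /B; case: pickP => // h _; rewrite -[X in measurable X]setTI.
  exact: (measurable_funM (measurable_cst (jump_sign R h)) (@measurable_id _ _ setT)).
rewrite -(prod_codom _ _ tinj) /prob (_ : [set w | _] = [set w | forall i : 'I_n, B i (X i w)]).
  rewrite iid_ord_fine//; apply: eq_bigr => i _; rewrite /B.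
  by case: pickP.
apply/seteqP; split=> w /=.
  move=> [Cw Dw] i; rewrite /B; case: pickP => [h /eqP <-|ni]; first exact: Cw.
  by apply: Dw; apply/negP => /codomP[h ih]; have := ni h; rewrite ih eqxx.
move=> Bw; split=> [h|i ni].
  by have := Bw (tau h); rewrite /B; case: pickP => [g /eqP /tinj ->|/(_ h)]//; rewrite eqxx.
have := Bw i; rewrite /B; case: pickP => // h /eqP e.
by move: ni; rewrite -e codom_f.
Qed.

Lemma selection_prob1 tau (C : H -> set R) : injective tau -> (forall h, measurable (C h)) ->
  prob P [set w | forall h, C h (signed_inc (fun i => X i w) h (tau h))] =
  \prod_h prob P [set w | C h (signed_inc (fun i => X i w) h 0%N)].
Proof.
move=> tinj mC; have := selection_prob tinj mC measurableT.
rewrite preimage_setT prob_setT expr1n mulr1 => <-; congr (prob P _).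
by apply/seteqP; split=> w //= -[].
Qed.

Definition inc_tail (h : H) (y : R) : R :=
  prob P [set w | y <= signed_inc (fun i => X i w) h 0%N].

Lemma measurable_inc_ge h i y : measurable [set w | y <= @signed_inc R (fun i => X i w) j k h i].
Proof. by apply: measurable_le_set => //; exact: measurable_signed_inc. Qed.

Lemma inc_tail_itv h y z : y <= z ->
  prob P [set w | y <= @signed_inc R (fun i => X i w) j k h 0%N < z] = inc_tail h y - inc_tail h z.
Proof.
move=> yz; have mi : measurable [set w | y <= @signed_inc R (fun i => X i w) j k h 0%N < z].
  rewrite (_ : [set w | _] = [set w | y <= @signed_inc R (fun i => X i w) j k h 0%N] `\`
     [set w | z <= @signed_inc R (fun i => X i w) j k h 0%N]).
    by apply: measurableD; exact: measurable_inc_ge.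
  apply/seteqP; split=> w /=; first by move=> /andP[-> sz]; split => //; apply/negP; rewrite -ltNge.
  by move=> [-> /negP]; rewrite -ltNge.
apply/eqP; rewrite eq_sym subr_eq -probU//; last 2 first.
- exact: measurable_inc_ge.
- by rewrite -subset0 => w [/= /andP[_ h1] h2]; rewrite ltNge h2 in h1.
apply/eqP; congr (prob P _); apply/seteqP; split=> w /=.
  by move=> yw; have [zw|wz] := leP z (signed_inc (fun i => X i w) h 0%N); [right|left; rewrite yw].
by move=> [/andP[]//|]; exact: le_trans.
Qed.

Lemma inc_tail_noninc h y z : y <= z -> inc_tail h z <= inc_tail h y.
Proof. by move=> yz; rewrite -subr_ge0 -inc_tail_itv// prob_ge0. Qed.

Definition others_small (c : R) tau : set Omega :=
  [set w | forall i : 'I_n, i \notin codom tau -> `|X i w| <= c].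

Lemma measurable_others_small c tau : measurable (others_small c tau).
Proof.
apply: (@measurable_set_forall _ _ _ (fun i : 'I_n => [set w | i \notin codom tau -> `|X i w| <= c])) => i.
have [_|_] := boolP (i \notin codom tau); last first.
  by rewrite [X in measurable X](_ : _ = setT)//; apply/seteqP; split=> x //= _ /negP.
rewrite [X in measurable X](_ : _ = [set w | `|X i w| <= c]).
  by apply: measurable_le_set => //; exact: measurableT_comp.
by apply/seteqP; split=> w /= h; [exact: h|move=> _].
Qed.

Definition box (a b c e : H -> R) : set (T2 * T2) :=
  [set z | (forall h, a h <= pair_coord h z.1 < b h) /\ (forall h, c h <= pair_coord h z.2 < e h)].

Definition time_ok (a b : H -> R) tau : bool :=
  [forall h, a h <= step_time R (tau h) < b h].

(** The times of the jumps are not random once [tau] is fixed; they only decide whether [tau]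
    contributes. *)
Lemma tau_box_prob (a b c e : H -> R) (s : R) tau : (0 < n)%N -> injective tau ->
  (forall h, c h <= e h) ->
  prob P [set w | box a b c e (tau_rv tau w) /\ others_small s tau w] =
  (if time_ok a b tau then 1 else 0) *
    ((\prod_h (inc_tail h (c h * n%:R) - inc_tail h (e h * n%:R))) *
     prob P [set w | `|X 0%N w| <= s] ^+ (n - #|{: H}|)).
Proof.
move=> n0 tinj ce; have nR : 0 < n%:R :> R by rewrite ltr0n.
case: ifPn => [/forallP tok|ntok]; last first.
  rewrite mul0r (_ : [set w | _] = set0) /prob ?measure0//.
  rewrite -subset0 => w [[tok _] _]; move/negP: ntok; apply; apply/forallP => h.
  by have := tok h; rewrite tau_point_time.
pose C h := `[(c h * n%:R), (e h * n%:R)[%classic : set R.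
pose D := [set y : R | `|y| <= s].
have mD : measurable D by apply: measurable_le_set => //; exact: measurable_normr.
rewrite mul1r (eq_bigr (fun h => prob P [set w | C h (signed_inc (fun i => X i w) h 0%N)])); last first.
  move=> h _; have cen : c h * n%:R <= e h * n%:R by rewrite ler_pM2r.
  by rewrite -(inc_tail_itv h cen); congr (prob P _).
have mC h : measurable (C h) by exact: measurable_itv.
rewrite -(selection_prob tinj mC mD); congr (prob P _); apply/seteqP; split=> w /=.
  move=> [[_ zs] small]; split => // h; have := zs h.
  by rewrite tau_point_size ler_pdivlMr// ltr_pdivrMr// /C /= in_itv.
move=> [Cw small]; split => //; split=> h.
  by rewrite tau_point_time; exact: tok.
have := Cw h; rewrite /C /= in_itv/=.
by rewrite tau_point_size ler_pdivlMr// ltr_pdivrMr.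
Qed.

End selection_probabilities.

(** * Counting selections *)

Section limits_of_products.
Variable R : realType.

Lemma cvg_prod_fin (F : finType) (f : F -> nat -> R) (l : F -> R) :
  (forall i, f i n @[n --> \oo] --> l i) ->
  \prod_i f i n @[n --> \oo] --> \prod_i l i.
Proof.
move=> fl.
have H s : (fun n => \prod_(i <- s) f i n) @ \oo --> \prod_(i <- s) l i.
  elim: s => [|i s IH].
    rewrite big_nil (_ : (fun n => _) = fun=> 1); first exact: cvg_cst.
    by apply/funext => n; rewrite big_nil.
  rewrite big_cons (_ : (fun n => _) = fun n => f i n * \prod_(i <- s) f i n).
    exact: cvgM.
  by apply/funext => n; rewrite big_cons.
exact: H.
Qed.

Lemma cvg_invn : (n%:R : R)^-1 @[n --> \oo] --> (0 : R).
Proof.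
apply: (@le_pow_cvg0 _ _ (- 1)); first by rewrite oppr_lt0.
by exists 1 => //; near=> n; rewrite mul1r powR_inv1// ger0_norm ?invr_ge0.
Unshelve. all: by end_near. Qed.

Lemma cvg_ffact m : (n ^_ m)%:R / (n%:R : R) ^+ m @[n --> \oo] --> (1 : R).
Proof.
elim: m => [|m IH].
  rewrite (_ : (fun n => _) = fun=> 1); first exact: cvg_cst.
  by apply/funext => n; rewrite ffactn0 expr0 divr1.
have h : (n%:R - m%:R) / (n%:R : R) @[n --> \oo] --> (1 : R).
  have : 1 - m%:R * (n%:R : R)^-1 @[n --> \oo] --> 1 - m%:R * (0 : R).
    by apply: cvgB; [exact: cvg_cst|apply: cvgM; [exact: cvg_cst|exact: cvg_invn]].
  rewrite mulr0 subr0 => lim1; apply: cvg_trans; last exact: lim1.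
  apply: near_eq_cvg; near=> n.
  have n0 : (n%:R : R) != 0 by rewrite pnatr_eq0 -lt0n; near: n; exact: nbhs_infty_gt.
  by rewrite mulrBl divff.
have := cvgM IH h; rewrite mulr1 => lim1; apply: cvg_trans; last exact: lim1.
apply: near_eq_cvg; near=> n.
have mn : (m <= n)%N by near: n; exact: nbhs_infty_ge.
by rewrite ffactnSr natrM natrB// exprSr invfM mulrACA.
Unshelve. all: by end_near. Qed.

Lemma bernoulli_ineq (t : R) n : 0 <= t <= 1 -> 1 - n%:R * t <= (1 - t) ^+ n.
Proof.
move=> /andP[t0 t1]; elim: n => [|n IH]; first by rewrite mul0r subr0 expr0.
have t1' : 0 <= 1 - t by rewrite subr_ge0.
rewrite exprS (@le_trans _ _ ((1 - t) * (1 - n%:R * t)))//; last by rewrite ler_wpM2l.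
rewrite -natr1 -subr_ge0.
have -> : (1 - t) * (1 - n%:R * t) - (1 - (n%:R + 1) * t) = n%:R * (t * t) by ring.
by rewrite !mulr_ge0.
Qed.

End limits_of_products.

Section counting.
Variable R : realType.

(** The loss of [2] comes from rounding at the two ends. *)
Lemma count_interval n (a b : R) : 0 <= a -> a <= b -> b <= 1 ->
  n%:R * (b - a) - 2 <= #|[pred i : 'I_n | a <= step_time R i < b]|%:R.
Proof.
move=> a0 ab b1; have [->|n0] := posnP n.
  by rewrite mul0r sub0r (@le_trans _ _ 0)// oppr_le0.
have nR : 0 < n%:R :> R by rewrite ltr0n.
pose lo := Num.truncn (n%:R * a); pose hi := Num.truncn (n%:R * b).
have na0 : 0 <= n%:R * a by rewrite mulr_ge0// ltW.
have nb0 : 0 <= n%:R * b by rewrite mulr_ge0 ?(ltW nR)// (le_trans a0).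
have /andP[lo1 lo2] := truncn_itv na0; have /andP[hi1 hi2] := truncn_itv nb0.
have hin : (hi <= n)%N.
  by rewrite -(ler_nat R) (le_trans hi1)// ler_piMr// ltW.
have itv i : (lo <= i < hi.-1)%N -> n%:R * a <= i.+1%:R < n%:R * b.
  move=> /andP[li ih]; apply/andP; split.
    by rewrite (le_trans (ltW lo2))// ler_nat.
  by rewrite (lt_le_trans _ hi1)// ltr_nat; lia.
have : (hi.-1 - lo <= #|[pred i : 'I_n | (a <= step_time R i < b)%R]|)%N.
  have lt_n (i : 'I_(hi.-1 - lo)) : (lo + i < n)%N by have := ltn_ord i; lia.
  pose f (i : 'I_(hi.-1 - lo)) := Ordinal (lt_n i).
  have finj : injective f.
    by move=> i i' /(congr1 val)/= /addnI /val_inj.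
  rewrite -[leqLHS]card_ord -(card_codom finj); apply: subset_leq_card.
  apply/fintype.subsetP => _ /codomP[i ->]; rewrite inE /step_time /=.
  rewrite ler_pdivlMr// ltr_pdivrMr// [a * _]mulrC [b * _]mulrC.
  by apply: itv; have := ltn_ord i; lia.
rewrite -(ler_nat R); apply: le_trans.
have : (hi.+1 <= (hi.-1 - lo) + lo + 2)%N by lia.
rewrite -(ler_nat R) !natrD => h.
have : n%:R * (b - a) = n%:R * b - n%:R * a by ring.
by move=> ->; move: h hi2 lo1; lra.
Qed.

Variables (j k n : nat).
Local Notation H := ('I_j + 'I_k)%type.

(** A lower bound for the proportion of selections that are injective and have their times in the
    given intervals: the proportion for arbitrary maps, a product over the jumps, minus the
    proportion of maps that are not injective. *)
Definition low_count (a b : H -> R) : R :=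
  \prod_h Num.max 0 ((b h - a h) - 2 * n%:R^-1) - (1 - (n ^_ #|{: H}|)%:R / n%:R ^+ #|{: H}|).

Lemma low_count_le (a b : H -> R) : (0 < n)%N ->
  (forall h, [/\ 0 <= a h, a h <= b h & b h <= 1]) ->
  low_count a b * n%:R ^+ #|{: H}| <=
  \sum_(tau : {ffun H -> 'I_n} | injectiveb tau) (if time_ok a b tau then 1 else 0).
Proof.
move=> n0 ab; have nR : 0 < n%:R :> R by rewrite ltr0n.
pose t (h : H) (i : 'I_n) : R := if a h <= step_time R i < b h then 1 else 0.
have all : \sum_(tau : {ffun H -> 'I_n}) (if time_ok a b tau then 1 else 0) =
    \prod_h \sum_i t h i.
  rewrite bigA_distr_bigA/=; apply: eq_bigr => tau _; rewrite /time_ok.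
  case: ifPn => [/forallP tok|]; first by rewrite big1// => h _; rewrite /t tok.
  by rewrite negb_forall => /existsP[h nh]; rewrite (bigD1 h)//= /t (negbTE nh) mul0r.
have cnt h : n%:R * Num.max 0 ((b h - a h) - 2 * n%:R^-1) <= \sum_i t h i.
  have -> : \sum_i t h i = #|[pred i : 'I_n | a h <= step_time R i < b h]|%:R.
    by rewrite -big_mkcond/= sumr_const.
  rewrite maxr_pMr ?(ltW nR)// mulr0 ge_max ler0n/=.
  have [a0 ab' b1] := ab h; apply: le_trans (count_interval n a0 ab' b1).
  by rewrite mulrBr mulrCA divff ?mulr1// gt_eqF.
have noninj : \sum_(tau : {ffun H -> 'I_n} | ~~ injectiveb tau) (if time_ok a b tau then 1 else 0)
    <= (n%:R ^+ #|{: H}| - (n ^_ #|{: H}|)%:R : R).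
  apply: (@le_trans _ _ (\sum_(tau : {ffun H -> 'I_n} | ~~ injectiveb tau) 1)).
    by apply: ler_sum => tau _; case: ifP.
  rewrite sumr_const lerBrDr; have := card_inj_ffuns H 'I_n; rewrite card_ord => <-.
  rewrite -natrD -natrX ler_nat; have := cardC [pred f : {ffun H -> 'I_n} | injectiveb f].
  rewrite card_ffun card_ord => <-; rewrite addnC leq_add//.
  by apply: subset_leq_card; apply/fintype.subsetP => f; rewrite inE.
have e : \prod_h \sum_i t h i =
    \sum_(tau : {ffun H -> 'I_n} | injectiveb tau) (if time_ok a b tau then 1 else 0) +
    \sum_(tau : {ffun H -> 'I_n} | ~~ injectiveb tau) (if time_ok a b tau then 1 else 0).
  by rewrite -all (bigID (fun tau : {ffun H -> 'I_n} => injectiveb tau)).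
have prodle : n%:R ^+ #|{: H}| * \prod_h Num.max 0 ((b h - a h) - 2 * n%:R^-1) <= \prod_h \sum_i t h i.
  rewrite -prodr_const -big_split/=; apply: ler_prod => h _.
  by rewrite cnt andbT mulr_ge0 ?le_max ?lexx// ltW.
rewrite /low_count mulrBl mulrBl mul1r divfK ?expf_neq0 ?gt_eqF//.
rewrite [X in X - _]mulrC; move: prodle; rewrite e => prodle.
rewrite lerBlDr (le_trans prodle)// lerD2l (le_trans noninj)//.
Qed.

End counting.

(** * Limits over boxes *)

Lemma cvg_max0 (R : realType) (u : nat -> R) (l : R) :
  u n @[n --> \oo] --> l -> Num.max 0 (u n) @[n --> \oo] --> Num.max 0 l.
Proof.
have maxE (y : R) : Num.max 0 y = (y + `|y|) / 2.
  have [y0|y0] := leP 0 y; first by rewrite ger0_norm//; field.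
  by rewrite ltr0_norm// subrr mul0r.
move=> ul; rewrite maxE (_ : (fun n => _) = fun n => (u n + `|u n|) / 2); last first.
  by apply/funext => n; rewrite maxE.
by apply: cvgM; [apply: cvgD => //; exact: cvg_norm|exact: cvg_cst].
Qed.

Section box_limits.
Context (R : realType) (d : measure_display) (Omega : measurableType d).
Variable P : probability Omega R.
Variable X : nat -> {RV P >-> R}.
Hypothesis iidX : iid X.
Variables (j k : nat).
Local Notation H := ('I_j + 'I_k)%type.
Variable gam : H -> R.
Local Notation tail := (@inc_tail R d Omega P X j k).
Hypothesis tail_gt0 : forall h y, 0 < tail h y.
Hypothesis tail_ratio : forall h (c : R), 0 < c ->
  tail h (c * n%:R) / tail h n%:R @[n --> \oo] --> c `^ (- gam h).
Hypothesis small_typical : forall eps : R, 0 < eps ->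
  n%:R * (1 - prob P [set w | `|X 0%N w| <= eps * n%:R]) @[n --> \oo] --> (0 : R).

Definition norming (n : nat) : R := \prod_h (n%:R * tail h n%:R).

Lemma normingE n : norming n = n%:R ^+ #|{: H}| * \prod_h tail h n%:R.
Proof. by rewrite /norming big_split/= prodr_const. Qed.

Lemma norming_gt0 n : (0 < n)%N -> 0 < norming n.
Proof. by move=> n0; apply: prodr_gt0 => h _; rewrite mulr_gt0// ltr0n. Qed.

Lemma measurable_abs_le (c : R) : measurable [set w | `|X 0%N w| <= c].
Proof. by apply: measurable_le_set => //; exact: measurableT_comp. Qed.

(** The number of selections grows like the volume of the time box times [n ^+ #|{: H}|], which is
    the power of [n] in [norming]; the sizes contribute ratios of tails; and the remaining
    increments are all small with a probability tending to one, by the inequality of Bernoulli. *)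
Lemma box_lower_limit (a b c e : H -> R) (eps : R) : 0 < eps ->
  (forall h, [/\ 0 <= a h, a h <= b h & b h <= 1]) ->
  (forall h, 0 < c h <= e h) ->
  exists2 v : nat -> R,
    v @ \oo --> (\prod_h (b h - a h)) * (\prod_h (c h `^ (- gam h) - e h `^ (- gam h))) &
    forall n, (0 < n)%N -> v n <=
      (\sum_(tau : {ffun H -> 'I_n} | injectiveb tau)
         prob P [set w | box a b c e (tau_rv X tau w) /\ others_small X (eps * n%:R) tau w]) /
      norming n.
Proof.
move=> eps0 ab ce.
pose q n := prob P [set w | `|X 0%N w| <= eps * n%:R].
pose v n := Num.max 0 (low_count n a b) *
  (\prod_h ((tail h (c h * n%:R) - tail h (e h * n%:R)) / tail h n%:R)) *
  Num.max 0 (1 - n%:R * (1 - q n)).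
exists v.
  have l1 : (fun n => low_count n a b) @ \oo --> \prod_h (b h - a h).
    have -> : \prod_h (b h - a h) = \prod_h Num.max 0 ((b h - a h) - 2 * 0) - (1 - 1).
      rewrite subrr subr0; apply: eq_bigr => h _; rewrite mulr0 subr0 max_r//.
      by have [_ + _] := ab h; rewrite subr_ge0.
    apply: cvgB; last by apply: cvgB; [exact: cvg_cst|exact: cvg_ffact].
    apply: (@cvg_prod_fin _ H (fun h n => Num.max 0 ((b h - a h) - 2 * n%:R^-1))) => h.
    apply: cvg_max0.
    by apply: cvgB; [exact: cvg_cst|apply: cvgM; [exact: cvg_cst|exact: cvg_invn]].
  have l2 : (fun n => \prod_h ((tail h (c h * n%:R) - tail h (e h * n%:R)) / tail h n%:R)) @ \oo -->
      \prod_h (c h `^ (- gam h) - e h `^ (- gam h)).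
    apply: (@cvg_prod_fin _ H (fun h n => (tail h (c h * n%:R) - tail h (e h * n%:R)) / tail h n%:R)) => h.
    have /andP[c0 ce'] := ce h; have e0 := lt_le_trans c0 ce'.
    rewrite (_ : (fun n => _) = fun n => tail h (c h * n%:R) / tail h n%:R - tail h (e h * n%:R) / tail h n%:R).
      by apply: cvgB; exact: tail_ratio.
    by apply/funext => n; rewrite mulrBl.
  have l3 : (fun n => Num.max 0 (1 - n%:R * (1 - q n))) @ \oo --> (1 : R).
    have l3' : (fun n => 1 - n%:R * (1 - q n)) @ \oo --> (1 - 0 : R).
      by apply: cvgB; [exact: cvg_cst|exact: small_typical].
    rewrite subr0 in l3'; have := cvg_max0 l3'.
    by rewrite (max_r ler01).
  have ab0 : 0 <= \prod_h (b h - a h).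
    by apply: prodr_ge0 => h _; have [_ + _] := ab h; rewrite subr_ge0.
  have l1' := cvg_max0 l1; rewrite (max_r ab0) in l1'.
  by have := cvgM (cvgM l1' l2) l3; rewrite mulr1; apply.
move=> n n0; have nR : 0 < n%:R :> R by rewrite ltr0n.
have n_gt0 : 0 < n%:R ^+ #|{: H}| :> R by rewrite exprn_gt0.
have ce' h : c h <= e h by have /andP[] := ce h.
pose D := \prod_h (tail h (c h * n%:R) - tail h (e h * n%:R)).
pose Q := q n ^+ (n - #|{: H}|).
have D0 : 0 <= D.
  apply: prodr_ge0 => h _; rewrite subr_ge0; apply: inc_tail_noninc.
  by rewrite ler_pM2r.
have q01 : 0 <= 1 - q n <= 1.
  by rewrite subr_ge0 prob_le1 ?gerBl ?prob_ge0//; exact: measurable_abs_le.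
have Q0 : 0 <= Q by rewrite exprn_ge0// prob_ge0.
have qQ : Num.max 0 (1 - n%:R * (1 - q n)) <= Q.
  rewrite ge_max Q0/= (le_trans (bernoulli_ineq n q01))// subKr.
  by rewrite /Q ler_wiXn2l ?prob_ge0 ?prob_le1 ?leq_subr//; exact: measurable_abs_le.
rewrite (eq_bigr (fun tau => (if time_ok a b tau then 1 else 0) * (D * Q))); last first.
  by move=> tau /injectiveP tinj; exact: tau_box_prob.
rewrite -mulr_suml normingE ler_pdivlMr; last first.
  by rewrite mulr_gt0// prodr_gt0.
set N := \sum_(_ | _) _.
have N0 : 0 <= N by apply: sumr_ge0 => tau _; case: ifP.
have lcN : Num.max 0 (low_count n a b) * n%:R ^+ #|{: H}| <= N.
  rewrite maxr_pMl ?(ltW n_gt0)// mul0r ge_max N0/=.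
  exact: low_count_le.
have -> : v n * (n%:R ^+ #|{: H}| * \prod_h tail h n%:R) =
    (Num.max 0 (low_count n a b) * n%:R ^+ #|{: H}|) * (D * Num.max 0 (1 - n%:R * (1 - q n))).
  rewrite /v; have -> : \prod_h ((tail h (c h * n%:R) - tail h (e h * n%:R)) / tail h n%:R) =
      D / \prod_h tail h n%:R by rewrite prodf_div.
  have p0 : \prod_h tail h n%:R != 0 by rewrite gt_eqF// prodr_gt0.
  by field.
apply: ler_pM => //.
- by rewrite mulr_ge0 ?(ltW n_gt0)// le_max lexx.
- by rewrite mulr_ge0// le_max lexx.
- by rewrite ler_wpM2l.
Qed.

(** Times unrestricted and other increments arbitrary: then the probability factors exactly, and
    the selections are at most [n ^+ #|{: H}|]. *)
Lemma far_upper_limit (r : R) : 0 < r ->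
  exists2 v : nat -> R, v @ \oo --> \prod_h r `^ (- gam h) &
    forall n, (0 < n)%N ->
      (\sum_(tau : {ffun H -> 'I_n} | injectiveb tau)
         prob P [set w | forall h, r <= pair_coord h (tau_rv X tau w).2]) / norming n <= v n.
Proof.
move=> r0; exists (fun n => \prod_h (tail h (r * n%:R) / tail h n%:R)).
  apply: (@cvg_prod_fin _ H (fun h n => tail h (r * n%:R) / tail h n%:R)) => h.
  exact: tail_ratio.
move=> n n0; have nR : 0 < n%:R :> R by rewrite ltr0n.
rewrite [X in X / _](eq_bigr (fun=> \prod_h tail h (r * n%:R))); last first.
  move=> tau tinjb; have tinj : injective tau by exact/injectiveP.
  pose C (h : H) := `[(r * n%:R), +oo[%classic : set R.
  have mC (h : H) : measurable (C h) by exact: measurable_itv.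
  have -> : [set w | forall h, r <= pair_coord h (tau_rv X tau w).2] =
      [set w | forall h, C h (signed_inc (fun i => X i w) h (tau h))].
    apply/seteqP; split=> w /= rw h; have := rw h; rewrite /C /= in_itv/= andbT.
      by rewrite tau_point_size ler_pdivlMr.
    by rewrite tau_point_size ler_pdivlMr.
  rewrite selection_prob1//; apply: eq_bigr => h _; congr (prob P _).
  by apply/seteqP; split=> w; rewrite /C /= in_itv/= andbT.
have t0 : 0 <= \prod_h tail h (r * n%:R) by apply: prodr_ge0 => h _; exact/ltW.
rewrite sumr_const normingE ler_pdivrMr; last by rewrite mulr_gt0 ?exprn_gt0// prodr_gt0.
have -> : \prod_h (tail h (r * n%:R) / tail h n%:R) * (n%:R ^+ #|{: H}| * \prod_h tail h n%:R) =
    n%:R ^+ #|{: H}| * \prod_h tail h (r * n%:R).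
  rewrite prodf_div; have p0 : \prod_h tail h n%:R != 0 by rewrite gt_eqF// prodr_gt0.
  by field.
rewrite -[leLHS]mulr_natl ler_wpM2r// -natrX ler_nat.
have := max_card [pred tau : {ffun H -> 'I_n} | injectiveb tau].
by rewrite card_ffun card_ord.
Qed.

End box_limits.

(** * Lower limits over open sets *)

Lemma cvg_sum_fin (R : realType) (F : finType) (Q : pred F) (f : F -> nat -> R) (l : F -> R) :
  (forall i, Q i -> f i n @[n --> \oo] --> l i) ->
  (fun n => \sum_(i | Q i) f i n) @ \oo --> \sum_(i | Q i) l i.
Proof.
move=> fl.
have H s : (fun n => \sum_(i <- s | Q i) f i n) @ \oo --> \sum_(i <- s | Q i) l i.
  elim: s => [|i s IH].
    rewrite big_nil (_ : (fun n => _) = fun=> 0); first exact: cvg_cst.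
    by apply/funext => n; rewrite big_nil.
  rewrite big_cons (_ : (fun n => _) = fun n => if Q i then f i n + \sum_(i <- s | Q i) f i n
    else \sum_(i <- s | Q i) f i n).
    by case: ifPn => // /fl fi; exact: cvgD.
  by apply/funext => n; rewrite big_cons.
exact: H.
Qed.

Section open_sets.
Context (R : realType) (d : measure_display) (Omega : measurableType d).
Variable P : probability Omega R.
Variable X : nat -> {RV P >-> R}.
Hypothesis iidX : iid X.
Variables (j k : nat) (alpha beta : R).
Hypotheses (a0 : 0 < alpha) (b0 : 0 < beta).
Local Notation H := ('I_j + 'I_k)%type.
Local Notation T2 := (j.-tuple R * k.-tuple R)%type.
Local Notation T := (T2 * T2)%type.

Definition jump_index (h : H) : R := if h is inl _ then alpha else beta.

Local Notation tail := (@inc_tail R d Omega P X j k).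
Hypothesis tail_gt0 : forall h y, 0 < tail h y.
Hypothesis tail_ratio : forall h (c : R), 0 < c ->
  tail h (c * n%:R) / tail h n%:R @[n --> \oo] --> c `^ (- jump_index h).
Hypothesis small_typical : forall eps : R, 0 < eps ->
  n%:R * (1 - prob P [set w | `|X 0%N w| <= eps * n%:R]) @[n --> \oo] --> (0 : R).

Local Notation norming := (@norming R d Omega P X j k).
Local Notation jump_law := (@jump_law R alpha beta a0 b0 j k).
Local Notation jump_coord := (@jump_coord R j k).

Definition proper_jumps (z : T) : Prop :=
  (forall h, 0 < pair_coord h z.1 < 1) /\ (forall h, 0 < pair_coord h z.2).

Lemma exists_coords (f : H + H -> R) : exists z : T, forall i, jump_coord i z = f i.
Proof.
exists (([tuple f (inl (inl i)) | i < j], [tuple f (inl (inr i)) | i < k]),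
  ([tuple f (inr (inl i)) | i < j], [tuple f (inr (inr i)) | i < k])).
by move=> [[i|i]|[i|i]]; rewrite /jump_coord /pair_coord /= tnth_mktuple.
Qed.

Section one_cell.
Variables (m : nat) (c : {ffun H + H -> 'I_(2 * 4 ^ m)}).
Hypothesis c_proper : dyadic_cell jump_coord c `<=` proper_jumps.

Let lo i : R := dyadic_lo R m (c i).
Let hi i : R := dyadic_lo R m (c i).+1.

Let lo_hi i : lo i < hi i.
Proof.
by rewrite /lo /hi /dyadic_lo ltrD2r ltr_pM2r ?invr_gt0 ?exprn_gt0// ltr_nat.
Qed.

Let in_cell (f : H + H -> R) : (forall i, lo i <= f i < hi i) ->
  exists2 z, proper_jumps z & forall i, jump_coord i z = f i.
Proof.
move=> fc; have [z zf] := exists_coords f; exists z => //; apply: c_proper => i.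
by rewrite zf; exact: fc.
Qed.

(* A cell inside the region of proper jumps has its lower corner there, and cannot reach beyond
   time one; so [box_lower_limit] applies to it. *)
Let time_lo h : 0 < lo (inl h) < 1.
Proof.
have [|z [zt _] zf] := in_cell (f := lo); first by move=> i; rewrite lexx lo_hi.
by have := zt h; have := zf (inl h) => /= ->.
Qed.

Let size_lo h : 0 < lo (inr h).
Proof.
have [|z [_ zs] zf] := in_cell (f := lo); first by move=> i; rewrite lexx lo_hi.
by have := zs h; have := zf (inr h) => /= ->.
Qed.

Let time_hi h : hi (inl h) <= 1.
Proof.
rewrite leNgt; apply/negP => h1.
pose f i := if i == inl h then 1 else lo i.
have [|z [zt _] zf] := in_cell (f := f).
  move=> i; rewrite /f; case: eqP => [->|_]; last by rewrite lexx lo_hi.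
  by rewrite h1 andbT; have /andP[_ /ltW] := time_lo h.
by have := zt h; have := zf (inl h); rewrite /f eqxx /= => ->; rewrite ltxx andbF.
Qed.

Let cell_box : dyadic_cell jump_coord c =
  box (fun h => lo (inl h)) (fun h => hi (inl h)) (fun h => lo (inr h)) (fun h => hi (inr h)).
Proof.
apply/seteqP; split=> z /=.
  by move=> zc; split=> h; [exact: (zc (inl h))|exact: (zc (inr h))].
by move=> [z1 z2] [h|h]; [exact: z1|exact: z2].
Qed.

Lemma cell_lower_limit (eps : R) : 0 < eps ->
  exists2 v : nat -> R, ((fine (jump_law (dyadic_cell jump_coord c)))%:E =
      jump_law (dyadic_cell jump_coord c))%E /\
    v @ \oo --> fine (jump_law (dyadic_cell jump_coord c)) &
    forall n, (0 < n)%N -> v n <=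
      (\sum_(tau : {ffun H -> 'I_n} | injectiveb tau)
         prob P [set w | dyadic_cell jump_coord c (tau_rv X tau w) /\
                         others_small X (eps * n%:R) tau w]) /
      norming n.
Proof.
move=> eps0.
have ab h : [/\ 0 <= lo (inl h), lo (inl h) <= hi (inl h) & hi (inl h) <= 1].
  by split; [have /andP[/ltW] := time_lo h|exact/ltW|].
have ce h : 0 < lo (inr h) <= hi (inr h) by rewrite size_lo ltW.
have [v vl vle] := box_lower_limit iidX tail_gt0 tail_ratio small_typical eps0 ab ce.
have law : jump_law (dyadic_cell jump_coord c) = ((\prod_h (hi (inl h) - lo (inl h))) *
    (\prod_h (lo (inr h) `^ (- jump_index h) - hi (inr h) `^ (- jump_index h))))%:E.
  pose B h := `[lo (inl h), hi (inl h)[%classic : set R.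
  pose C h := `[lo (inr h), hi (inr h)[%classic : set R.
  have mB h : measurable (B h) by exact: measurable_itv.
  have mC h : measurable (C h) by exact: measurable_itv.
  have hU h : @uniform01 R (B h) = (hi (inl h) - lo (inl h))%:E.
    by have [? ? ?] := ab h; exact: uniform01_itv.
  have hA (i : 'I_j) : nu_measure a0 (C (inl i)) =
    (lo (inr (inl i)) `^ (- alpha) - hi (inr (inl i)) `^ (- alpha))%:E by exact: nu_itv.
  have hB (i : 'I_k) : nu_measure b0 (C (inr i)) =
    (lo (inr (inr i)) `^ (- beta) - hi (inr (inr i)) `^ (- beta))%:E by exact: nu_itv.
  rewrite cell_box.
  have e := @jump_law_box R alpha beta a0 b0 j k B C _
    (fun h => lo (inr h) `^ (- jump_index h) - hi (inr h) `^ (- jump_index h)) mB mC hU hA hB.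
  by rewrite -e; congr (_ _).
by exists v; [rewrite law|rewrite cell_box].
Qed.

End one_cell.

(** Half of the portmanteau theorem, for the sums over selections: finitely many cells inside [G]
    carry more than [r], and the lower limit over each cell is known. *)
Lemma open_lower (G : set T) (eps r : R) : coord_open jump_coord G -> G `<=` proper_jumps ->
  0 < eps -> (r%:E < jump_law G)%E ->
  \forall n \near \oo, r < (\sum_(tau : {ffun H -> 'I_n} | injectiveb tau)
     prob P [set w | G (tau_rv X tau w) /\ others_small X (eps * n%:R) tau w]) / norming n.
Proof.
move=> Go Gp eps0 rG.
have mco := @measurable_jump_coord R j k.
have [m rm] : exists m, (r%:E < jump_law (inner_cells jump_coord m G))%E.
  have cv := inner_cells_cvg mco (mu := jump_law) Go.
  apply: contrapT => /forallNP h; move: rG; rewrite ltNge => /negP; apply.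
  rewrite -(cvg_lim _ cv)//; apply: lime_le; first by apply/cvg_ex; exists (jump_law G).
  by near=> m; rewrite leNgt; apply/negP; exact: h.
pose Q (c : {ffun H + H -> 'I_(2 * 4 ^ m)}) := `[< dyadic_cell jump_coord c `<=` G >].
have cells (c : {ffun H + H -> 'I_(2 * 4 ^ m)}) : exists v : nat -> R, Q c ->
    [/\ ((fine (jump_law (dyadic_cell jump_coord c)))%:E = jump_law (dyadic_cell jump_coord c))%E,
      v @ \oo --> fine (jump_law (dyadic_cell jump_coord c)) &
    forall n, (0 < n)%N -> v n <=
      (\sum_(tau : {ffun H -> 'I_n} | injectiveb tau)
         prob P [set w | dyadic_cell jump_coord c (tau_rv X tau w) /\
                         others_small X (eps * n%:R) tau w]) / norming n].
  have [/asboolP cG|_] := boolP (Q c); last by exists (fun=> 0).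
  have [v [v1 v2] v3] := cell_lower_limit (subset_trans cG Gp) eps0.
  by exists v.
have /(_ _)/cid-/all_sig[v vP] := cells.
have lim : (fun n => \sum_(c | Q c) v c n) @ \oo -->
    \sum_(c | Q c) fine (jump_law (dyadic_cell jump_coord c)).
  by apply: cvg_sum_fin => c /vP[].
have sumE : (jump_law (inner_cells jump_coord m G) =
    (\sum_(c | Q c) fine (jump_law (dyadic_cell jump_coord c)))%:E)%E.
  rewrite measure_inner_cells// -sumEFin; apply: eq_bigr => c Qc.
  by have [-> _ _] := vP c Qc.
rewrite sumE lte_fin in rm.
have near_r := cvgr_gt _ lim _ rm.
near=> n.
have n0 : (0 < n)%N by near: n; exact: nbhs_infty_gt.
apply: (@lt_le_trans _ _ (\sum_(c | Q c) v c n)); first by near: n; exact: near_r.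
apply: (@le_trans _ _ (\sum_(c | Q c) (\sum_(tau : {ffun H -> 'I_n} | injectiveb tau)
         prob P [set w | dyadic_cell jump_coord c (tau_rv X tau w) /\
                         others_small X (eps * n%:R) tau w]) / norming n)).
  by apply: ler_sum => c /vP[_ _]; apply.
have norm0 : 0 <= (norming n)^-1 by rewrite invr_ge0; apply/ltW/norming_gt0.
rewrite -mulr_suml ler_wpM2r//.
rewrite exchange_big/=; apply: ler_sum => tau _.
have mcell (c : {ffun H + H -> 'I_(2 * 4 ^ m)}) : measurable [set w |
    dyadic_cell jump_coord c (tau_rv X tau w) /\ others_small X (eps * n%:R) tau w].
  apply: measurableI; last exact: measurable_others_small.
  rewrite -[X in measurable X]setTI; apply: measurable_tau_rv => //.
  exact: dyadic_cell_measurable.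
have mG : measurable [set w | G (tau_rv X tau w) /\ others_small X (eps * n%:R) tau w].
  apply: measurableI; last exact: measurable_others_small.
  rewrite -[X in measurable X]setTI; apply: measurable_tau_rv => //.
  exact: coord_open_measurable Go.
rewrite big_mkcond/= (eq_bigr (fun c => prob P [set w | Q c /\
    (dyadic_cell jump_coord c (tau_rv X tau w) /\ others_small X (eps * n%:R) tau w)])); last first.
  move=> c _; case: ifPn => Qc; first by congr (prob P _); apply/seteqP; split=> w // [].
  rewrite (_ : [set w | _] = set0) /prob ?measure0//.
  by rewrite -subset0 => w [].
have mQ c : measurable [set w | Q c /\
    (dyadic_cell jump_coord c (tau_rv X tau w) /\ others_small X (eps * n%:R) tau w)].
  case: (Q c); last by rewrite (_ : [set w | _] = set0)// -subset0 => w [].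
  by rewrite [X in measurable X](_ : _ = [set w | dyadic_cell jump_coord c (tau_rv X tau w) /\
     others_small X (eps * n%:R) tau w])//; apply/seteqP; split=> w // [].
rewrite -prob_exists//; last first.
  move=> c c' w [_ [h1 _]] [_ [h2 _]]; exact: dyadic_cell_disjoint h1 h2.
apply: prob_le => //; first exact: measurable_set_exists.
by move=> w [c [/asboolP cG [h1 h2]]]; split => //; exact: cG.
Unshelve. all: by end_near. Qed.

End open_sets.

(** * Tails of the increments *)

Section tails_of_increments.
Context (R : realType) (d : measure_display) (Omega : measurableType d).
Variable P : probability Omega R.
Variable X : nat -> {RV P >-> R}.
Hypothesis iidX : iid X.
Variables alpha beta : R.
Hypotheses (a1 : 1 < alpha) (b1 : 1 < beta).

Definition up_tail (y : R) : R := prob P [set w | y <= X 0%N w].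
Definition down_tail (y : R) : R := prob P [set w | X 0%N w <= - y].

Hypothesis up_rv : regularly_varying up_tail (- alpha).
Hypothesis down_rv : regularly_varying down_tail (- beta).

Lemma measurable_up y : measurable [set w | y <= X 0%N w].
Proof. exact: measurable_le_set. Qed.

Lemma measurable_down y : measurable [set w | X 0%N w <= - y].
Proof. exact: measurable_le_set. Qed.

Lemma up_tail_noninc y z : y <= z -> up_tail z <= up_tail y.
Proof.
by move=> yz; apply: prob_le; [exact: measurable_up|exact: measurable_up|move=> w; exact: le_trans].
Qed.

Lemma down_tail_noninc y z : y <= z -> down_tail z <= down_tail y.
Proof.
move=> yz; apply: prob_le; [exact: measurable_down|exact: measurable_down|].
by move=> w /= /le_trans; apply; rewrite lerN2.
Qed.

Let up_pos : \forall x \near +oo, 0 < up_tail x. Proof. by have [] := up_rv. Qed.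
Let down_pos : \forall x \near +oo, 0 < down_tail x. Proof. by have [] := down_rv. Qed.
Let up_lim c : 0 < c -> up_tail (c * x) / up_tail x @[x --> +oo] --> c `^ (- alpha).
Proof. by have [_ _] := up_rv; apply. Qed.
Let down_lim c : 0 < c -> down_tail (c * x) / down_tail x @[x --> +oo] --> c `^ (- beta).
Proof. by have [_ _] := down_rv; apply. Qed.

Lemma inc_tail_up j k (i : 'I_j) y : @inc_tail R d Omega P X j k (inl i) y = up_tail y.
Proof.
by rewrite /inc_tail /up_tail; congr (prob P _); apply/seteqP; split=> w;
  rewrite /= /signed_inc mul1r.
Qed.

Lemma inc_tail_down j k (i : 'I_k) y : @inc_tail R d Omega P X j k (inr i) y = down_tail y.
Proof.
by rewrite /inc_tail /down_tail; congr (prob P _); apply/seteqP; split=> w;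
  rewrite /= /signed_inc mulN1r lerNr.
Qed.

Lemma inc_tail_gt0 j k (h : 'I_j + 'I_k) y : 0 < inc_tail X h y.
Proof.
case: h => i; rewrite ?inc_tail_up ?inc_tail_down.
- exact: (tail_gt0 up_tail_noninc up_pos).
- exact: (tail_gt0 down_tail_noninc down_pos).
Qed.

Lemma inc_tail_ratio j k (h : 'I_j + 'I_k) c : 0 < c ->
  inc_tail X h (c * n%:R) / inc_tail X h n%:R @[n --> \oo] --> c `^ (- jump_index alpha beta h).
Proof.
move=> c0; case: h => i.
- rewrite (_ : (fun n => _) = (fun n => up_tail (c * n%:R) / up_tail n%:R)).
    exact: (tail_ratio_nat up_lim).
  by apply/funext => n; rewrite !inc_tail_up.
- rewrite (_ : (fun n => _) = (fun n => down_tail (c * n%:R) / down_tail n%:R)).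
    exact: (tail_ratio_nat down_lim).
  by apply/funext => n; rewrite !inc_tail_down.
Qed.

Lemma up_le_pow (c eta : R) : 0 < c -> 0 < eta ->
  le_pow (fun n => n%:R * up_tail (c * n%:R)) (1 - alpha + eta).
Proof. exact: (tail_le_pow up_tail_noninc up_pos up_lim). Qed.

Lemma down_le_pow (c eta : R) : 0 < c -> 0 < eta ->
  le_pow (fun n => n%:R * down_tail (c * n%:R)) (1 - beta + eta).
Proof. exact: (tail_le_pow down_tail_noninc down_pos down_lim). Qed.

Lemma normingE2 j k n : norming X j k n =
  (n%:R * up_tail n%:R) ^+ j * (n%:R * down_tail n%:R) ^+ k.
Proof.
rewrite /norming big_sumType/=; congr (_ * _).
  by rewrite (eq_bigr (fun=> n%:R * up_tail n%:R)) ?prodr_const ?card_ord// => i _; rewrite inc_tail_up.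
by rewrite (eq_bigr (fun=> n%:R * down_tail n%:R)) ?prodr_const ?card_ord// => i _; rewrite inc_tail_down.
Qed.

(** The error terms are divided by [norming], so what matters is that [norming] is not too small. *)
Lemma normingV_le_pow j k (eta : R) : 0 < eta ->
  le_pow (fun n => (norming X j k n)^-1) ((alpha - 1 + eta) * j%:R + (beta - 1 + eta) * k%:R).
Proof.
move=> eta0; rewrite (_ : (fun n => _) = (fun n => (n%:R * up_tail n%:R)^-1 ^+ j *
    (n%:R * down_tail n%:R)^-1 ^+ k)); last first.
  by apply/funext => n; rewrite normingE2 invfM !exprVn.
apply: le_powM; apply: le_powX.
- exact: (tailV_le_pow up_tail_noninc up_pos up_lim).
- exact: (tailV_le_pow down_tail_noninc down_pos down_lim).
Qed.

(** Stated through a selection and not through the number of large increments, so that its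
    probability is bounded by a union over [tau]. *)
Definition many_jumps l m (c : R) n : set Omega :=
  [set w | exists tau : {ffun 'I_l + 'I_m -> 'I_n}, injective tau /\
    forall h, c <= signed_inc (fun i => X i w) h (tau h)].

Let many1 l m c n (tau : {ffun 'I_l + 'I_m -> 'I_n}) :
  measurable [set w | injective tau /\ forall h, c <= signed_inc (fun i => X i w) h (tau h)].
Proof.
have [ti|nti] := pselect (injective tau).
  rewrite [X in measurable X](_ : _ = [set w | forall h, c <= signed_inc (fun i => X i w) h (tau h)]).
    apply: (@measurable_set_forall _ _ _ (fun h => [set w | c <= signed_inc (fun i => X i w) h (tau h)])) => h.
    exact: measurable_inc_ge.
  by apply/seteqP; split=> w // [].
by rewrite [X in measurable X](_ : _ = set0)// -subset0 => w [].
Qed.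

Lemma measurable_many_jumps l m c n : measurable (many_jumps l m c n).
Proof. by apply: measurable_set_exists => tau; exact: many1. Qed.

Lemma many_jumps_le l m c n : prob P (many_jumps l m c n) <=
  (n%:R * up_tail c) ^+ l * (n%:R * down_tail c) ^+ m.
Proof.
apply: le_trans; first by apply: prob_exists_le => tau; exact: many1.
apply: (@le_trans _ _ (\sum_(tau : {ffun 'I_l + 'I_m -> 'I_n}) \prod_(h : 'I_l + 'I_m) inc_tail X h c)).
  apply: ler_sum => tau _; have [ti|nti] := pselect (injective tau); last first.
    rewrite [X in prob P X](_ : _ = set0).
      rewrite /prob measure0 /=; apply: prodr_ge0 => h _; exact/ltW/inc_tail_gt0.
    by rewrite -subset0 => w [].
  pose C (h : 'I_l + 'I_m) := `[c, +oo[%classic : set R.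
  have mC (h : 'I_l + 'I_m) : measurable (C h) by exact: measurable_itv.
  have := selection_prob1 iidX ti mC.
  rewrite (_ : [set w | forall h, C h _] = [set w | injective tau /\
      forall h, c <= signed_inc (fun i => X i w) h (tau h)]); last first.
    apply/seteqP; split=> w /=.
      by move=> Cw; split => // h; have := Cw h; rewrite /C /= in_itv/= andbT.
    by move=> [_ cw] h; rewrite /C /= in_itv/= andbT.
  move=> ->; rewrite le_eqVlt; apply/orP; left; apply/eqP; apply: eq_bigr => h _.
  by congr (prob P _); apply/seteqP; split=> w; rewrite /C /= in_itv/= andbT.
rewrite sumr_const card_ffun card_ord card_sum !card_ord big_sumType/=.
rewrite (eq_bigr (fun=> up_tail c)); last by move=> i _; rewrite inc_tail_up.
rewrite [X in _ * X *+ _](eq_bigr (fun=> down_tail c)); last by move=> i _; rewrite inc_tail_down.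
rewrite !prodr_const !card_ord -[leLHS]mulr_natl natrX exprD !exprMn.
by rewrite le_eqVlt; apply/orP; left; apply/eqP; ring.
Qed.

(** The exponents of [n] in the numerator and in the denominator differ by the gap between the costs, up to a multiple of [eta];
    [eta] is chosen so that it does not fill the gap. *)
Lemma many_jumps_negligible l m j k (eps : R) : 0 < eps ->
  jump_cost alpha beta (j, k) < jump_cost alpha beta (l, m) ->
  prob P (many_jumps l m (eps * n%:R) n) / norming X j k n @[n --> \oo] --> (0 : R).
Proof.
move=> eps0; rewrite /jump_cost /= => cost.
pose N : R := l%:R + m%:R + j%:R + k%:R + 1.
have N0 : 0 < N by rewrite ltr_wpDl// !addr_ge0.
pose g : R := (alpha - 1) * l%:R + (beta - 1) * m%:R - ((alpha - 1) * j%:R + (beta - 1) * k%:R).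
have g0 : 0 < g by rewrite subr_gt0.
pose eta := g / (2 * N).
have eta0 : 0 < eta by rewrite divr_gt0// mulr_gt0.
have gE : g = 2 * eta * N by rewrite /eta; field; rewrite gt_eqF.
apply: (@le_pow_cvg0 _ _ ((1 - alpha + eta) * l%:R + (1 - beta + eta) * m%:R +
    ((alpha - 1 + eta) * j%:R + (beta - 1 + eta) * k%:R))).
  have -> : (1 - alpha + eta) * l%:R + (1 - beta + eta) * m%:R +
    ((alpha - 1 + eta) * j%:R + (beta - 1 + eta) * k%:R) = - g + eta * (N - 1).
    by rewrite /g /N; ring.
  have : 0 < eta * N by rewrite mulr_gt0.
  by rewrite gE; move: eta0; set e := eta * N; rewrite mulrBr mulr1 -mulrA -/e; lra.
apply: (@le_pow_sub _ _ (fun n => ((n%:R * up_tail (eps * n%:R)) ^+ l *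
    (n%:R * down_tail (eps * n%:R)) ^+ m) * (norming X j k n)^-1)).
  near=> n; have n0 : (0 < n)%N by near: n; exact: nbhs_infty_gt.
  have norm0 : 0 < (norming X j k n)^-1.
    by rewrite invr_gt0; apply: norming_gt0 => // h y; exact: inc_tail_gt0.
  rewrite !normrM ler_wpM2r// ger0_norm ?prob_ge0// -normrM.
  by rewrite (le_trans (many_jumps_le _ _ _ _))// ler_norm.
apply: le_powM; last exact: normingV_le_pow.
by apply: le_powM; apply: le_powX; [exact: up_le_pow|exact: down_le_pow].
Unshelve. all: by end_near. Qed.

Lemma abs_tail_le (c : R) : prob P [set w | c <= `|X 0%N w|] <= up_tail c + down_tail c.
Proof.
have := probU_le P (measurable_up c) (measurable_down c); apply: le_trans.
apply: prob_le.
- by apply: measurable_le_set => //; exact: measurableT_comp.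
- by apply: measurableU; [exact: measurable_up|exact: measurable_down].
- by move=> w /=; rewrite lter_normr => /orP[h|h]; [left|right; rewrite lerNr].
Qed.

(** Since both indices exceed one, the expected number of increments above [eps * n] tends to
    zero. *)
Lemma typical_small (eps : R) : 0 < eps ->
  n%:R * (1 - prob P [set w | `|X 0%N w| <= eps * n%:R]) @[n --> \oo] --> (0 : R).
Proof.
move=> eps0.
have lu : (fun n => n%:R * up_tail (eps * n%:R)) @ \oo --> (0 : R).
  apply: (le_pow_cvg0 _ (@up_le_pow eps ((alpha - 1) / 2) eps0 _)); last by rewrite divr_gt0// subr_gt0.
  by move: a1; lra.
have ld : (fun n => n%:R * down_tail (eps * n%:R)) @ \oo --> (0 : R).
  apply: (le_pow_cvg0 _ (@down_le_pow eps ((beta - 1) / 2) eps0 _)); last by rewrite divr_gt0// subr_gt0.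
  by move: b1; lra.
have lud : (fun n => n%:R * up_tail (eps * n%:R) + n%:R * down_tail (eps * n%:R)) @ \oo --> (0 : R).
  by have := cvgD lu ld; rewrite addr0; apply.
apply: (@squeeze_cvgr _ _ _ _ (fun=> 0) (fun n => n%:R * up_tail (eps * n%:R) + n%:R * down_tail (eps * n%:R)) _ _ (0 : R)); [|exact: cvg_cst|exact: lud]; near=> n.
have mle : measurable [set w | `|X 0%N w| <= eps * n%:R] by exact: measurable_abs_le.
rewrite mulr_ge0 ?subr_ge0 ?prob_le1//= -mulrDr ler_wpM2l//.
rewrite -prob_setC// (le_trans _ (abs_tail_le _))//; apply: prob_le.
- exact: measurableC.
- by apply: measurable_le_set => //; exact: measurableT_comp.
- by move=> w /= /negP; rewrite -ltNge => /ltW.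
Unshelve. all: by end_near. Qed.

(** Any exponent between one and the smaller of the two indices would do; it is capped by [2], as
    the exponential bounds require. *)
Lemma increment_moment : exists2 p : R, 1 < p <= 2 &
  (\int[P]_w (`|X 0%N w| `^ p)%:E < +oo)%E.
Proof.
pose g := Num.min alpha beta.
have g1 : 1 < g by rewrite lt_min a1.
pose eta := (g - 1) / 2; have eta0 : 0 < eta by rewrite divr_gt0// subr_gt0.
pose q := g - eta.
have q1 : 1 < q by rewrite /q /eta; move: g1; lra.
have [x0 [x00 [C C0 hC]]] := tail_le up_tail_noninc up_pos up_lim eta0.
have [y0 [y00 [D D0 hD]]] := tail_le down_tail_noninc down_pos down_lim eta0.
pose z0 := Num.max x0 y0.
have z00 : 0 < z0 by rewrite lt_max x00.
exists (Num.min 2 ((q + 1) / 2)).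
  by rewrite ge_min lexx/= lt_min ltr1n/=; move: q1; lra.
have tail1 x : 1 <= x -> fine (P [set w | x <= `|X 0%N w|]) <= (C + D + z0 `^ q) * x `^ (- q).
  move=> x1; have x_gt0 : 0 < x by exact: lt_le_trans x1.
  have mx : measurable [set w | x <= `|X 0%N w|].
    by apply: measurable_le_set => //; exact: measurableT_comp.
  have [xz|zx] := ltP x z0.
    apply: (le_trans (prob_le1 P mx)).
    rewrite mulrDl; apply: ler_wpDl.
      by rewrite mulr_ge0 ?powR_ge0// addr_ge0// ltW.
    rewrite powRN ler_pdivlMr ?powR_gt0// mul1r.
    by apply: ge0_ler_powR; rewrite ?nnegrE ?(ltW xz) ?(ltW x_gt0) ?(ltW z00)// ltW// (lt_trans ltr01).
  rewrite (le_trans (abs_tail_le x))// mulrDl ler_wpDr ?mulr_ge0 ?powR_ge0// mulrDl lerD//.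
    rewrite (le_trans (hC x _)) ?(le_trans _ zx) ?le_max ?lexx// ler_pM2l//.
    apply: ler_powR => //; rewrite /q opprB addrC lerD2l lerN2.
    by rewrite /g ge_min lexx.
  rewrite (le_trans (hD x _)) ?(le_trans _ zx) ?le_max ?lexx ?orbT// ler_pM2l//.
  apply: ler_powR => //; rewrite /q opprB addrC lerD2l lerN2.
  by rewrite /g ge_min lexx orbT.
apply: (moment_lty _ _ tail1).
  rewrite lt_min ltr0n/=; apply/andP; split; first by move: q1; lra.
  by rewrite gt_min; apply/orP; right; move: q1; lra.
by rewrite !addr_ge0 ?powR_ge0// ltW.
Qed.

End tails_of_increments.

(** * The walk as a random path *)

Section walk_path.
Context (R : realType) (d : measure_display) (Omega : measurableType d).
Variable P : probability Omega R.
Variable X : nat -> {RV P >-> R}.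

Definition walk_path n w : skorokhod R :=
  Skorokhod (cadlag_truncn (fun k => (\sum_(i < k) X i w) / n%:R) n).

Lemma walk_path_random_walk (S : nat -> {RV P >-> R}) n w : (forall w, S 0%N w = 0) ->
  (forall i w, X i w = S i.+1 w - S i w) -> scaled_walk S n w = walk_path n w.
Proof.
move=> S0 XS; have SE k : S k w = \sum_(i < k) X i w.
  elim: k => [|k IH]; first by rewrite big_ord0 S0.
  by rewrite big_ord_recr/= -IH XS addrC subrK.
by apply: skorokhodP => t /=; rewrite SE.
Qed.

Lemma truncn_time n (t : unit_interval R) : (Num.truncn (n%:R * \val t) < n.+1)%N.
Proof.
have /andP[t0 t1] := unit_interval_itv t.
have nt0 : 0 <= n%:R * \val t by rewrite mulr_ge0.
rewrite ltnS -(ler_nat R); have /andP[h _] := truncn_itv nt0; rewrite (le_trans h)//.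
by rewrite ler_piMr.
Qed.

(** The path depends on finitely many partial sums, continuously for the uniform norm; so the
    preimage of an open set is open in these coordinates. *)
Lemma measurable_walk_path n : measurable_fun setT (walk_path n).
Proof.
apply: (measurability (@open (skorokhod R)) erefl) => _ [U oU <-]; rewrite setTI.
pose co (k : 'I_n.+1) w : R := (\sum_(i < k) X i w) / n%:R.
have mco k : measurable_fun setT (co k).
  by apply: measurable_funM => //; apply: measurable_sum.
apply: (coord_open_measurable mco) => w /= Uw.
have /nbhs_ballP[e /= e0 eU] : nbhs (walk_path n w) U by exact: open_nbhs_nbhs.
exists (e / 2); first by rewrite divr_gt0.
move=> w' ww'; apply: eU; rewrite ballEmdist/= metric_sym.
apply: (@le_lt_trans _ _ (e / 2)); last by move: e0; lra.
apply: mdist_le_sup => t; exact/ltW/(ww' (Ordinal (truncn_time n t))).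
Qed.

Lemma measurable_walk_event n (A : set (skorokhod R)) : measurable A ->
  measurable [set w | A (walk_path n w)].
Proof. by move=> mA; rewrite -[X in measurable X]setTI; exact: measurable_walk_path. Qed.

End walk_path.

(** * Geometry of a set bounded away from cheaper paths *)

Section neighbourhoods.
Variable R : realType.
Implicit Types (A B : set (skorokhod R)) (x y a : skorokhod R).

Lemma bounded_awayP A B : bounded_away A B -> exists2 delta : R, 0 < delta &
  forall x y, A x -> B y -> delta <= mdist x y.
Proof.
rewrite /bounded_away; set S := [set _ | _ in _].
case E : (ereal_inf S) => [r||] r0.
- exists r => // x y Ax By; rewrite -lee_fin -E; apply: ereal_inf_lbound.
  by exists (x, y).
- exists 1 => // x y Ax By; suff : (+oo <= (mdist x y)%:E)%E by rewrite leye_eq.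
  by rewrite -E; apply: ereal_inf_lbound; exists (x, y).
- by [].
Qed.

(** The complement of the closed [rho]-neighbourhood of [A], written with a margin so that it is
    visibly open. *)
Definition away rho A : set (skorokhod R) :=
  [set y | exists2 e, rho < e & forall a, A a -> e <= mdist a y].

Definition deep rho A : set (skorokhod R) :=
  [set y | exists2 e, rho < e & forall y', mdist y y' < e -> A y'].

Lemma open_away rho A : open (away rho A).
Proof.
rewrite openE => y [e re far]; apply/nbhs_ballP.
exists ((e - rho) / 2) => /=; first by rewrite divr_gt0// subr_gt0.
move=> y'; rewrite ballEmdist/= => yy'; exists ((e + rho) / 2); first by lra.
move=> a /far; have := metric_triangle a y' y; rewrite (metric_sym y' y); move: yy' re; lra.
Qed.

Lemma open_deep rho A : open (deep rho A).
Proof.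
rewrite openE => y [e re near]; apply/nbhs_ballP.
exists ((e - rho) / 2) => /=; first by rewrite divr_gt0// subr_gt0.
move=> y'; rewrite ballEmdist/= => yy'; exists ((e + rho) / 2); first by lra.
move=> a ya; apply: near; have := metric_triangle y y' a; move: yy' ya re; lra.
Qed.

Lemma away_le rho rho' A : rho <= rho' -> away rho' A `<=` away rho A.
Proof. by move=> rr y [e re far]; exists e => //; exact: le_lt_trans re. Qed.

Lemma deep_le rho rho' A : rho <= rho' -> deep rho' A `<=` deep rho A.
Proof. by move=> rr y [e re far]; exists e => //; exact: le_lt_trans re. Qed.

Lemma not_awayP rho A a y : A a -> mdist a y <= rho -> ~ away rho A y.
Proof. by move=> Aa ay [e re /(_ a Aa)]; move: re ay; lra. Qed.

Lemma deepP rho A y y' : deep rho A y -> mdist y y' <= rho -> A y'.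
Proof. by move=> [e re near] yy'; apply: near; exact: le_lt_trans re. Qed.

Lemma closure_away A y (rho : nat -> R) : rho @ \oo --> (0 : R) ->
  (forall k, ~ away (rho k) A y) -> closure A y.
Proof.
move=> r0 na B /nbhs_ballP[e /= e0 eB].
have [k rk] : exists k, rho k < e.
  by have [k _ /(_ k (leqnn k))] := cvgr_lt _ r0 _ e0; exists k.
apply: contrapT => AB; apply: (na k); exists e => // a Aa; rewrite leNgt; apply/negP => ay.
by apply: AB; exists a; split => //; apply: eB; rewrite ballEmdist/= metric_sym.
Qed.

Lemma interior_deep A y (rho : nat -> R) : rho @ \oo --> (0 : R) ->
  interior A y -> exists k, deep (rho k) A y.
Proof.
move=> r0 /nbhs_ballP[e /= e0 eA].
have [k _ /(_ k (leqnn k)) rk] := cvgr_lt _ r0 _ e0; by exists k; exists e.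
Qed.

End neighbourhoods.

Section jump_geometry.
Variables (R : realType) (alpha beta : R).
Hypotheses (a1 : 1 < alpha) (b1 : 1 < beta).
Variables (A : set (skorokhod R)) (j k : nat) (delta : R).
Hypothesis far : forall x y, A x -> step_paths_lt alpha beta j k y -> delta <= mdist x y.
Local Notation H := ('I_j + 'I_k)%type.
Local Notation T2 := (j.-tuple R * k.-tuple R)%type.
Local Notation cost := (jump_cost alpha beta).

Let ca : 0 < alpha - 1. Proof. by rewrite subr_gt0. Qed.
Let cb : 0 < beta - 1. Proof. by rewrite subr_gt0. Qed.

Lemma jump_cost_le l m l' m' : (l <= l')%N -> (m <= m')%N -> cost (l, m) <= cost (l', m').
Proof. by move=> ll mm; rewrite /jump_cost /= lerD// ler_pM2l// ler_nat. Qed.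

(** Removing a jump from a path with [j] upward and [k] downward jumps leaves a cheaper step path,
    from which [A] is bounded away; so no jump of a path near [A] is small. *)
Lemma jump_size_ge (z : T2 * T2) h a : (forall g, 0 < pair_coord g z.1 <= 1) ->
  injective (fun g => pair_coord g z.1) -> pos_sizes z.2 -> A a ->
  delta <= mdist a (path_of z) + pair_coord h z.2.
Proof.
move=> z01 zinj zpos Aa.
pose u := split_fun z.1.1 z.1.2.
pose s := fun g : H => jump_sign R g * split_fun z.2.1 z.2.2 g.
pose s' g := if g == h then 0 else s g.
have ss' : mdist (jump_fun u s) (jump_fun u s') <= pair_coord h z.2.
  apply: le_trans (mdist_jump_fun_sizes _ _ _) _.
  rewrite (bigD1 h)//= big1 ?addr0; last first.
    by move=> g gh; rewrite /s' (negbTE gh) subrr normr0.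
  rewrite /s' eqxx subr0 /s normrM.
  have -> : `|jump_sign R h| = 1 by case: (h) => i; rewrite /jump_sign ?normrN normr1.
  by rewrite mul1r gtr0_norm//; exact: zpos.
have sE g : (0 < s g) = (if g is inl _ then true else false).
  have := zpos g; rewrite /s /pair_coord; case: g => i zi; first by rewrite mul1r.
  by rewrite mulN1r oppr_gt0 ltNge (ltW zi).
have sE' g : (s g < 0) = (if g is inl _ then false else true).
  have := zpos g; rewrite /s /pair_coord; case: g => i zi; last by rewrite mulN1r oppr_lt0.
  by rewrite mul1r ltNge (ltW zi).
pose l := #|[pred g | 0 < s' g]|; pose m := #|[pred g | s' g < 0]|.
have st : step_paths l m (jump_fun u s') by apply: jump_fun_step_paths.
have lj : (l <= j)%N.
  have : (#|codom (@inl 'I_j 'I_k)| = j)%N by rewrite card_codom ?card_ord// => ? ? [].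
  move=> card_c; rewrite -[X in (_ <= X)%N]card_c; apply: subset_leq_card; apply/fintype.subsetP => g; rewrite !inE /s'.
  case: ifP => _; first by rewrite ltxx.
  by rewrite sE; case: g => // i _; exact: codom_f.
have mk : (m <= k)%N.
  have : (#|codom (@inr 'I_j 'I_k)| = k)%N by rewrite card_codom ?card_ord// => ? ? [].
  move=> card_c; rewrite -[X in (_ <= X)%N]card_c; apply: subset_leq_card; apply/fintype.subsetP => g; rewrite !inE /s'.
  case: ifP => _; first by rewrite ltxx.
  by rewrite sE'; case: g => // i _; exact: codom_f.
have lm : (l + m < j + k)%N.
  have dis : #|[predI [pred g | 0 < s' g] & [pred g | s' g < 0]]| = 0%N.
    by apply: eq_card0 => g; rewrite !inE; apply/negP => /andP[p q]; have := lt_trans p q; rewrite ltxx.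
  have {dis} -> : (l + m)%N = #|[predU [pred g | 0 < s' g] & [pred g | s' g < 0]]|.
    by rewrite /l /m -cardUI dis addn0.
  have : (#|predC1 h| < j + k)%N.
    have : (#|predC1 h| < #|{: H}|)%N by rewrite cardC1 prednK//; apply/card_gt0P; exists h.
    by rewrite card_sum !card_ord.
  apply: leq_ltn_trans; apply: subset_leq_card; apply/fintype.subsetP => g; rewrite !inE /s'.
  by case: ifP => //; rewrite ltxx.
have lt : step_paths_lt alpha beta j k (jump_fun u s').
  exists (l, m) => //; split; last exact: jump_cost_le.
  by move=> [lE mE]; rewrite lE mE ltnn in lm.
rewrite (le_trans (far Aa lt))// (le_trans (metric_triangle _ (path_of z) _))// lerD2l.
by rewrite /path_of jump_pathE.
Qed.

(** The path of the large increments is too close to [A] to be one of the cheaper step paths. *)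
Lemma jump_counts n c (x : nat -> R) a : 0 <= c -> (0 < n)%N -> A a ->
  mdist a (big_path n c x) < delta ->
  let l := #|[pred i : 'I_n | c < x i]| in let m := #|[pred i : 'I_n | c < - x i]| in
  (l = j /\ m = k) \/ cost (j, k) < cost (l, m).
Proof.
move=> c0 n0 Aa near l m.
have [e|ne] := pselect ((l, m) = (j, k)); first by left; case: e.
right; rewrite ltNge; apply/negP => le; move: near; rewrite ltNge => /negP; apply.
by apply: far => //; exists (l, m) => //; exact: big_path_step_paths.
Qed.

(** Reduces the infinitely many pairs of larger cost to finitely many: an event with [l] and [m] large
    increments is included in those with fewer, so that counts can be capped. *)
Lemma cost_bounded : exists L, forall l m, cost (j, k) < cost (l, m) ->
  cost (j, k) < cost (minn l L, minn m L).
Proof.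
pose c := Num.min (alpha - 1) (beta - 1).
have c0 : 0 < c by rewrite lt_min ca cb.
pose L := (Num.truncn (cost (j, k) / c)).+1.
have big : cost (j, k) < c * L%:R.
  by rewrite mulrC -ltr_pdivrMr//; exact: truncnS_gt.
have biga : cost (j, k) < (alpha - 1) * L%:R.
  by apply: (lt_le_trans big); rewrite ler_wpM2r// ge_min lexx.
have bigb : cost (j, k) < (beta - 1) * L%:R.
  by apply: (lt_le_trans big); rewrite ler_wpM2r// ge_min lexx orbT.
exists L => l m; have [lL|/ltnW Ll] := leqP l L.
  have [mL//|/ltnW Lm] := leqP m L.
  by move=> _; rewrite {2}/jump_cost /= ltr_wpDl// mulr_ge0// ltW.
by move=> _; rewrite {2}/jump_cost /= ltr_wpDr// mulr_ge0// ltW.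
Qed.

End jump_geometry.

(** * Extended limits and measures *)

Section extended_limits.
Variable R : realType.
Local Open Scope ereal_scope.

Lemma lte_fin_between (r : R) (x : \bar R) : r%:E < x -> exists2 g : R, (r < g)%R & g%:E < x.
Proof.
case: x => [s||]//.
- rewrite lte_fin => rs; exists ((r + s) / 2)%R; rewrite ?lte_fin; lra.
- by move=> _; exists (r + 1)%R; [rewrite ltrDl|exact: ltry].
Qed.

Lemma lee_fin_lt (x y : \bar R) : (forall r : R, r%:E < x -> r%:E <= y) -> x <= y.
Proof.
move=> H; rewrite leNgt; apply/negP => yx.
case: y yx H => [s||] yx H.
- have [g sg gx] := lte_fin_between yx; have := H g gx.
  by rewrite lee_fin leNgt sg.
- by rewrite ltNge leey in yx.
- case: x yx H => [s||]// _ H.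
  + by have := H (s - 1)%R; rewrite lte_fin ltrBlDr ltrDl ltr01 => /(_ isT).
  + by have := H 0%R (ltry 0).
Qed.

(** Reduces the two inequalities of the theorem to statements on real numbers, for all large [n]. *)
Lemma limn_einf_ge (u : nat -> R) (L : \bar R) :
  (forall r : R, r%:E < L -> \forall n \near \oo, (r <= u n)%R) ->
  L <= limn_einf (fun n => (u n)%:E).
Proof.
move=> H; apply: lee_fin_lt => r /H [N _ Nr].
rewrite limn_einf_lim; apply: lime_ge; first exact: is_cvg_einfs.
exists N => // n /= Nn; apply: le_ereal_inf_tmp => _ [m /= nm <-].
by rewrite lee_fin; apply: Nr => /=; exact: leq_trans nm.
Qed.

Lemma limn_esup_le (u : nat -> R) (L : \bar R) :
  (forall r : R, L < r%:E -> \forall n \near \oo, (u n <= r)%R) ->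
  limn_esup (fun n => (u n)%:E) <= L.
Proof.
move=> H; rewrite -leeN2 -limn_einfN.
apply: (@limn_einf_ge (fun n => - u n)%R) => r rL.
have [|N _ Nr] := H (- r)%R; first by rewrite EFinN lteNr.
by exists N => // n /Nr; rewrite lerNr.
Qed.

Lemma lt_measure_bigcup d (T : measurableType d) (mu : {measure set T -> \bar R})
    (F : nat -> set T) (r : R) : (forall k, measurable (F k)) ->
  (forall k l, (k <= l)%N -> F k `<=` F l) -> r%:E < mu (\bigcup_k F k) ->
  exists k, r%:E < mu (F k).
Proof.
move=> mF Fle rF.
have cv : (mu \o F) @ \oo --> mu (\bigcup_k F k).
  apply: nondecreasing_cvg_mu => //; first exact: bigcupT_measurable.
  by move=> k l kl; apply/subsetPset; exact: Fle.
apply: contrapT => /forallNP h; move: rF; rewrite ltNge => /negP; apply.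
rewrite -(cvg_lim _ cv)//; apply: lime_le; first by apply/cvg_ex; exists (mu (\bigcup_k F k)).
by near=> k; rewrite leNgt; apply/negP; exact: h.
Unshelve. all: by end_near. Qed.

Lemma le_measure_null d (T : measurableType d) (mu : {measure set T -> \bar R}) (A B N : set T) :
  measurable A -> measurable B -> measurable N -> mu N = 0 -> A `<=` B `|` N -> mu A <= mu B.
Proof.
move=> mA mB mN N0 AB; apply: (@le_trans _ _ (mu (B `|` N))).
  by apply: le_measure; rewrite ?inE//; exact: measurableU.
have : mu (B `|` N) <= mu B + mu N by exact: measureU2.
by rewrite N0 adde0.
Qed.

End extended_limits.

(** * The upper and the lower bound *)

Section walk_limits.
Context (R : realType) (d : measure_display) (Omega : measurableType d).
Variable P : probability Omega R.
Variable X : nat -> {RV P >-> R}.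
Hypothesis iidX : iid X.
Hypothesis X_mean : (\int[P]_w (X 0%N w)%:E = 0)%E.
Variables alpha beta : R.
Hypotheses (a1 : 1 < alpha) (b1 : 1 < beta).
Hypothesis up_rv : regularly_varying (up_tail X) (- alpha).
Hypothesis down_rv : regularly_varying (down_tail X) (- beta).
Variables (A : set (skorokhod R)) (j k : nat) (delta : R).
Hypotheses (mA : measurable A) (delta0 : 0 < delta).
Hypothesis far : forall x y, A x -> step_paths_lt alpha beta j k y -> delta <= mdist x y.

Local Notation H := ('I_j + 'I_k)%type.
Local Notation T2 := (j.-tuple R * k.-tuple R)%type.
Local Notation T := (T2 * T2)%type.
Let a0 : 0 < alpha. Proof. exact: lt_trans a1. Qed.
Let b0 : 0 < beta. Proof. exact: lt_trans b1. Qed.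
Local Notation norming := (@norming R d Omega P X j k).
Local Notation jump_law := (@jump_law R alpha beta a0 b0 j k).
Local Notation jump_coord := (@jump_coord R j k).
Local Notation cost := (jump_cost alpha beta).

Let tail_gt0 (h : H) y : 0 < inc_tail X h y. Proof. exact: (inc_tail_gt0 up_rv down_rv). Qed.
Let tail_ratio (h : H) (c : R) : 0 < c ->
  inc_tail X h (c * n%:R) / inc_tail X h n%:R @[n --> \oo] --> c `^ (- jump_index alpha beta h).
Proof. exact: inc_tail_ratio. Qed.
Let small_typical (eps : R) : 0 < eps ->
  n%:R * (1 - prob P [set w | `|X 0%N w| <= eps * n%:R]) @[n --> \oo] --> (0 : R).
Proof. exact: (typical_small a1 b1 up_rv down_rv). Qed.

Let normn_gt0 n : (0 < n)%N -> 0 < norming n.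
Proof. exact: norming_gt0. Qed.

(** [norming] decays no faster than [n `^ (- (alpha * j + beta * k))]; the exceptional event is taken
    smaller by one more power of [n]. *)
Lemma big_trunc_negligible (rho : R) : 0 < rho ->
  exists2 eps0 : R, 0 < eps0 & forall eps, 0 < eps <= eps0 ->
  (fun n => prob P (big_trunc_sum X (eps * n%:R) (rho * n%:R) n) / norming n) @ \oo --> (0 : R).
Proof.
move=> rho0; have [p p12 Xp] := increment_moment a1 b1 up_rv down_rv.
pose q := alpha * j%:R + beta * k%:R.
have q0 : 0 <= q by rewrite addr_ge0// mulr_ge0// ltW.
have M0 : 0 < q + 1 by rewrite ltr_wpDl.
have [eps0 eps00 small] := small_jumps iidX X_mean p12 Xp rho0 M0.
exists eps0 => // eps epsi.
have nv := normingV_le_pow up_rv down_rv j k (@ltr01 R).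
have := le_powM (small eps epsi) nv.
apply: le_pow_cvg0; rewrite /q !subrK; lra.
Qed.

Let walk := walk_path X.

Lemma mdist_walk_big_path n (c rho : R) w : (0 < n)%N ->
  ~ big_trunc_sum X c (rho * n%:R) n w ->
  mdist (walk n w) (big_path n c (fun i => X i w)) <= rho.
Proof.
move=> n0 nb; apply: mdist_big_path => // i; rewrite ltNge; apply/negP => h.
by apply: nb; exists i.
Qed.

Let pos_times n (x : nat -> R) (tau : {ffun H -> 'I_n}) : (0 < n)%N -> injective tau ->
  (forall g, 0 < pair_coord g (tau_point x tau).1 <= 1) /\
  injective (fun g => pair_coord g (tau_point x tau).1).
Proof.
move=> n0 tinj; split=> [g|g h]; first by rewrite tau_point_time step_time_itv.
by rewrite !tau_point_time => /(step_time_inj n0) /tinj.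
Qed.

Section upper.

(** Large jumps that do not occur when the walk is in [A]. The set is open, so that its mass can be
    bounded from below. *)
Definition miss (rho : R) : set T :=
  [set z | good_times z.1 /\ [set: skorokhod R] (path_of z)] `&`
  ([set z | forall h, delta / 2 < pair_coord h z.2] `&`
   ([set z | ~ sorted_sizes z.2] `|` [set z | good_times z.1 /\ away rho A (path_of z)])).

Let coord_open_unsorted : coord_open jump_coord [set z : T | ~ sorted_sizes z.2].
Proof.
have tr : transitive (>=%R : rel R) by move=> x y z h1 h2; exact: le_trans h2 h1.
have -> : [set z : T | ~ sorted_sizes z.2] =
    [set z | exists ii : {ii : 'I_j * 'I_j | (ii.1 < ii.2)%N},
       jump_coord (inr (inl (sval ii).1)) z < jump_coord (inr (inl (sval ii).2)) z] `|`
    [set z | exists ii : {ii : 'I_k * 'I_k | (ii.1 < ii.2)%N},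
       jump_coord (inr (inr (sval ii).1)) z < jump_coord (inr (inr (sval ii).2)) z].
  apply/seteqP; split=> z /=.
    move=> ns; apply: contrapT => /not_orP[n1 n2]; apply: ns.
    split; apply/(sorted_tnthP _ tr) => i i' ii'; rewrite /= leNgt; apply/negP => lt.
      by apply: n1; exists (exist _ (i, i') ii').
    by apply: n2; exists (exist _ (i, i') ii').
  move=> [] [[[i i'] /= ii']] lt [/(sorted_tnthP _ tr) s1 /(sorted_tnthP _ tr) s2].
    by have := s1 _ _ ii'; rewrite /= leNgt; move: lt; rewrite /jump_coord /pair_coord /= => ->.
  by have := s2 _ _ ii'; rewrite /= leNgt; move: lt; rewrite /jump_coord /pair_coord /= => ->.
by apply: coord_openU; apply: coord_open_exists => ii; exact: coord_open_lt2.
Qed.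

Lemma coord_open_sizes (r : R) : coord_open jump_coord [set z : T | forall h, r < pair_coord h z.2].
Proof.
apply: (coord_open_forall (G := fun h => [set z : T | r < pair_coord h z.2])) => h.
exact: (coord_open_gt (co := jump_coord) (i := inr h)).
Qed.

Lemma coord_open_miss rho : coord_open jump_coord (miss rho).
Proof.
apply: coord_openI; first by apply: coord_open_path; exact: openT.
apply: coord_openI; first exact: coord_open_sizes.
by apply: coord_openU => //; apply: coord_open_path; exact: open_away.
Qed.

Lemma miss_proper rho : miss rho `<=` @proper_jumps R j k.
Proof.
move=> z [[[z01 _] _] [zs _]]; split => // h; apply: lt_trans (zs h).
by rewrite divr_gt0.
Qed.

(** Up to bad truncated sums and up to too many jumps, the walk in [A] provides a selection of
    ordered jumps of sizes at least [delta / 2] whose path is near [A]. *)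
Lemma walk_event_upper (eps rho : R) : 0 < eps -> 0 < rho <= delta / 2 ->
  exists L, forall n w, (0 < n)%N -> A (walk n w) ->
  [\/ big_trunc_sum X (eps * n%:R) (rho * n%:R) n w,
    exists p : 'I_L * 'I_L, cost (j, k) < cost (val p.1, val p.2) /\
      many_jumps X p.1 p.2 (eps * n%:R) n w |
    exists tau : {ffun H -> 'I_n}, injectiveb tau /\
      ((forall h, delta / 2 <= pair_coord h (tau_rv X tau w).2) /\ ~ miss rho (tau_rv X tau w))].
Proof.
move=> eps0 /andP[rho0 rhod]; have [L LP] := cost_bounded a1 b1 j k.
exists L.+1 => n w n0 Aw; pose c := eps * n%:R; pose x i := X i w.
have c0 : 0 <= c by rewrite mulr_ge0// ltW.
have [|nb] := pselect (big_trunc_sum X c (rho * n%:R) n w); first by constructor 1.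
have near := mdist_walk_big_path n0 nb.
have rd : rho < delta by move: rhod delta0; lra.
have [[lj mk]|/LP lt] := jump_counts far c0 n0 Aw (le_lt_trans near rd); last first.
  constructor 2; set l := #|_| in lt; set m := #|_| in lt.
  have lL : (minn l L < L.+1)%N by rewrite ltnS geq_minr.
  have mL : (minn m L < L.+1)%N by rewrite ltnS geq_minr.
  exists (Ordinal lL, Ordinal mL); split => //=.
  have [tau [tinj sel]] := @exists_selection_big R n c x (minn l L) (minn m L) c0 (geq_minl _ _) (geq_minl _ _).
  by exists tau; split => // h; exact/ltW/sel.
constructor 3; have [tau [tinj [sel small] srt]] := @exists_selection_all R n c x j k c0 lj mk.
have pE : path_of (tau_point x tau) = big_path n c x by exact: path_of_tau.
have nR : 0 < n%:R :> R by rewrite ltr0n.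
have szpos : pos_sizes (tau_point x tau).2.
  by move=> h; rewrite tau_point_size divr_gt0// (le_lt_trans c0)//; exact: sel.
exists tau; split; first exact/injectiveP.
have [t1 t2] := pos_times x n0 tinj.
split=> [h|[_ [_ []]]].
- have := jump_size_ge a1 b1 far h t1 t2 szpos Aw.
  by rewrite pE; move: near rhod; rewrite -/x -/c; lra.
- by apply.
- by move=> [_]; apply: not_awayP Aw _; rewrite pE.
Qed.

(** The mass outside [miss] is the explicit mass of the large jumps minus the mass of [miss]; an
    upper limit for the former and a lower limit for the latter are enough. *)
Lemma walk_upper (rho q g : R) : 0 < rho <= delta / 2 -> (g%:E < jump_law (miss rho))%E ->
  (\prod_(h : H) (delta / 2) `^ (- jump_index alpha beta h) - g < q) ->
  \forall n \near \oo, prob P [set w | A (walk n w)] / norming n <= q.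
Proof.
move=> rhod gm vq; have rho0 : 0 < rho by case/andP: rhod.
have [eps eps0 trunc0] := big_trunc_negligible rho0.
have [L LP] := walk_event_upper eps0 rhod.
have d2 : 0 < delta / 2 by rewrite divr_gt0.
have [v vl vle] := far_upper_limit iidX tail_gt0 tail_ratio d2.
have lower := open_lower iidX tail_gt0 tail_ratio small_typical
  (@coord_open_miss rho) (@miss_proper rho) eps0 gm.
pose E n (tau : {ffun H -> 'I_n}) :=
  [set w | forall h, delta / 2 <= pair_coord h (tau_rv X tau w).2].
pose G n (tau : {ffun H -> 'I_n}) := [set w | miss rho (tau_rv X tau w)].
pose many n (p : 'I_L * 'I_L) := [set w | cost (j, k) < cost (val p.1, val p.2) /\
   many_jumps X p.1 p.2 (eps * n%:R) n w].
pose u n := prob P (big_trunc_sum X (eps * n%:R) (rho * n%:R) n) / norming n +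
  (\sum_p prob P (many n p) / norming n + v n).
have mmany n p : measurable (many n p).
  have [c|c] := boolP (cost (j, k) < cost (val p.1, val p.2)).
    rewrite (_ : many n p = many_jumps X p.1 p.2 (eps * n%:R) n); first exact: measurable_many_jumps.
    by apply/seteqP; split=> w //= [].
  by rewrite (_ : many n p = set0)// -subset0 => w [h]; rewrite h in c.
have mE n tau : measurable (@E n tau).
  have m2 : measurable [set z : T | forall h, delta / 2 <= pair_coord h z.2].
    apply: (@measurable_set_forall _ _ _ (fun h => [set z : T | delta / 2 <= pair_coord h z.2])) => h.
    by apply: measurable_le_set => //; exact: (@measurable_jump_coord R j k (inr h)).
  by have := @measurable_tau_rv _ _ _ P X j k n tau measurableT _ m2; rewrite setTI.
have mG n tau : measurable (@G n tau).
  rewrite -[X in measurable X]setTI; apply: measurable_tau_rv => //.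
  exact: (coord_open_measurable (@measurable_jump_coord R j k) (@coord_open_miss rho)).
have ul : u @ \oo --> (0 + (\sum_(p : 'I_L * 'I_L) 0 +
    \prod_(h : H) (delta / 2) `^ (- jump_index alpha beta h)) : R).
  apply: cvgD; first by apply: trunc0; rewrite eps0 lexx.
  apply: cvgD; last exact: vl.
  apply: (@cvg_sum_fin R _ xpredT (fun p n => prob P (many n p) / norming n)) => p _.
  have [c|c] := boolP (cost (j, k) < cost (val p.1, val p.2)).
    rewrite (_ : (fun n => _) = fun n => prob P (many_jumps X p.1 p.2 (eps * n%:R) n) / norming n).
      exact: (many_jumps_negligible iidX up_rv down_rv eps0 c).
    apply/funext => n; congr (prob P _ / _).
    by apply/seteqP; split=> w //= [].
  rewrite (_ : (fun n => _) = fun=> 0); first exact: cvg_cst.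
  apply/funext => n; rewrite (_ : many n p = set0) /prob ?measure0 ?mul0r//.
  by rewrite -subset0 => w [h]; rewrite h in c.
rewrite big1// !add0r in ul.
have uq := cvgr_lt _ ul _ (_ : _ < q + g).
near=> n.
have n0 : (0 < n)%N by near: n; exact: nbhs_infty_gt.
have norm0 : 0 < (norming n)^-1 by rewrite invr_gt0 normn_gt0.
pose D (tau : {ffun H -> 'I_n}) := [set w | injectiveb tau /\ (E n tau w /\ ~ G n tau w)].
have mD tau : measurable (D tau).
  rewrite /D; case: (injectiveb tau); last by rewrite [X in measurable X](_ : _ = set0)// -subset0 => w [].
  rewrite [X in measurable X](_ : _ = E n tau `\` G n tau); first exact: measurableD.
  by apply/seteqP; split=> w //= [].
have mB := measurable_big_trunc_sum X (eps * n%:R) (rho * n%:R) n.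
have mM : measurable [set w | exists p, many n p w] by exact: measurable_set_exists.
have mDD : measurable [set w | exists tau, D tau w] by exact: measurable_set_exists.
have inc : prob P [set w | A (walk n w)] <=
    prob P (big_trunc_sum X (eps * n%:R) (rho * n%:R) n) +
    (\sum_p prob P (many n p) + \sum_tau prob P (D tau)).
  apply: (@le_trans _ _ (prob P (big_trunc_sum X (eps * n%:R) (rho * n%:R) n `|`
      ([set w | exists p, many n p w] `|` [set w | exists tau, D tau w])))).
    apply: prob_le; first exact: (measurable_walk_event X n mA).
      by apply: measurableU; [exact: mB|exact: measurableU].
    by move=> w /= /(LP n w n0)[|?|?]; [left|right; left|right; right].
  apply: (le_trans (probU_le _ mB (measurableU _ _ mM mDD))).
  rewrite lerD2l; apply: (le_trans (probU_le _ mM mDD)).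
  apply: lerD; first by exact: prob_exists_le (mmany n).
  exact: prob_exists_le mD.
have DE : \sum_tau prob P (D tau) <= \sum_(tau : {ffun H -> 'I_n} | injectiveb tau) prob P (E n tau) -
    \sum_(tau : {ffun H -> 'I_n} | injectiveb tau) prob P [set w | miss rho (tau_rv X tau w) /\ others_small X (eps * n%:R) tau w].
  rewrite -sumrB [leRHS]big_mkcond/=; apply: ler_sum => tau _; case: ifPn => ti; last first.
    rewrite (_ : D tau = set0) /prob ?measure0//.
    by rewrite -subset0 => w [h]; rewrite h in ti.
  rewrite lerBrDr.
  have mO := measurable_others_small X (eps * n%:R) tau.
  rewrite -probU//; last 2 first.
  - exact: measurableI (mG n tau) mO.
  - by rewrite -subset0 => w [[_ [_ ng]] [g' _]].
  apply: prob_le => //.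
    by apply: measurableU => //; exact: measurableI (mG n tau) mO.
  move=> w [[_ []//]|[/= [_ [zs _]] _] h]; exact/ltW/zs.
apply: (@le_trans _ _ (u n - g)); last first.
  by rewrite lerBlDr; apply/ltW; near: n; apply: uq; move: vq; lra.
rewrite /u -mulr_suml -!addrA.
apply: (@le_trans _ _ ((prob P (big_trunc_sum X (eps * n%:R) (rho * n%:R) n) +
    (\sum_p prob P (many n p) + \sum_tau prob P (D tau))) / norming n)).
  by rewrite ler_pM2r.
rewrite !mulrDl lerD2l lerD2l.
apply: (@le_trans _ _ ((\sum_(tau : {ffun H -> 'I_n} | injectiveb tau) prob P (E n tau) -
    \sum_(tau : {ffun H -> 'I_n} | injectiveb tau) prob P [set w | miss rho (tau_rv X tau w) /\ others_small X (eps * n%:R) tau w]) / norming n)).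
  by rewrite ler_pM2r.
rewrite mulrBl; apply: lerB; first exact: vle.
by apply/ltW; near: n; exact: lower.
Unshelve. all: by end_near. Qed.

End upper.

Section lower.

(** An open set of jumps that forces the walk into [A]: [deep] leaves room for the truncated sums,
    and strict order makes the selection unique. *)
Definition hit (rho : R) : set T :=
  [set z | good_times z.1 /\ deep rho A (path_of z)] `&`
  ([set z | forall h, delta / 2 < pair_coord h z.2] `&` [set z | ssorted_sizes z.2]).

Let coord_open_ssorted : coord_open jump_coord [set z : T | ssorted_sizes z.2].
Proof.
have tr : transitive (>%R : rel R) by move=> x y z h1 h2; exact: lt_trans h2 h1.
have -> : [set z : T | ssorted_sizes z.2] =
    [set z | forall ii : {ii : 'I_j * 'I_j | (ii.1 < ii.2)%N},
       jump_coord (inr (inl (sval ii).2)) z < jump_coord (inr (inl (sval ii).1)) z] `&`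
    [set z | forall ii : {ii : 'I_k * 'I_k | (ii.1 < ii.2)%N},
       jump_coord (inr (inr (sval ii).2)) z < jump_coord (inr (inr (sval ii).1)) z].
  apply/seteqP; split=> z /=.
    by move=> [/(sorted_tnthP _ tr) s1 /(sorted_tnthP _ tr) s2]; split=> -[[i i'] /= ii'];
      [exact: s1|exact: s2].
  move=> [s1 s2]; split; apply/(sorted_tnthP _ tr) => i i' ii'.
    exact: (s1 (exist _ (i, i') ii')).
  exact: (s2 (exist _ (i, i') ii')).
by apply: coord_openI; apply: coord_open_forall => ii; exact: coord_open_lt2.
Qed.

Lemma coord_open_hit rho : coord_open jump_coord (hit rho).
Proof.
apply: coord_openI; first by apply: coord_open_path; exact: open_deep.
by apply: coord_openI => //; exact: coord_open_sizes.
Qed.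

Lemma hit_proper rho : hit rho `<=` @proper_jumps R j k.
Proof.
move=> z [[[z01 _] _] [zs _]]; split => // h; apply: lt_trans (zs h).
by rewrite divr_gt0.
Qed.

Let hit_selects (eps rho : R) n (tau : {ffun H -> 'I_n}) w : (0 < n)%N -> eps <= delta / 2 ->
  hit rho (tau_rv X tau w) -> others_small X (eps * n%:R) tau w ->
  selects_all (eps * n%:R) (fun i => X i w) tau.
Proof.
move=> n0 ed [_ [zs _]] small; split => // h; have nR : 0 < n%:R :> R by rewrite ltr0n.
have := zs h; rewrite tau_point_size ltr_pdivlMr//; apply: le_lt_trans.
by rewrite ler_pM2r.
Qed.

(** The events of different selections are disjoint, so their probabilities add up to at most that
    of the walk in [A] or of bad truncated sums. *)
Lemma walk_lower (rho r g : R) : 0 < rho -> (g%:E < jump_law (hit rho))%E -> r < g ->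
  \forall n \near \oo, r <= prob P [set w | A (walk n w)] / norming n.
Proof.
move=> rho0 gh rg.
have [eps1 eps10 trunc0] := big_trunc_negligible rho0.
pose eps := Num.min eps1 (delta / 2).
have eps0 : 0 < eps by rewrite lt_min eps10 divr_gt0.
have ed : eps <= delta / 2 by rewrite ge_min lexx orbT.
have eps1i : 0 < eps <= eps1 by rewrite eps0 ge_min lexx.
have lower := open_lower iidX tail_gt0 tail_ratio small_typical
  (@coord_open_hit rho) (@hit_proper rho) eps0 gh.
have err := cvgr_lt _ (trunc0 _ eps1i) _ (_ : 0 < g - r).
near=> n.
have n0 : (0 < n)%N by near: n; exact: nbhs_infty_gt.
have norm0 : 0 < (norming n)^-1 by rewrite invr_gt0 normn_gt0.
have mB := measurable_big_trunc_sum X (eps * n%:R) (rho * n%:R) n.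
have mW := measurable_walk_event X n mA.
have low : g < (\sum_(tau : {ffun H -> 'I_n} | injectiveb tau) prob P
    [set w | hit rho (tau_rv X tau w) /\ others_small X (eps * n%:R) tau w]) / norming n.
  by near: n; exact: lower.
have small : prob P (big_trunc_sum X (eps * n%:R) (rho * n%:R) n) / norming n < g - r.
  by near: n; apply: err; rewrite subr_gt0.
pose F (tau : {ffun H -> 'I_n}) :=
  [set w | hit rho (tau_rv X tau w) /\ others_small X (eps * n%:R) tau w].
have mF tau : measurable (F tau).
  have mh := coord_open_measurable (@measurable_jump_coord R j k) (@coord_open_hit rho).
  apply: measurableI; last exact: measurable_others_small.
  by have := @measurable_tau_rv _ _ _ P X j k n tau measurableT _ mh; rewrite setTI.
pose D (tau : {ffun H -> 'I_n}) := [set w | injectiveb tau /\ F tau w].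
have mD tau : measurable (D tau).
  rewrite /D; case: (injectiveb tau); last by rewrite [X in measurable X](_ : _ = set0)// -subset0 => w [].
  by rewrite [X in measurable X](_ : _ = F tau)//; apply/seteqP; split=> w //= [].
have disj tau tau' w : D tau w -> D tau' w -> tau = tau'.
  move=> [_ [h1 s1]] [_ [h2 s2]]; have c0 : 0 <= eps * n%:R by rewrite mulr_ge0// ltW.
  apply: (selection_unique c0 (hit_selects n0 ed h1 s1) (hit_selects n0 ed h2 s2)).
    by have [_ []] := h1.
  by have [_ []] := h2.
have inc : prob P [set w | exists tau, D tau w] <= prob P [set w | A (walk n w)] +
    prob P (big_trunc_sum X (eps * n%:R) (rho * n%:R) n).
  apply: le_trans (probU_le _ mW mB); apply: prob_le.
  - exact: measurable_set_exists.
  - exact: measurableU.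
  move=> w [tau [/injectiveP tinj [ht sm]]].
  have [|nb] := pselect (big_trunc_sum X (eps * n%:R) (rho * n%:R) n w); [by right|left].
  have [sel others] := hit_selects n0 ed ht sm.
  have [[_ dp] _] := ht; apply: (deepP dp).
  rewrite metric_sym (_ : path_of _ = big_path n (eps * n%:R) (fun i => X i w)).
    exact: mdist_walk_big_path.
  exact: path_of_tau.
rewrite (prob_exists P mD disj) in inc.
have sumD : \sum_tau prob P (D tau) = \sum_(tau : {ffun H -> 'I_n} | injectiveb tau) prob P (F tau).
  rewrite [RHS]big_mkcond/=; apply: eq_bigr => tau _; rewrite /D; case: ifPn => ti.
    by congr (prob P _); apply/seteqP; split=> w //= [].
  by rewrite (_ : [set w | _] = set0) /prob ?measure0// -subset0 => w [].
rewrite sumD in inc.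
rewrite -(ler_pM2r norm0) mulrDl in inc.
rewrite -lerBlDr in inc; apply: le_trans _ inc; rewrite lerBrDr.
by apply/ltW; apply: lt_trans low; rewrite -ltrBrDl.
Unshelve. all: by end_near. Qed.

End lower.

Section vanishing_neighbourhood.

Let rho (m : nat) : R := delta / 2 * harmonic m.

Let rho_gt0 m : 0 < rho m.
Proof. by apply: mulr_gt0; [exact: divr_gt0|exact: harmonic_gt0]. Qed.

Let rho_le m : 0 < rho m <= delta / 2.
Proof.
rewrite rho_gt0; have h1 : harmonic m <= 1 :> R by rewrite /harmonic /= invf_le1// ler1n.
have d0 : 0 <= delta / 2 by rewrite divr_ge0// ltW.
by have := ler_wpM2l d0 h1; rewrite mulr1.
Qed.

Let rho_noninc m n : (m <= n)%N -> rho n <= rho m.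
Proof.
move=> mn; rewrite /rho ler_pM2l ?divr_gt0// /harmonic /= lef_pV2 ?posrE//.
by rewrite ler_nat.
Qed.

Let rho_cvg0 : rho @ \oo --> (0 : R).
Proof. by rewrite -(mulr0 (delta / 2)); apply: cvgM; [exact: cvg_cst|exact: cvg_harmonic]. Qed.

Let mjc := @measurable_jump_coord R j k.

Let measurable_sizes (B : set T2) : measurable B -> measurable [set z : T | B z.2].
Proof. by move=> mB; have := @measurable_snd _ _ T2 T2 measurableT _ mB; rewrite setTI. Qed.

Let measurable_times (B : set T2) : measurable B -> measurable [set z : T | B z.1].
Proof. by move=> mB; have := @measurable_fst _ _ T2 T2 measurableT _ mB; rewrite setTI. Qed.

Let measurable_pos : measurable [set z : T | pos_sizes z.2].
Proof. exact: (coord_open_measurable mjc (@coord_open_sizes 0)). Qed.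

Let measurable_srt : measurable [set z : T | sorted_sizes z.2].
Proof. by apply: measurable_sizes; exact: measurable_sorted_sizes. Qed.

Lemma measurable_path_set_open (B : set (skorokhod R)) : open B ->
  measurable (@path_set R j k B).
Proof.
move=> oB; rewrite (_ : path_set B = [set z | good_times z.1 /\ B (path_of z)] `&` [set z | pos_sizes z.2]).
  by apply: measurableI => //; exact: (coord_open_measurable mjc (coord_open_path oB)).
by apply/seteqP; split=> z /= [] => [? ? ?|[? ?] ?].
Qed.

Lemma measurable_path_set_closed (B : set (skorokhod R)) : closed B ->
  measurable (@path_set R j k B).
Proof.
move=> cB; rewrite (_ : path_set B = path_set setT `\` path_set (~` B)).
  by apply: measurableD; apply: measurable_path_set_open; [exact: openT|exact: closed_openC].
apply/seteqP; split=> z /=; first by move=> [? ? Bz]; split=> // -[].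
by move=> [[? ? _] nB]; split => //; apply: contrapT => nBz; exact: nB.
Qed.

(** As [rho] decreases to [0], the sets [hit] increase to the ordered jumps with a path in the
    interior of [A], up to ties between sizes. That sizes exceed [delta / 2] is automatic for paths
    in [A], by [jump_size_ge]. *)
Lemma interior_lower :
  (limit_measure alpha beta j k (interior A) <=
    limn_einf (fun n => (prob P [set w | A (walk n w)] / norming n)%:E))%E.
Proof.
have mint := measurable_path_set_open (@open_interior _ A).
rewrite (limit_measureE a0 b0 mint); apply: limn_einf_ge => r rl.
have [g rg gl] := lte_fin_between rl.
have mhit m : measurable (hit (rho m)) by exact: (coord_open_measurable mjc (@coord_open_hit _)).
have [mties ties0] := @size_ties_null R alpha beta a0 b0 j k.
have [m gm] : exists m, (g%:E < jump_law (hit (rho m)))%E.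
  apply: (lt_measure_bigcup (mu := jump_law) mhit).
    move=> m n mn z [[gt dp] rest]; split => //; split => //.
    exact: deep_le (rho_noninc mn) _ dp.
  apply: (lt_le_trans gl); apply: (@le_measure_null _ _ _ jump_law _ _ [set z : T | size_ties z.2]).
  - exact: measurableI.
  - exact: bigcupT_measurable.
  - exact: measurable_sizes.
  - exact: jump_law_null2.
  move=> z [[gt zpos iA] srt].
  have [tz|nt] := pselect (size_ties z.2); [by right|left].
  have [m dm] := interior_deep rho_cvg0 iA.
  exists m => //; split => //; split; last exact: sorted_sizes_ties.
  move=> h; have [t01 tne] := gt.
  have := @jump_size_ge R alpha beta a1 b1 A j k delta far z h (path_of z).
  rewrite mdistxx add0r => dz; apply: lt_le_trans (dz _ _ zpos (interior_subset iA)).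
  - by move: delta0; lra.
  - by move=> f; have /andP[-> /ltW] := t01 f.
  - move=> f f' ff; apply/eqP; apply: contrapT => /negP ne; exact: (tne f f').
exact: (walk_lower (rho_gt0 m) gm rg).
Qed.

(** As [rho] decreases to [0], the sets [miss] increase to all large jumps but those that are
    ordered with a path in the closure of [A], up to null sets. *)
Lemma closure_upper :
  (limn_esup (fun n => (prob P [set w | A (walk n w)] / norming n)%:E) <=
    limit_measure alpha beta j k (closure A))%E.
Proof.
have mcl := measurable_path_set_closed (@closed_closure _ A).
rewrite (limit_measureE a0 b0 mcl); apply: limn_esup_le => q.
set W := _ `&` _ => Wq.
have mW : measurable W by exact: measurableI.
pose c := delta / 2; have c0 : 0 < c by rewrite divr_gt0.
pose e : R := \prod_(h : H) c `^ (- jump_index alpha beta h).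
pose E := [set z : T | (forall h : H, setT (pair_coord h z.1)) /\
  (forall h : H, `[c, +oo[%classic (pair_coord h z.2))].
have eE : jump_law E = e%:E.
  have := @jump_law_box R alpha beta a0 b0 j k (fun=> setT) (fun=> `[c, +oo[%classic)
    (fun=> 1) (fun h => c `^ (- jump_index alpha beta h)).
  rewrite big1// mul1r; apply => //.
  - by move=> h; exact: probability_setT.
  - by move=> i; exact: nu_ray.
  - by move=> i; exact: nu_ray.
pose N := [set z : T | (~` @good_times R j k) z.1] `|`
  [set z : T | exists h : H, pair_coord h z.2 = c].
have mc : measurable [set p : T2 | exists h : H, pair_coord h p = c].
  apply: measurable_set_exists => h; have := measurable_pair_coord h measurableT (measurable_set1 c).
  by rewrite setTI.
have mbad : measurable (~` @good_times R j k) by apply: measurableC; exact: measurable_good_times.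
have mN : measurable N.
  by apply: measurableU; [exact: measurable_times|exact: (measurable_sizes mc)].
have N0 : jump_law N = 0%E.
  apply: null_setU; [exact: measurable_times|exact: (measurable_sizes mc)| |].
    by apply: jump_law_null1 => //; exact: times_law_bad.
  apply: (@jump_law_null2 R alpha beta a0 b0 j k _ mc); apply: null_set_exists => h.
    by have := measurable_pair_coord h measurableT (measurable_set1 c); rewrite setTI.
  by apply: (@pair_coord_null _ _ _ (nu_measure a0) (nu_measure b0) h [set c]) => //; exact: nu_set1.
have mmiss m : measurable (miss (rho m)) by exact: (coord_open_measurable mjc (@coord_open_miss _)).
have mmiss' : measurable (\bigcup_m miss (rho m)) by exact: bigcupT_measurable.
have mE : measurable E.
  apply: measurableI; first by rewrite [X in measurable X](_ : _ = setT)//; apply/seteqP; split.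
  apply: (@measurable_set_forall _ _ _ (fun h => [set z : T | `[c, +oo[%classic (pair_coord h z.2)])) => h.
  by have := mjc (inr h) measurableT (measurable_itv `[c, +oo[); rewrite setTI.
have cover : (e%:E <= jump_law (\bigcup_m miss (rho m)) + jump_law W)%E.
  rewrite -eE; apply: (@le_trans _ _ (jump_law (\bigcup_m miss (rho m) `|` W))); last exact: measureU2.
  apply: (@le_measure_null _ _ _ jump_law _ _ N mE (measurableU _ _ mmiss' mW) mN N0).
  move=> z [_ Ez]; have [Nz|nN] := pselect (N z); [by right|left].
  have [mz|nm] := pselect ((\bigcup_m miss (rho m)) z); [by left|right].
  have gt : good_times z.1 by apply: contrapT => h; apply: nN; left.
  have cz h : c < pair_coord h z.2.
    rewrite lt_def; apply/andP; split.
      by apply/eqP => zc; apply: nN; right; exists h.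
    by have := Ez h; rewrite /= in_itv/= andbT.
  split; last first.
    apply: contrapT => ns; apply: nm; exists 0%N => //; split => //; split => //.
    by left.
  split => //; first by move=> h; exact: lt_trans (cz h).
  apply: (closure_away rho_cvg0) => m am; apply: nm; exists m => //.
  by split => //; split => //; right.
have [w wE] : exists w : R, jump_law W = w%:E.
  have W0 : (0 <= jump_law W)%E by exact: measure_ge0.
  exists (fine (jump_law W)); rewrite fineK// ge0_fin_numE// (lt_trans Wq)//; exact: ltry.
rewrite wE lte_fin in Wq; rewrite wE in cover.
(* Half of the room between [w] and [q] goes to the mass, the other half to the convergence in [n]. *)
have [m gm] : exists m, ((e - (w + q) / 2)%:E < jump_law (miss (rho m)))%E.
  apply: (lt_measure_bigcup (mu := jump_law) mmiss).
    move=> m n mn z [gz [sz h]]; split => //; split => //.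
    case: h => [|[gt az]]; [by left|right; split => //].
    exact: away_le (rho_noninc mn) _ az.
  rewrite -leeBlDr// -EFinB in cover; apply: lt_le_trans cover.
  by rewrite lte_fin; lra.
by apply: (walk_upper (rho_le m) gm); rewrite -/c -/e; lra.
Qed.

End vanishing_neighbourhood.

End walk_limits.

Theorem theorem4p1 (R : realType) (d : measure_display)
    (Omega : measurableType d) (P : probability Omega R)
    (S : nat -> {RV P >-> R}) (alpha beta : R) (A : set (skorokhod R))
    (J K : nat) :
  random_walk S ->
  ('E_P[S 1%N] = 0)%E ->
  1 < alpha -> 1 < beta ->
  regularly_varying (fun x => fine (P [set w | x <= S 1%N w])) (- alpha) ->
  regularly_varying (fun x => fine (P [set w | S 1%N w <= - x])) (- beta) ->
  measurable A ->
  argmin_jump_cost alpha beta A (J, K) ->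
  bounded_away A (step_paths_lt alpha beta J K) ->
  let ratio (n : nat) : R :=
    fine (P [set w | A (scaled_walk S n w)]) /
    ((n%:R * fine (P [set w | n%:R <= S 1%N w])) ^+ J *
     (n%:R * fine (P [set w | S 1%N w <= - n%:R])) ^+ K) in
  (limit_measure alpha beta J K (interior A) <= limn_einf (fun n => (ratio n)%:E))%E /\
  (limn_esup (fun n => (ratio n)%:E) <= limit_measure alpha beta J K (closure A))%E.
Proof.
move=> [S0 iidS] ES a1 b1 up_rv down_rv mA _ /bounded_awayP[delta delta0 far] ratio.
have [X [XE iidX]] : exists X : nat -> {RV P >-> R},
    (forall i w, X i w = S i.+1 w - S i w) /\ iid X.
  by exists (fun i => S i.+1 - S i : {mfun Omega >-> R}).
have X0 w : X 0%N w = S 1%N w by rewrite XE S0 subr0.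
have upE : (fun x => fine (P [set w | x <= S 1%N w])) = up_tail X.
  by apply/funext => x; congr (prob P _); apply/seteqP; split=> w /=; rewrite X0.
have downE : (fun x => fine (P [set w | S 1%N w <= - x])) = down_tail X.
  by apply/funext => x; congr (prob P _); apply/seteqP; split=> w /=; rewrite X0.
rewrite upE in up_rv; rewrite downE in down_rv.
have X_mean : (\int[P]_w (X 0%N w)%:E = 0)%E.
  by rewrite -ES unlock; apply: eq_integral => w _; rewrite X0.
have ratioE : (fun n => (ratio n)%:E) =
    (fun n => (prob P [set w | A (walk_path X n w)] / norming X J K n)%:E).
  apply/funext => n; congr (_%:E); rewrite /ratio normingE2; congr (_ / _).
    by congr (prob P _); apply/seteqP; split=> w /=; rewrite (walk_path_random_walk n w S0 XE).
  by rewrite -[in RHS]upE -[in RHS]downE.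
rewrite ratioE; split.
  exact: (interior_lower iidX X_mean a1 b1 up_rv down_rv mA delta0 far).
exact: (closure_upper iidX X_mean a1 b1 up_rv down_rv mA delta0 far).
Qed.
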